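(* Let $\Omega\subset\mathbb{R}^d$ be a non-empty open bounded set, $k\in\mathbb{N}_0$, $0<\alpha\le1$ and $(E,\|\cdot\|_E)$ a Banach space over $\mathbb{K}$. Then the following assertions hold. (a) $(\mathcal{C}^{k,\alpha}(\overline{\Omega},E),\|\cdot\|^E,\tau_{|\cdot|^E_{\mathcal{C}^k(\overline\Omega)}})$ is a C-sequential Saks space, $\tau_{|\cdot|^E_{\mathcal{C}^k(\overline\Omega)}}=\tau^E_{\mathcal{K}_{k,\overline\Omega_{\mathrm{wd}}}}$ on $\|\cdot\|^E$-bounded sets and $\gamma(\|\cdot\|^E,\tau_{|\cdot|^E_{\mathcal{C}^k(\overline\Omega)}})=\gamma(\|\cdot\|^E,\tau^E_{\mathcal{K}_{k,\overline\Omega_{\mathrm{wd}}}})$. Suppose for (b)--(c) that $\Omega$ has Lipschitz boundary if $k\ge1$. (b) If $E=\mathbb{K}$, then $(\mathcal{C}^{k,\alpha}(\overline\Omega),\|\cdot\|,\tau_{|\cdot|_{\mathcal{C}^k(\overline\Omega)}})$ is semi-Montel and $\gamma(\|\cdot\|,\tau_{|\cdot|_{\mathcal{C}^k(\overline\Omega)}})=\gamma_{\mathrm{s}}(\|\cdot\|,\tau_{\mathcal{S}})$ for $\mathcal{S}\in\{\mathcal{N}_{k,\overline\Omega_{\mathrm{wd}}},\mathcal{K}_{k,\overline\Omega_{\mathrm{wd}}}\}$. (c) $\mathcal{C}^{k,\alpha}(\overline\Omega,E)=\mathcal{C}^{k,\alpha}(\overline\Omega,E)_\sigma$ and $(\mathcal{C}^{k,\alpha}(\overline\Omega,E),\|\cdot\|^E,\tau_{|\cdot|^E_{\mathcal{C}^k(\overline\Omega)}})$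 is complete.
   Context: $\mathbb{K}\in\{\mathbb{R},\mathbb{C}\}$. Function spaces. $\mathcal{C}^k(\overline\Omega,E)$ is the space of $k$-times continuously partially differentiable functions $f\colon\Omega\to E$ such that $(\partial^\beta)^Ef$ extends continuously to $\overline\Omega$ for all $\beta\in\mathbb{N}_0^d$, $|\beta|\le k$ (the extension is denoted by the same symbol), with norm $|f|^E_{\mathcal{C}^k(\overline\Omega)}:=\sup_{x\in\Omega,\,|\beta|\le k}\|(\partial^\beta)^Ef(x)\|_E$. Then $\mathcal{C}^{k,\alpha}(\overline\Omega,E):=\{f\in\mathcal{C}^k(\overline\Omega,E):\|f\|^E<\infty\}$ with \[\|f\|^E:=|f|^E_{\mathcal{C}^k(\overline\Omega)}+\sup_{|\beta|=k}\ \sup_{x,y\in\Omega,\,x\ne y}\frac{\|(\partial^\beta)^Ef(x)-(\partial^\beta)^Ef(y)\|_E}{|x-y|^\alpha}.\] $\mathcal{C}^{k,\alpha}(\overline\Omega):=\mathcal{C}^{k,\alpha}(\overline\Omega,\mathbb{K})$, $\|\cdot\|:=\|\cdot\|^{\mathbb{K}}$, $|\cdot|_{\mathcal{C}^k(\overline\Omega)}:=|\cdot|^{\mathbb{K}}_{\mathcal{C}^k(\overline\Omega)}$. $\tau_{|\cdot|^E_{\mathcal{C}^k(\overline\Omega)}}$ is the topology on $\mathcal{C}^{k,\alpha}(\overline\Omega,E)$ induced by the norm $|\cdot|^E_{\mathcal{C}^k(\overline\Omega)}$. The weak version is $\mathcal{C}^{k,\alpha}(\overline\Omega,E)_\sigma:=\{f\colon\Omega\to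 E:e^*\circ f\in\mathcal{C}^{k,\alpha}(\overline\Omega)\text{ for all }e^*\in E^*\}$. Topologies $\tau^E_{\mathcal{S}}$. Let $\overline\Omega_{\mathrm{wd}}:=\{(x,y)\in\overline\Omega^2:x\ne y\}$ and $M:=\{\beta\in\mathbb{N}_0^d:|\beta|=k\}$. $\mathcal{N}_{k,\overline\Omega_{\mathrm{wd}}}$ (resp. $\mathcal{K}_{k,\overline\Omega_{\mathrm{wd}}}$) is the family of all sets $M\times N$ with $N\subset\overline\Omega_{\mathrm{wd}}$ finite (resp. compact). For $\mathcal{S}$ one of these families, $\tau_{\mathcal{S}}^E$ is generated by the seminorms \[q_S^E(f):=|f|^E_{\mathcal{C}^k(\overline\Omega)}+\sup_{(\beta,x,y)\in S}\frac{\|(\partial^\beta)^Ef(x)-(\partial^\beta)^Ef(y)\|_E}{|x-y|^\alpha},\quad S\in\mathcal{S},\] (supremum over the empty set being $0$) and $\tau_{\mathcal{S}}:=\tau_{\mathcal{S}}^{\mathbb{K}}$. Saks spaces. Let $(X,\|\cdot\|)$ be a normed space and $\tau$ a locally convex Hausdorff topology on $X$ coarser than the norm topology $\tau_{\|\cdot\|}$. The mixed topology $\gamma=\gamma(\|\cdot\|,\tau)$ is the finest linear topology on $X$ that coincides with $\tau$ on $\|\cdot\|$-bounded sets and lies between $\tau$ and $\tau_{\|\cdot\|}$; it is locally convex Hausdorff. $(X,\|\cdot\|,\tau)$ is a Saks space if there is a directed system $\Gamma_\tau$ of continuous seminorms generating $\tau$ with $\|x\|=\sup_{q\in\Gamma_\tau}q(x)$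 for all $x$. The submixed topology $\gamma_{\mathrm{s}}(\|\cdot\|,\tau)$ is generated by the seminorms $x\mapsto\sup_{n\in\mathbb{N}}q_n(x)a_n$ with $(q_n)_{n\in\mathbb{N}}\subset\Gamma_\tau$ and $(a_n)_{n\in\mathbb{N}}$ a real non-negative null-sequence (independent of the choice of such $\Gamma_\tau$). A Saks space is complete if $(X,\gamma)$ is complete; semi-Montel if $(X,\gamma)$ is a semi-Montel space (bounded sets are relatively compact); C-sequential if every convex sequentially open subset of $(X,\gamma)$ is open. *)

(* Defs.v *)
From HB Require Import structures.
From mathcomp Require Import all_boot all_order all_algebra.
From mathcomp Require Import all_classical all_reals all_analysis.
From mathcomp Require Import complex.

Set Implicit Arguments.
Unset Strict Implicit.
Unset Printing Implicit Defensive.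

Import Order.TTheory GRing.Theory Num.Theory.
Import numFieldNormedType.Exports.

Local Open Scope classical_set_scope.
Local Open Scope ring_scope.

Variant RorC := RealScalars | ComplexScalars.

Definition scalar_field (R : realType) (F : RorC) : numFieldType :=
  match F with RealScalars => R | ComplexScalars => R[i] end.

Section Scalars.
Variables (R : realType) (F : RorC).
Local Notation K := (scalar_field R F).

Definition real_scalar : R -> K :=
  match F return R -> scalar_field R F with
  | RealScalars => fun x => x
  | ComplexScalars => fun x => x%:C%C
  end.

Definition real_part : K -> R :=
  match F return scalar_field R F -> R with
  | RealScalars => fun x => x
  | ComplexScalars => fun z => complex.Re z
  end.

(* The norm of a normedModType over K takes its (real) values in K. *)
Definition rnorm (E : normedModType K) (v : E) : R := real_part `|v|.

Definition rabs (a : K) : R := real_part `|a|.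

Lemma real_partD : {morph real_part : x y / x + y}.
Proof. by rewrite /real_part; case: F => //= -[a b] [c e]. Qed.

Lemma real_partM x y : 0 <= x -> 0 <= y ->
  real_part (x * y) = real_part x * real_part y.
Proof.
rewrite /real_part; case: F x y => //= -[a b] [c e].
by rewrite !lecE /= => /andP[/eqP-> _] /andP[/eqP-> _]; rewrite mulr0 subr0.
Qed.

Lemma le_real_part x y : x <= y -> real_part x <= real_part y.
Proof.
rewrite /real_part; case: F x y => //= -[a b] [c e].
by rewrite lecE /= => /andP[].
Qed.

Lemma real_part_ge0 x : 0 <= x -> 0 <= real_part x.
Proof.
rewrite /real_part; case: F x => //= -[a b].
by rewrite lecE /= => /andP[].
Qed.

Lemma rnorm_ge0 (E : normedModType K) (v : E) : 0 <= rnorm v.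
Proof. exact: real_part_ge0. Qed.

Lemma ler_rnormD (E : normedModType K) (v w : E) :
  rnorm (v + w) <= rnorm v + rnorm w.
Proof. by rewrite /rnorm -real_partD; apply/le_real_part/ler_normD. Qed.

Lemma rnormZ (E : normedModType K) a (v : E) : rnorm (a *: v) = rabs a * rnorm v.
Proof. by rewrite /rnorm normrZ real_partM. Qed.

End Scalars.

(* Topologies are kept as data since several of them live on the same space;
   tspace tau is X equipped with tau. *)
Record topology (X : Type) := Topology {
  open_sets :> set_system X ;
  open_setsT : open_sets setT ;
  open_setsI : setI_closed open_sets ;
  open_sets_bigU : forall (I : Type) (f : I -> set X),
    (forall i, open_sets (f i)) -> open_sets (\bigcup_i f i) }.

HB.instance Definition _ (X : Type) := gen_eqMixin (topology X).
HB.instance Definition _ (X : Type) := gen_choiceMixin (topology X).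

Lemma topology_ext (X : Type) (t1 t2 : topology X) :
  open_sets t1 = open_sets t2 -> t1 = t2.
Proof.
case: t1 t2 => [op1 a1 b1 c1] [op2 a2 b2 c2] /= eop; subst op2.
congr Topology; exact: Prop_irrelevance.
Qed.

Definition tspace (X : Type) (tau : topology X) : Type := X.

HB.instance Definition _ (X : choiceType) (tau : topology X) :=
  Choice.copy (tspace tau) X.
HB.instance Definition _ (X : choiceType) (tau : topology X) :=
  isOpenTopological.Build (tspace tau)
    (open_setsT tau) (@open_setsI _ tau) (@open_sets_bigU _ tau).
HB.instance Definition _ (K : numDomainType) (X : lmodType K)
  (tau : topology X) := GRing.Lmodule.copy (tspace tau) X.

Definition agree_on (X : Type) (B : set X) (t1 t2 : topology X) :=
  [set U `&` B | U in open_sets t1] = [set U `&` B | U in open_sets t2].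

Section Tvs.
Variables (K : numFieldType) (X : lmodType K).
Implicit Types tau : topology X.

Definition linear_topology tau :=
  continuous (fun z : tspace tau * tspace tau => z.1 + z.2) /\
  continuous (fun z : K^o * tspace tau => z.1 *: z.2).

Definition locally_convex_topology tau :=
  linear_topology tau /\
  exists2 B : set_system (tspace tau),
    (forall b, b \in B -> convex_set b) & basis B.

Definition tvs_bounded tau (B : set X) :=
  forall U : set X, nbhs (0 : tspace tau) U ->
  exists2 r : K, 0 < r &
    forall l : K, r <= `|l| -> B `<=` [set l *: u | u in U].

Definition semi_Montel tau :=
  [/\ locally_convex_topology tau, hausdorff_space (tspace tau) &
  forall B : set X, tvs_bounded tau B -> precompact (B : set (tspace tau))].

Definition tvs_cauchy tau (G : set_system X) :=
  forall U : set X, nbhs (0 : tspace tau) U ->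
  exists2 A : set X, G A & forall x y, A x -> A y -> U (x - y).

Definition tvs_complete tau :=
  forall G : set_system X, ProperFilter G -> tvs_cauchy tau G ->
  exists x : tspace tau, G --> x.

Definition sequentially_open tau (U : set X) :=
  forall (u : nat -> tspace tau) (x : tspace tau),
  U x -> u @ \oo --> x -> \forall n \near \oo, U (u n).

Definition C_sequential tau :=
  forall U : set X, convex_set U -> sequentially_open tau U -> open_sets tau U.

End Tvs.

Section Saks.
Variables (R : realType) (F : RorC).
Local Notation K := (scalar_field R F).
Variable X : lmodType K.
Implicit Types (q N : X -> R) (G : set (X -> R)) (tau : topology X).

Definition is_seminorm q :=
  [/\ forall x, 0 <= q x,
      forall x y, q (x + y) <= q x + q y &
      forall (a : K) x, q (a *: x) = rabs a * q x].

Definition is_norm N := is_seminorm N /\ forall x, N x = 0 -> x = 0.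

Definition seminorm_open G : set_system X := [set U | forall x, U x ->
  exists2 D : set (X -> R), finite_set D /\ D `<=` G &
  exists2 e : R, 0 < e & [set y | forall q, D q -> q (y - x) < e] `<=` U].

Fact seminorm_openT G : seminorm_open G setT.
Proof. by move=> x _; exists set0; [split|exists 1]. Qed.

Fact seminorm_openI G : setI_closed (seminorm_open G).
Proof.
move=> U V oU oV x [/oU[D [fD DG] [e e0 De]] /oV[D' [fD' D'G] [e' e'0 De']]].
exists (D `|` D'); first by split; [rewrite finite_setU|rewrite subUset].
exists (Num.min e e'); first by rewrite lt_min e0.
move=> y /= yD; split.
  by apply: De => q Dq; have := yD q (or_introl Dq); rewrite lt_min => /andP[].
by apply: De' => q Dq; have := yD q (or_intror Dq); rewrite lt_min => /andP[].
Qed.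

Fact seminorm_open_bigU G (I : Type) (f : I -> set X) :
  (forall i, seminorm_open G (f i)) -> seminorm_open G (\bigcup_i f i).
Proof.
move=> of_ x [i _ /of_[D DG [e e0 De]]].
by exists D => //; exists e => // y /De fy; exists i.
Qed.

Definition seminorm_topology G : topology X :=
  Topology (seminorm_openT G) (@seminorm_openI G) (@seminorm_open_bigU G).

Definition norm_topology N := seminorm_topology [set N].

Definition norm_bounded N (B : set X) := exists M : R, forall x, B x -> N x <= M.

Definition mixed_candidate N tau gamma :=
  [/\ linear_topology gamma,
      forall B, norm_bounded N B -> agree_on B gamma tau,
      open_sets tau `<=` open_sets gamma &
      open_sets gamma `<=` open_sets (norm_topology N)].

Definition is_mixed_topology N tau gamma :=
  mixed_candidate N tau gamma /\
  forall gamma', mixed_candidate N tau gamma' ->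
    open_sets gamma' `<=` open_sets gamma.

(* The unique topology satisfying is_mixed_topology: see mixed_topologyP. *)
Definition mixed_topology N tau : topology X :=
  xget tau [set gamma | is_mixed_topology N tau gamma].

(* Finite intersections of sets that are open for some mixed_candidate. *)
Inductive candidates_base N tau : set X -> Prop :=
| CandidatesT : candidates_base N tau setT
| CandidatesI gamma W V : mixed_candidate N tau gamma -> open_sets gamma W ->
    candidates_base N tau V -> candidates_base N tau (W `&` V).

Fact candidates_baseI N tau : setI_closed (candidates_base N tau).
Proof.
move=> A B; elim=> [|g W V cg gW _ IH] BB; first by rewrite setTI.
by rewrite -setIA; apply: CandidatesI cg gW _; exact: IH.
Qed.

Definition candidates_open N tau : set_system X := [set U | forall x, U x ->
  exists V, [/\ candidates_base N tau V, V x & V `<=` U]].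

Fact candidates_base_open N tau V :
  candidates_base N tau V -> candidates_open N tau V.
Proof. by move=> bV x Vx; exists V; split. Qed.

Fact candidates_openT N tau : candidates_open N tau setT.
Proof. by move=> x _; exists setT; split=> //; exact: CandidatesT. Qed.

Fact candidates_openI N tau : setI_closed (candidates_open N tau).
Proof.
move=> A B oA oB x [/oA[V [bV Vx VA]] /oB[W [bW Wx WB]]].
exists (V `&` W); split=> //; first exact: candidates_baseI.
exact: setISS.
Qed.

Fact candidates_open_bigU N tau (I : Type) (f : I -> set X) :
  (forall i, candidates_open N tau (f i)) -> candidates_open N tau (\bigcup_i f i).
Proof.
move=> of_ x [i _ /of_[V [bV Vx Vf]]]; exists V; split=> // y /Vf fy.
by exists i.
Qed.

Definition candidates_topology N tau : topology X := Topology
  (@candidates_openT N tau) (@candidates_openI N tau) (@candidates_open_bigU N tau).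

Lemma nbhs_tspaceP tau (x : X) (A : set X) :
  nbhs (x : tspace tau) A <-> exists U, [/\ open_sets tau U, U x & U `<=` A].
Proof. by []. Qed.

Lemma candidates_topology_linear N tau :
  linear_topology (candidates_topology N tau).
Proof.
split.
  move=> [x y] A /nbhs_tspaceP[U [oU /= /oU[V [bV Vxy VU]] UA]].
  suff [P [Q [bP bQ [Px Qy] PQ]]] : exists P Q, [/\ candidates_base N tau P,
      candidates_base N tau Q, P x /\ Q y & forall u v, P u -> Q v -> V (u + v)].
    exists (P, Q) => /=.
      by split; [exists P|exists Q]; split=> //; exact: candidates_base_open.
    by move=> [u v] [/= Pu Qv]; apply/UA/VU/PQ.
  elim: bV x y Vxy {UA VU} => [|g W V' cg gW _ IH] x y.
    by move=> _; exists setT, setT; split=> //; exact: CandidatesT.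
  move=> [Wxy /IH[P [Q [bP bQ [Px Qy] PQ]]]].
  have [[ca _] _ _ _] := cg.
  have [|[P' Q'] /= [[P1 [oP1 P1x P1P]] [Q1 [oQ1 Q1y Q1Q]]] PQ'] := ca (x, y) W.
    by exists W; split.
  exists (P1 `&` P), (Q1 `&` Q); split=> //; try by apply: CandidatesI cg _ _.
  move=> u v [/P1P Pu Pu'] [/Q1Q Qv Qv']; split; last exact: PQ.
  exact: (PQ' (u, v)).
move=> [a x] A /nbhs_tspaceP[U [oU /= /oU[V [bV Vxy VU]] UA]].
suff [P [Q [aP bQ Qx PQ]]] : exists (P : set K^o) Q, [/\ nbhs a P,
    candidates_base N tau Q, Q x & forall u v, P u -> Q v -> V (u *: v)].
  exists (P, Q) => /=.
    by split=> //; exists Q; split=> //; exact: candidates_base_open.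
  by move=> [u v] [/= Pu Qv]; apply/UA/VU/PQ.
elim: bV x Vxy {UA VU} => [|g W V' cg gW _ IH] x.
  by move=> _; exists setT, setT; split=> //; [exact: filterT|exact: CandidatesT].
move=> [Wxy /IH[P [Q [aP bQ Qx PQ]]]].
have [[_ cs] _ _ _] := cg.
have [|[P' Q'] /= [aP' [Q1 [oQ1 Q1y Q1Q]]] PQ'] := cs (a, x) W.
  by exists W; split.
exists (P' `&` P), (Q1 `&` Q); split=> //; try by apply: CandidatesI cg _ _.
  exact: filterI.
move=> u v [Pu Pu'] [/Q1Q Qv Qv']; split; last exact: PQ.
exact: (PQ' (u, v)).
Qed.

Lemma mixed_topologyP N tau : linear_topology tau ->
  open_sets tau `<=` open_sets (norm_topology N) ->
  is_mixed_topology N tau (mixed_topology N tau) /\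
  forall gamma, is_mixed_topology N tau gamma -> gamma = mixed_topology N tau.
Proof.
move=> ltau tauN; have ctau : mixed_candidate N tau tau by split.
have fine_ gamma : mixed_candidate N tau gamma ->
    open_sets gamma `<=` open_sets (candidates_topology N tau).
  move=> cg U gU x Ux; exists U; split=> //.
  by rewrite -(setIT U); apply: CandidatesI cg gU _; exact: CandidatesT.
have mC : is_mixed_topology N tau (candidates_topology N tau).
  split=> //; split; first exact: candidates_topology_linear.
  - move=> B bB; apply/seteqP; split=> _ [U oU <-]; last by exists U => //; exact: fine_ oU.
    have bP V : candidates_base N tau V ->
        exists2 V', open_sets tau V' & V `&` B = V' `&` B.
      elim=> [|g W V' cg gW _ [V1 oV1 eV1]].
        by exists setT => //; exact: open_setsT.
      have [_ agr _ _] := cg.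
      have : [set U `&` B | U in open_sets g] (W `&` B) by exists W.
      rewrite (agr B bB) => -[W1 oW1 eW1].
      exists (W1 `&` V1); first exact: open_setsI.
      by rewrite setIIl eV1 -eW1 -setIIl.
    pose I := {V : set X | open_sets tau V /\ V `&` B `<=` U}.
    exists (\bigcup_(V : I) sval V).
      by apply: open_sets_bigU => -[V []].
    apply/seteqP; split=> x [].
      by move=> [[V /= [oV VU]] _ Vx] Bx; split=> //; exact: VU.
    move=> Ux Bx; split=> //; have [V [bV Vx VU]] := oU x Ux.
    have [V' oV' eV] := bP V bV.
    have V'U : open_sets tau V' /\ V' `&` B `<=` U.
      by split=> //; rewrite -eV => y [/VU].
    exists (exist _ V' V'U) => //=.
    have : (V `&` B) x by [].
    by rewrite eV => -[].
  - exact: fine_.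
  - move=> U oU x /oU[V [bV Vx VU]].
    have : open_sets (norm_topology N) V.
      elim: bV => [|g W V' cg gW _ IH]; first exact: open_setsT.
      by apply: open_setsI => //; have [_ _ _] := cg; exact.
    move=> /(_ x Vx)[D HD [e e0 De]]; exists D => //; exists e => //.
    exact: subset_trans De VU.
have uniq g1 g2 : is_mixed_topology N tau g1 -> is_mixed_topology N tau g2 ->
    g1 = g2.
  move=> [c1 m1] [c2 m2]; apply: topology_ext; apply/seteqP.
  by split; [exact: m2|exact: m1].
have mix : is_mixed_topology N tau (mixed_topology N tau).
  by rewrite /mixed_topology; case: xgetP => // /(_ (candidates_topology N tau)).
by split=> // gamma mg; exact: uniq.
Qed.

(* Directed means directed for the pointwise order. The extended supremum is
   used since sup is 0 on unbounded sets of reals. *)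
Definition saks_system N tau G :=
  [/\ G !=set0 /\ (forall p q, G p -> G q ->
        exists2 r, G r & forall x, p x <= r x /\ q x <= r x),
      forall q, G q -> is_seminorm q /\ continuous (q : tspace tau -> R),
      tau = seminorm_topology G &
      forall x, ereal_sup [set (q x)%:E | q in G] = (N x)%:E].

Definition is_Saks N tau :=
  [/\ is_norm N,
      locally_convex_topology tau,
      hausdorff_space (tspace tau),
      open_sets tau `<=` open_sets (norm_topology N) &
      exists G, saks_system N tau G].

Definition submixed_seminorms G : set (X -> R) := [set p |
  exists (q : nat -> X -> R) (a : nat -> R),
  [/\ forall n, G (q n), forall n, 0 <= a n, a @ \oo --> 0 &
      p = fun x => sup [set q n x * a n | n in [set: nat]]]].

(* gamma is the submixed topology of the Saks space (X, N, tau), whichever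
   admissible system of seminorms is used to form it. *)
Definition is_submixed_topology N tau gamma :=
  is_Saks N tau /\
  forall G, saks_system N tau G ->
    gamma = seminorm_topology (submixed_seminorms G).

End Saks.

Section Hoelder.
Variables (R : realType) (F : RorC) (d : nat).
Local Notation K := (scalar_field R F).
Implicit Types Omega : set 'rV[R]_d.

Definition edot (x y : 'rV[R]_d) : R := \sum_j x 0 j * y 0 j.

(* The norm of the normedModType 'rV[R]_d is the maximum norm. *)
Definition enorm (x : 'rV[R]_d) : R := Num.sqrt (edot x x).

(* Near each boundary point, Omega is the part of space strictly above the
   graph of a Lipschitz function phi on the hyperplane orthogonal to a unit
   vector e; only the values of phi on that hyperplane matter. *)
Definition lipschitz_boundary Omega := forall p, (closure Omega `\` Omega^°) p ->
  exists (U : set 'rV[R]_d) (e : 'rV[R]_d) (phi : 'rV[R]_d -> R) (L : R),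
  [/\ open U /\ U p, enorm e = 1,
      forall s t, `|phi s - phi t| <= L * enorm (s - t) &
      forall x, U x -> (Omega x <-> phi (x - edot x e *: e) < edot x e)].

Definition multi_index := {ffun 'I_d -> nat}.

Definition mi_order (b : multi_index) : nat := (\sum_j b j)%N.

(* Supremum of a set of nonnegative reals, equal to 0 on the empty set. *)
Definition esup0 (A : set R) : \bar R := ereal_sup (0%E |` (EFin @` A)).

Section Functions.
Variables (Omega : set 'rV[R]_d) (E : normedModType K).
Implicit Types f : Omega -> E.

(* 'valL_0 f extends f by 0 outside Omega; since Omega is meant to be open,
   only values in Omega matter in the limit h --> 0. *)
Definition diff_quotient (j : 'I_d) f (x : Omega) (h : R) : E :=
  real_scalar F h^-1 *: ('valL_0 f (val x + h *: delta_mx 0 j) - f x).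

Definition partial (j : 'I_d) f : Omega -> E :=
  fun x => lim (diff_quotient j f x @ 0^').

(* On C^k functions the order of the partial derivatives is irrelevant. *)
Definition mpartial (b : multi_index) f : Omega -> E :=
  foldr (fun j g => iter (b j) (partial j) g) f (enum 'I_d).

Fixpoint is_Ck (k : nat) f : Prop :=
  continuous f /\
  if k is k'.+1 then
    forall j, (forall x, cvg (diff_quotient j f x @ 0^')) /\ is_Ck k' (partial j f)
  else True.

Definition is_extension (g : Omega -> E) (h : 'rV[R]_d -> E) :=
  {within closure Omega, continuous h} /\ forall x : Omega, h (val x) = g x.

(* Meaningful on closure Omega only, where the extension is unique. *)
Definition extension (g : Omega -> E) : 'rV[R]_d -> E :=
  xget (fun=> 0) [set h | is_extension g h].

Definition Ck_closure (k : nat) : set (Omega -> E) := [set f |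
  is_Ck k f /\
  forall b : multi_index, (mi_order b <= k)%N ->
    exists h, is_extension (mpartial b f) h].

Definition Ck_enorm (k : nat) f : \bar R := esup0 [set r |
  exists (b : multi_index) (x : Omega),
    (mi_order b <= k)%N /\ r = rnorm (mpartial b f x)].

Definition Hoelder_quotients (k : nat) (alpha : R) f : set R := [set r |
  exists (b : multi_index) (x y : Omega),
  [/\ mi_order b = k, x <> y &
      r = rnorm (mpartial b f x - mpartial b f y) /
          enorm (val x - val y) `^ alpha]].

Definition Hoelder_enorm (k : nat) (alpha : R) f : \bar R :=
  (Ck_enorm k f + esup0 (Hoelder_quotients k alpha f))%E.

Definition Hoelder (k : nat) (alpha : R) : set (Omega -> E) :=
  [set f | Ck_closure k f /\ (Hoelder_enorm k alpha f < +oo)%E].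

(* Hoelder is a linear subspace of the space of all functions Omega -> E. *)

Lemma valL0_lin a f g y :
  'valL_0 (a *: f + g) y = a *: 'valL_0 f y + 'valL_0 g y.
Proof. by rewrite /valL_ /=; case: 'oinv_ _ => [x|] //=; rewrite scaler0 addr0. Qed.

Lemma diff_quotient_lin a f g j x :
  diff_quotient j (a *: f + g) x =
  a *: diff_quotient j f x + diff_quotient j g x.
Proof.
apply/funext => h; rewrite /diff_quotient valL0_lin.
rewrite -[(a *: f + g) x]/(a *: f x + g x).
rewrite -[RHS]/(a *: (_ *: _) + _ *: _).
by rewrite scalerA mulrC -scalerA -scalerDr opprD addrACA -scalerN -scalerDr.
Qed.

Let differentiable j f := forall x, cvg (diff_quotient j f x @ 0^').

Lemma partial_lin a f g j : differentiable j f -> differentiable j g ->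
  differentiable j (a *: f + g) /\
  partial j (a *: f + g) = a *: partial j f + partial j g.
Proof.
move=> df dg.
have H x : diff_quotient j (a *: f + g) x @ 0^' -->
    (a *: partial j f + partial j g) x.
  rewrite diff_quotient_lin; apply: cvgD; last exact: dg.
  by apply: cvgZr; exact: df.
split=> [x|]; first by apply/cvg_ex; eexists; exact: H.
by apply/funext => x; apply/cvg_lim => //; exact: H.
Qed.

Lemma continuous_lin (T : topologicalType) a (f g : T -> E) :
  continuous f -> continuous g -> continuous (a *: f + g).
Proof.
move=> cf cg x; apply: cvgD; last exact: cg.
by apply: cvgZr; exact: cf.
Qed.

Lemma is_Ck_lin k a f g : is_Ck k f -> is_Ck k g -> is_Ck k (a *: f + g).
Proof.
elim: k f g => [|k IH] f g [cf df] [cg dg]; split=> //; try exact: continuous_lin.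
move=> j; have [dfj Cf] := df j; have [dgj Cg] := dg j.
by have [dl ->] := partial_lin a dfj dgj; split=> //; exact: IH.
Qed.

Lemma iter_partial_lin n k a f g j : is_Ck (n + k) f -> is_Ck (n + k) g ->
  [/\ is_Ck k (iter n (partial j) f), is_Ck k (iter n (partial j) g) &
      iter n (partial j) (a *: f + g) =
      a *: iter n (partial j) f + iter n (partial j) g].
Proof.
elim: n k => [|n IH] k //; rewrite addSnnS => Cf Cg.
have [[_ /(_ j)[df Cf']] [_ /(_ j)[dg Cg']] e] := IH _ Cf Cg.
by split=> //=; rewrite e; have [] := partial_lin a df dg.
Qed.

Lemma foldr_partial_lin a f g (b : multi_index) (s : seq 'I_d) k :
  let D := foldr (fun j g => iter (b j) (partial j) g) in
  is_Ck ((\sum_(j <- s) b j)%N + k) f -> is_Ck ((\sum_(j <- s) b j)%N + k) g ->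
  [/\ is_Ck k (D f s), is_Ck k (D g s) &
      D (a *: f + g) s = a *: D f s + D g s].
Proof.
move=> D; elim: s k => [|j s IH] k; first by rewrite big_nil.
rewrite big_cons addnAC addnC => Cf Cg; rewrite /D /= -/D.
have [Cf' Cg' ->] := IH _ Cf Cg; exact: iter_partial_lin.
Qed.

Lemma mpartial_lin k a f g (b : multi_index) : (mi_order b <= k)%N ->
  is_Ck k f -> is_Ck k g ->
  mpartial b (a *: f + g) = a *: mpartial b f + mpartial b g.
Proof.
move=> bk Cf Cg.
have e : ((\sum_(j <- enum 'I_d) b j) + (k - mi_order b))%N = k.
  by rewrite big_enum /= subnKC.
by rewrite -e in Cf Cg; have [] := foldr_partial_lin a Cf Cg.
Qed.

Lemma is_extension_lin a (g1 g2 : Omega -> E) h1 h2 :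
  is_extension g1 h1 -> is_extension g2 h2 ->
  is_extension (a *: g1 + g2) (a *: h1 + h2).
Proof.
move=> [c1 e1] [c2 e2]; split.
  move=> x; apply: cvgD; last exact: c2.
  by apply: cvgZr; exact: c1.
by move=> x; rewrite -[LHS]/(a *: h1 _ + h2 _) e1 e2.
Qed.

Lemma Ck_closure_lin k a f g :
  Ck_closure k f -> Ck_closure k g -> Ck_closure k (a *: f + g).
Proof.
move=> [Cf ef] [Cg eg]; split=> [|b bk]; first exact: is_Ck_lin.
have [h1 H1] := ef b bk; have [h2 H2] := eg b bk.
exists (a *: h1 + h2); rewrite (mpartial_lin _ bk) //; exact: is_extension_lin.
Qed.

Lemma esup0_ltP (A : set R) :
  (esup0 A < +oo)%E <-> exists M : R, forall r, A r -> r <= M.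
Proof.
split=> [Aoo|[M AM]].
  exists (fine (esup0 A)) => r Ar.
  have rA : (r%:E <= esup0 A)%E by apply: ereal_sup_ubound; right; exists r.
  rewrite -lee_fin fineK // fin_numElt Aoo andbT.
  by rewrite (lt_le_trans _ rA) // ltNyr.
apply: (@le_lt_trans _ _ (Num.max 0 M)%:E); last exact: ltry.
apply: ge_ereal_sup => _ [->|[r /AM rM <-]]; rewrite lee_fin le_max ?lexx //.
by rewrite rM orbT.
Qed.

Lemma esup0_ge0 (A : set R) : (0 <= esup0 A)%E.
Proof. by apply: ereal_sup_ubound; left. Qed.

Lemma Hoelder_enorm_ltP k alpha f : (Hoelder_enorm k alpha f < +oo)%E <->
  exists M : R,
    (forall b x, (mi_order b <= k)%N -> rnorm (mpartial b f x) <= M) /\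
    (forall b x y, mi_order b = k -> x <> y ->
      rnorm (mpartial b f x - mpartial b f y) /
        enorm (val x - val y) `^ alpha <= M).
Proof.
split=> [|[M [M1 M2]]].
  rewrite /Hoelder_enorm => foo.
  have /esup0_ltP[M HM] : (Ck_enorm k f < +oo)%E.
    by apply: le_lt_trans foo; rewrite leeDl ?esup0_ge0.
  have /esup0_ltP[M' HM'] : (esup0 (Hoelder_quotients k alpha f) < +oo)%E.
    by apply: le_lt_trans foo; rewrite leeDr ?esup0_ge0.
  exists (Num.max M M'); split=> [b x bk|b x y bk xy].
    by rewrite le_max HM //; exists b, x.
  by rewrite le_max orbC HM' //; exists b, x, y.
apply: lte_add_pinfty; apply/esup0_ltP; exists M.
  by move=> _ [b [x [bk ->]]]; exact: M1.
by move=> _ [b [x [y [bk xy ->]]]]; exact: M2.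
Qed.

Lemma Hoelder_lin k alpha a f g :
  Hoelder k alpha f -> Hoelder k alpha g -> Hoelder k alpha (a *: f + g).
Proof.
move=> [Cf /Hoelder_enorm_ltP[M [M1 M2]]] [Cg /Hoelder_enorm_ltP[M' [M1' M2']]].
split; first exact: Ck_closure_lin.
have [[Df _] [Dg _]] := (Cf, Cg).
have a0 : 0 <= rabs a by exact: real_part_ge0.
apply/Hoelder_enorm_ltP; exists (rabs a * M + M'); split=> [b x bk|b x y bk xy].
  rewrite (mpartial_lin _ bk) //; apply: le_trans (ler_rnormD _ _) _.
  by rewrite rnormZ lerD // ?M1' // ler_wpM2l // M1.
rewrite (@mpartial_lin k) ?bk //.
have -> : (a *: mpartial b f + mpartial b g) x -
    (a *: mpartial b f + mpartial b g) y =
    a *: (mpartial b f x - mpartial b f y) + (mpartial b g x - mpartial b g y).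
  by rewrite scalerBr opprD addrACA.
apply: (@le_trans _ _ ((rabs a * rnorm (mpartial b f x - mpartial b f y) +
    rnorm (mpartial b g x - mpartial b g y)) / enorm (val x - val y) `^ alpha)).
  rewrite ler_wpM2r ?invr_ge0 ?powR_ge0 //.
  by apply: le_trans (ler_rnormD _ _) _; rewrite rnormZ.
by rewrite mulrDl -mulrA lerD ?M2' // ler_wpM2l // M2.
Qed.

Lemma partial0 j : differentiable j 0 /\ partial j 0 = 0.
Proof.
have e x : diff_quotient j 0 x = cst 0.
  apply/funext => h; rewrite /diff_quotient.
  have -> y : 'valL_0 (0 : Omega -> E) y = 0 by rewrite /valL_ /=; case: 'oinv_ _.
  by rewrite subrr scaler0.
split=> [x|]; first by rewrite e; exact: is_cvg_cst.
by apply/funext => x; rewrite /partial e; apply/cvg_lim => //; exact: cvg_cst.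
Qed.

Lemma mpartial0 b : mpartial b 0 = 0.
Proof.
rewrite /mpartial; elim: (enum _) => //= j s ->.
by elim: (b j) => //= n ->; have [] := partial0 j.
Qed.

Lemma Hoelder0 k alpha : Hoelder k alpha 0.
Proof.
have r0 : rnorm (0 : E) = 0 by rewrite /rnorm normr0 /real_part; case: (F).
split; last first.
  apply/Hoelder_enorm_ltP; exists 0; split=> [b x _|b x y _ _].
    by rewrite mpartial0 r0.
  by rewrite mpartial0 subrr r0 mul0r.
split=> [|b _]; last first.
  by exists 0; rewrite mpartial0; split=> // x; exact: cvg_cst.
have c0 : continuous (0 : Omega -> E) by exact: (@cst_continuous _ _ (0 : E)).
elim: k => [|k IH]; split=> // j.
by have [d0 ->] := partial0 j.
Qed.

Definition Hoelder_pred k alpha : {pred (Omega -> E)} :=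
  fun f => f \in Hoelder k alpha.

Fact Hoelder_submod k alpha : submod_closed (Hoelder_pred k alpha).
Proof.
split=> [|a f g]; first by apply/mem_set; exact: Hoelder0.
by move=> /set_mem Hf /set_mem Hg; apply/mem_set; exact: Hoelder_lin.
Qed.

HB.instance Definition _ k alpha :=
  GRing.isSubmodClosed.Build K (Omega -> E) (Hoelder_pred k alpha)
    (Hoelder_submod k alpha).

Definition Hoelder_space k alpha : Type :=
  {f : Omega -> E | f \in Hoelder_pred k alpha}.

HB.instance Definition _ k alpha := SubChoice.copy (Hoelder_space k alpha)
  {f : Omega -> E | f \in Hoelder_pred k alpha}.
HB.instance Definition _ k alpha :=
  [SubChoice_isSubLmodule of Hoelder_space k alpha by <:].

Definition Hoelder_norm k alpha (f : Hoelder_space k alpha) : R :=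
  fine (Hoelder_enorm k alpha (val f)).

Definition Ck_norm k alpha (f : Hoelder_space k alpha) : R :=
  fine (Ck_enorm k (val f)).

Definition Ck_topology k alpha : topology (Hoelder_space k alpha) :=
  norm_topology (@Ck_norm k alpha).

Definition off_diagonal : set ('rV[R]_d * 'rV[R]_d) :=
  [set z | [/\ closure Omega z.1, closure Omega z.2 & z.1 <> z.2]].

Definition finite_family k : set (set (multi_index * ('rV[R]_d * 'rV[R]_d))) :=
  [set [set b | mi_order b = k] `*` P | P in
    [set P | P `<=` off_diagonal /\ finite_set P]].

Definition compact_family k : set (set (multi_index * ('rV[R]_d * 'rV[R]_d))) :=
  [set [set b | mi_order b = k] `*` P | P in
    [set P | P `<=` off_diagonal /\ compact P]].

Definition Hoelder_seminorm k alpha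
    (S : set (multi_index * ('rV[R]_d * 'rV[R]_d)))
    (f : Hoelder_space k alpha) : R :=
  Ck_norm f + fine (esup0 [set r | exists b x y, S (b, (x, y)) /\
    r = rnorm (extension (mpartial b (val f)) x -
               extension (mpartial b (val f)) y) / enorm (x - y) `^ alpha]).

Definition family_topology k alpha
    (SS : set (set (multi_index * ('rV[R]_d * 'rV[R]_d)))) :
    topology (Hoelder_space k alpha) :=
  seminorm_topology [set Hoelder_seminorm S | S in SS].

End Functions.

Definition Hoelder_weak (Omega : set 'rV[R]_d) (E : normedModType K)
    (k : nat) (alpha : R) : set (Omega -> E) :=
  [set f : Omega -> E | forall e : {linear E -> K^o}, continuous e ->
    @Hoelder Omega K^o k alpha (e \o f)].

End Hoelder.

(* Main.v *)
(* Write P for the C^k norm and N for the Hoelder norm. Since P is a norm with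
   P <= N, the mixed topology is generated by all seminorms that are P-small on
   N-bounded P-neighbourhoods of 0, and suprema of infimal convolutions
   K_n(x) = inf_b (P(x - b) / eps_n + N(b) / r_n), r_n -> oo, already suffice.
   These suprema are lower semicontinuous for P, so completeness reduces to that
   of N-balls for P; C-sequentiality, N-boundedness of bounded sets and, for
   compact balls, the equality with the submixed topology (a Banach-Dieudonne
   induction) also come down to statements on N-balls.
   Off-diagonal compact sets keep |x - y| away from 0, so that the quotient
   seminorms are dominated by P and tau_S is the topology of P in all cases.
   N-balls are P-complete because uniform limits commute with partial
   derivatives; on a Lipschitz domain, Hoelder functions are equicontinuous up to
   the boundary with all derivatives of order at most k, so N-balls are compact
   for scalar functions.
   A weakly Hoelder function is Hoelder by uniform boundedness: weakly bounded
   difference quotients are bounded, and this also makes the partial derivatives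
   exist in norm. *)

(* The mixed topology is finest among linear topologies that are not assumed locally convex, so
   candidates cannot be compared through seminorms. A neighbourhood of 0 in a candidate only yields
   a string, that is sets W_n with W_(n+1) + W_(n+1) inside W_n; [mixed_string] extracts a seminorm
   ball from it. The same lemma gives C-sequentiality, where convexity supplies the string. Each K_n
   is controlled by P, and the factor 1 / r_n makes those of high index uniformly small on an
   N-ball; hence their supremum is P-small on N-bounded P-neighbourhoods of 0. Its lower
   semicontinuity makes the P-limit of a Cauchy filter a limit in the mixed topology. The obstacle
   to completeness is that a Cauchy filter may contain no N-bounded set; a supremum of infimal
   convolutions shows that it at least stays P-close to one N-ball. For a weakly Hoelder function no
   derivative exists in norm at the start. Functionals are therefore tested on difference quotients
   in small balls inside Omega; the boundary enters afterwards, through the extension of the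
   derivatives to the closure. *)
Require Import Defs.
From HB Require Import structures.
From mathcomp Require Import all_boot all_order all_algebra.
From mathcomp Require Import all_classical all_reals all_analysis.
From mathcomp Require Import finmap complex ring lra.

Set Implicit Arguments.
Unset Strict Implicit.
Unset Printing Implicit Defensive.

Import Order.TTheory GRing.Theory Num.Theory.
Import numFieldNormedType.Exports.

Local Open Scope classical_set_scope.
Local Open Scope ring_scope.

(** * Real and complex scalars *)

Section ScalarTheory.
Variables (R : realType) (F : RorC).
Local Notation K := (scalar_field R F).

Lemma real_scalarD (x y : R) : real_scalar F (x + y) = real_scalar F x + real_scalar F y.
Proof. by case: F => //=; rewrite rmorphD. Qed.

Lemma real_scalarB (x y : R) : real_scalar F (x - y) = real_scalar F x - real_scalar F y.
Proof. by case: F => //=; rewrite rmorphB. Qed.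

Lemma real_scalarM (x y : R) : real_scalar F (x * y) = real_scalar F x * real_scalar F y.
Proof. by case: F => //=; rewrite rmorphM. Qed.

Lemma real_scalar0 : real_scalar F (0 : R) = 0.
Proof. by case: F. Qed.

Lemma real_scalar1 : real_scalar F (1 : R) = 1.
Proof. by case: F. Qed.

Lemma ler_real_scalar (x y : R) : (real_scalar F x <= real_scalar F y) = (x <= y).
Proof. by case: F => //=; rewrite lecR. Qed.

Lemma ltr_real_scalar (x y : R) : (real_scalar F x < real_scalar F y) = (x < y).
Proof. by case: F => //=; rewrite ltcR. Qed.

Lemma real_scalarK (x : R) : real_part (real_scalar F x) = x.
Proof. by case: F. Qed.

(** In the order of [R[i]] a nonnegative element has zero imaginary part; this is what lets norms
    with values in [K] be handled as real numbers. *)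
Lemma real_partK (a : K) : 0 <= a -> real_scalar F (real_part a) = a.
Proof.
by case: F a => //= -[x y]; rewrite lecE /= => /andP[/eqP-> _].
Qed.

Lemma norm_rnorm (E : normedModType K) (v : E) : `|v| = real_scalar F (rnorm v).
Proof. by rewrite /rnorm real_partK. Qed.

Lemma norm_rabs (a : K) : `|a| = real_scalar F (rabs a).
Proof. by rewrite /rabs real_partK. Qed.

Lemma real_scalar_norm (x : R) : `|real_scalar F x| = real_scalar F `|x|.
Proof. by case: F => //=; rewrite normc_def /= expr0n addr0 sqrtr_sqr. Qed.

Lemma rabs_real_scalar (x : R) : rabs (real_scalar F x) = `|x|.
Proof. by rewrite /rabs real_scalar_norm real_scalarK. Qed.

Lemma rabs_ge0 (a : K) : 0 <= rabs a.
Proof. exact: real_part_ge0. Qed.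

Lemma rabsM (a b : K) : rabs (a * b) = rabs a * rabs b.
Proof. by rewrite /rabs normrM real_partM. Qed.

Lemma rabs1 : rabs (1 : K) = 1.
Proof. by rewrite -real_scalar1 rabs_real_scalar normr1. Qed.

Lemma rabs_gt0 (a : K) : (0 < rabs a) = (a != 0).
Proof. by rewrite -ltr_real_scalar real_scalar0 -norm_rabs normr_gt0. Qed.

Lemma rabs0 : rabs (0 : K) = 0.
Proof. by rewrite -real_scalar0 rabs_real_scalar normr0. Qed.

Lemma rabs_regular (a : K) : rabs a = rnorm (a : K^o).
Proof. by []. Qed.

Section Norm.
Variable E : normedModType K.
Implicit Types v w : E.

Lemma rnorm0 : rnorm (0 : E) = 0.
Proof. by rewrite /rnorm normr0 -real_scalar0 real_scalarK. Qed.

Lemma rnormN v : rnorm (- v) = rnorm v.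
Proof. by rewrite /rnorm normrN. Qed.

Lemma rnorm_distC v w : rnorm (v - w) = rnorm (w - v).
Proof. by rewrite -rnormN opprB. Qed.

Lemma rnorm0_eq0 v : rnorm v = 0 -> v = 0.
Proof. by move=> e; apply/normr0_eq0; rewrite norm_rnorm e real_scalar0. Qed.

Lemma ler_rnorm_distD u v w : rnorm (v - w) <= rnorm (v - u) + rnorm (u - w).
Proof. by rewrite -(subrKA u v (- w)) ler_rnormD. Qed.

Lemma ler_rnormB v w : rnorm (v - w) <= rnorm v + rnorm w.
Proof. by rewrite -(rnormN w) ler_rnormD. Qed.

Lemma rnorm_ge_dist v w : rnorm v <= rnorm (v - w) + rnorm w.
Proof. by rewrite -[X in rnorm X <= _](subrK w) ler_rnormD. Qed.

Lemma ler_dist_rnorm v w : `|rnorm v - rnorm w| <= rnorm (v - w).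
Proof.
rewrite ler_norml lerBlDr rnorm_ge_dist andbT lerBrDl -lerBrDr opprK.
by rewrite rnorm_distC addrC rnorm_ge_dist.
Qed.

Lemma rnormZr (t : R) v : rnorm (real_scalar F t *: v) = `|t| * rnorm v.
Proof. by rewrite rnormZ rabs_real_scalar. Qed.

Lemma cvg_rnormP (T : Type) (G : set_system T) (FG : Filter G) (f : T -> E) l :
  f @ G --> l <-> forall e : R, 0 < e -> \forall x \near G, rnorm (l - f x) < e.
Proof.
split=> [/cvgrPdist_lt H e e0|H].
  have := H (real_scalar F e); rewrite -real_scalar0 ltr_real_scalar => /(_ e0).
  by apply: filterS => x; rewrite norm_rnorm ltr_real_scalar.
apply/cvgrPdist_lt => e e0; have := H (real_part e).
rewrite -ltr_real_scalar real_scalar0 real_partK ?ltW // => /(_ e0).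
by apply: filterS => x; rewrite norm_rnorm -ltr_real_scalar real_partK ?ltW.
Qed.

Lemma nbhs_rnormP (l : E) (A : set E) :
  nbhs l A <-> exists2 e : R, 0 < e & [set v | rnorm (l - v) < e] `<=` A.
Proof.
split=> [/nbhs_normP[e /= e0 eA]|[e e0 eA]].
  exists (real_part e); first by rewrite -ltr_real_scalar real_scalar0 real_partK ?ltW.
  move=> v /= lv; apply: eA => /=.
  by rewrite norm_rnorm -(real_partK (ltW e0)) ltr_real_scalar.
apply/nbhs_normP; exists (real_scalar F e) => /=.
  by rewrite -real_scalar0 ltr_real_scalar.
by move=> v /=; rewrite norm_rnorm ltr_real_scalar => /eA.
Qed.

End Norm.
End ScalarTheory.

(** * Topologies generated by seminorms *)

Section Seminorms.
Variables (R : realType) (F : RorC).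
Local Notation K := (scalar_field R F).
Variable X : lmodType K.
Implicit Types (p q N P : X -> R) (G : set (X -> R)) (x y : X).

Lemma seminorm0 q : is_seminorm q -> q 0 = 0.
Proof. by move=> [_ _ qZ]; rewrite -(scale0r (0 : X)) qZ rabs0 mul0r. Qed.

Lemma seminormN q x : is_seminorm q -> q (- x) = q x.
Proof.
move=> [_ _ qZ]; rewrite -scaleN1r qZ.
by rewrite -real_scalar1 -[- _]add0r -real_scalar0 -real_scalarB sub0r rabs_real_scalar
  normrN1 mul1r.
Qed.

Lemma seminorm_distC q x y : is_seminorm q -> q (x - y) = q (y - x).
Proof. by move=> sq; rewrite -(seminormN _ sq) opprB. Qed.

Lemma seminormD q x y : is_seminorm q -> q (x + y) <= q x + q y.
Proof. by case. Qed.

Lemma seminorm_dist q x y z : is_seminorm q -> q (x - y) <= q (x - z) + q (z - y).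
Proof. by move=> sq; rewrite -(subrKA z x (- y)) seminormD. Qed.

Lemma seminorm_ge_dist q x y : is_seminorm q -> q x <= q (x - y) + q y.
Proof. by move=> sq; rewrite -[X in q X <= _](subrK y) seminormD. Qed.

Lemma seminormB q x y : is_seminorm q -> q (x - y) <= q x + q y.
Proof. by move=> sq; rewrite -(seminormN y sq) seminormD. Qed.

Lemma seminorm_ge0 q x : is_seminorm q -> 0 <= q x.
Proof. by case. Qed.

Lemma seminormZr q (t : R) x : is_seminorm q -> q (real_scalar F t *: x) = `|t| * q x.
Proof. by move=> [_ _ qZ]; rewrite qZ rabs_real_scalar. Qed.

Lemma seminorm_scale q (c : R) : 0 <= c -> is_seminorm q ->
  is_seminorm (fun x => q x * c).
Proof.
move=> c0 [q0 qD qZ]; split=> [x|x y|a x]; first exact: mulr_ge0.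
  by rewrite -mulrDl ler_wpM2r.
by rewrite qZ mulrA.
Qed.

(** For [a != 0] the reverse inequality is the assumed one applied to [a^-1] and [a *: x]. *)
Lemma seminormI q :
  (forall x, 0 <= q x) -> (forall x y, q (x + y) <= q x + q y) ->
  (forall a x, q (a *: x) <= rabs a * q x) -> is_seminorm q.
Proof.
move=> q0 qD qZ; split=> // a x; apply/eqP; rewrite eq_le qZ /=.
have [->|a0] := eqVneq a 0; first by rewrite rabs0 mul0r.
rewrite -ler_pdivlMl ?rabs_gt0 //.
have {1}-> : x = a^-1 *: (a *: x) by rewrite scalerA mulVf ?scale1r.
apply: le_trans (qZ _ _) _; rewrite ler_wpM2r //.
have := rabsM a a^-1; rewrite mulfV // rabs1 => e.
by rewrite -[leRHS]mul1r e mulrAC divff ?mul1r // gt_eqF // rabs_gt0.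
Qed.

Lemma finite_bound (D : set (X -> R)) x : finite_set D ->
  exists2 M : R, 0 < M & forall q, D q -> q x <= M.
Proof.
move=> /finite_seqP[s ->]; exists (1 + \sum_(q <- s) `|q x|).
  by rewrite ltr_wpDr // sumr_ge0.
move=> q /= qs; apply: (le_trans (ler_norm _)).
rewrite (big_rem q qs) /= addrCA lerDl addr_ge0 //; exact: sumr_ge0.
Qed.

Section SeminormTopology.
Variable G : set (X -> R).
Hypothesis semiG : forall q, G q -> is_seminorm q.
Local Notation T := (tspace (seminorm_topology G)).

Lemma nbhs_seminormP x (A : set X) : nbhs (x : T) A <->
  exists2 D : set (X -> R), finite_set D /\ D `<=` G &
  exists2 e : R, 0 < e & [set y | forall q, D q -> q (y - x) < e] `<=` A.
Proof.
split=> [/nbhs_tspaceP[U [oU Ux UA]]|[D [fD DG] [e e0 De]]].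
  have [D DG [e e0 De]] := oU x Ux; exists D => //; exists e => //.
  exact: subset_trans De UA.
(* The open set consists of the centres of some [D]-ball contained in [A]; halving the radius shows
   that it is open. *)
apply/nbhs_tspaceP; exists [set z | exists2 e : R, 0 < e &
  [set y | forall q, D q -> q (y - z) < e] `<=` A]; split.
- move=> z [r r0 zA]; exists D => //; exists (r / 2); first exact: divr_gt0.
  move=> y /= yz; exists (r / 2); first exact: divr_gt0.
  move=> w wy; apply: zA => q Dq; rewrite (splitr r).
  apply: le_lt_trans (seminorm_dist w z y (semiG (DG _ Dq))) _.
  by apply: ltrD; [exact: wy|exact: yz].
- by exists e.
- by move=> z [r r0]; apply=> q Dq; rewrite subrr seminorm0 //; exact/semiG/DG.
Qed.

Lemma nbhs_seminorm x q (e : R) : G q -> 0 < e ->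
  nbhs (x : T) [set y | q (y - x) < e].
Proof.
move=> Gq e0; apply/nbhs_seminormP; exists [set q].
  by split; [exact: finite_set1|move=> _ ->].
by exists e => // y; apply.
Qed.

Lemma seminorm_topology_linear : linear_topology (seminorm_topology G).
Proof.
split.
  move=> [x y] A /nbhs_seminormP[D [fD DG] [e e0 De]].
  have e20 : 0 < e / 2 by exact: divr_gt0.
  exists ([set u | forall q, D q -> q (u - x) < e / 2],
          [set v | forall q, D q -> q (v - y) < e / 2]).
    by split; apply/nbhs_seminormP; exists D => //; exists (e / 2).
  move=> [u v] [/= ux vy]; apply: De => q Dq /=.
  rewrite opprD addrACA (splitr e).
  apply: le_lt_trans (seminormD _ _ (semiG (DG _ Dq))) _.
  by apply: ltrD; [exact: ux|exact: vy].
move=> [a x] A /nbhs_seminormP[D [fD DG] [e e0 De]].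
have [M M0 xM] := finite_bound x fD.
(* [r] handles [b *: (v - x)], where [rabs b <= rabs a + 1] because [s <= 1]; the other half of [s]
   handles [(b - a) *: x]. *)
pose r := e / 2 / (rabs a + 1).
have a1 : 0 < rabs a + 1 by rewrite ltr_wpDl ?rabs_ge0.
have r0 : 0 < r by rewrite !divr_gt0.
pose s := Num.min 1 (e / 2 / M).
have s0 : 0 < s by rewrite lt_min ltr01 !divr_gt0.
exists ([set b : K^o | rnorm ((a : K^o) - b) < s],
        [set v | forall q, D q -> q (v - x) < r]).
  split; first by apply/nbhs_rnormP; exists s.
  by apply/nbhs_seminormP; exists D => //; exists r.
move=> [b v] [/= ab vx]; apply: De => q Dq /=.
have sq := semiG (DG _ Dq); have [_ _ qZ] := sq.
have -> : b *: v - a *: x = b *: (v - x) + (b - a) *: x.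
  by rewrite scalerBr scalerBl addrA subrK.
apply: le_lt_trans (seminormD _ _ sq) _; rewrite !qZ (splitr e).
have ab' : rabs (b - a) < s by rewrite rabs_regular rnorm_distC.
apply: ltr_leD.
  have b1 : rabs b <= rabs a + 1.
    rewrite addrC !rabs_regular; apply: le_trans (rnorm_ge_dist (b : K^o) a) _.
    rewrite lerD2r -rabs_regular; apply/ltW/(lt_le_trans ab').
    by rewrite /s ge_min lexx.
  have := vx q Dq; rewrite /r ltr_pdivlMr // mulrC => h.
  by apply: le_lt_trans h; rewrite ler_wpM2r ?seminorm_ge0.
have : rabs (b - a) <= e / 2 / M.
  by apply/ltW/(lt_le_trans ab'); rewrite /s ge_min lexx orbT.
rewrite ler_pdivlMr //; apply: le_trans.
by rewrite ler_wpM2l ?rabs_ge0 ?xM.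
Qed.

Lemma rabs_i01 (l : {i01 K}) : rabs (l%:num) + rabs (1 - l%:num) = 1.
Proof.
have l0 : 0 <= l%:num by [].
have l1 : 0 <= 1 - l%:num by rewrite subr_ge0.
rewrite /rabs !ger0_norm // -real_partD addrC subrK.
by rewrite -real_scalar1 real_scalarK.
Qed.

Lemma seminorm_convex (x y z : X) (l : {i01 K}) q (c : R) : is_seminorm q ->
  q (x - z) <= c -> q (y - z) <= c ->
  q (conv l (x : convex_lmodType X) (y : convex_lmodType X) - z) <= c.
Proof.
move=> sq qx qy; have [_ _ qZ] := sq.
rewrite -[conv _ _ _]/(l%:num *: x + (1 - l%:num) *: y).
have -> : l%:num *: x + (1 - l%:num) *: y - z =
    l%:num *: (x - z) + (1 - l%:num) *: (y - z).
  rewrite !scalerBr addrACA -opprD -[in RHS]scalerDl.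
  by rewrite [X in X *: z]addrC subrK scale1r.
apply: le_trans (seminormD _ _ sq) _; rewrite !qZ.
apply: (@le_trans _ _ (rabs l%:num * c + rabs (1 - l%:num) * c)).
  by apply: lerD; rewrite ler_wpM2l ?rabs_ge0.
by rewrite -mulrDl rabs_i01 mul1r.
Qed.

Lemma seminorm_topology_convex : locally_convex_topology (seminorm_topology G).
Proof.
split; first exact: seminorm_topology_linear.
exists [set b : set T | open b /\ convex_set b].
  by move=> b /set_mem[].
split; first by move=> b [].
move=> x A /nbhs_seminormP[D [fD DG] [e e0 De]].
(* One bound [r < e] common to all of [D] gives openness and convexity without a maximum over
   [D]. *)
pose U := [set y : T | exists2 r, r < e & forall q, D q -> q (y - x) <= r].
exists U => /=; last first.
  by move=> y [r re yx]; apply: De => q Dq; exact: le_lt_trans (yx _ Dq) re.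
split; last by exists 0 => // q Dq; rewrite subrr seminorm0 //; exact/semiG/DG.
split.
  rewrite openE => y [r re yx]; apply/nbhs_seminormP; exists D => //.
  exists ((e - r) / 2); first by rewrite divr_gt0 // subr_gt0.
  move=> z zy; exists ((e - r) / 2 + r).
    by rewrite -ltrBrDr ltr_pdivrMr // mulr_natr mulr2n ltrDl subr_gt0.
  move=> q Dq; apply: le_trans (seminorm_dist _ _ y (semiG (DG _ Dq))) _.
  by apply: lerD; [exact/ltW/zy|exact: yx].
move=> y z l /set_mem[r re yx] /set_mem[s se zx]; apply/mem_set.
exists (Num.max r s); first by rewrite gt_max re.
move=> q Dq; apply: seminorm_convex; first exact/semiG/DG.
  by rewrite le_max yx.
by rewrite le_max zx // orbT.
Qed.

Lemma seminorm_topology_hausdorff :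
  (forall x, (forall q, G q -> q x = 0) -> x = 0) -> hausdorff_space T.
Proof.
move=> sep x y xy; apply/eqP; rewrite -subr_eq0; apply/eqP/sep => q Gq.
have sq := semiG Gq.
have [//|qxy] := eqVneq (q (x - y)) 0.
have e0 : 0 < q (x - y) / 2 by rewrite divr_gt0 // lt_neqAle eq_sym qxy seminorm_ge0.
have [z [zx zy]] := xy _ _ (nbhs_seminorm x Gq e0) (nbhs_seminorm y Gq e0).
move: zx zy; rewrite /= => zx zy.
have := seminorm_dist x y z sq; rewrite leNgt.
by rewrite (seminorm_distC x z sq) (splitr (q (x - y))) ltrD.
Qed.

End SeminormTopology.

Lemma seminorm_topology_sub G G' :
  (forall q, G q -> is_seminorm q) -> (forall q, G' q -> is_seminorm q) ->
  (forall q, G q -> exists2 q', G' q' & exists C : R, forall x, q x <= C * q' x) ->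
  open_sets (seminorm_topology G) `<=` open_sets (seminorm_topology G').
Proof.
move=> sG sG' GG' U oU x Ux.
have [D [fD DG] [e e0 De]] := oU x Ux.
have /finite_seqP[s sD] := fD.
suff [V nV VU] : exists2 V, nbhs (x : tspace (seminorm_topology G')) V &
    forall y, V y -> forall q, q \in s -> q (y - x) < e.
  have [D' HD' [r r0 Dr]] := (nbhs_seminormP sG' x V).1 nV.
  exists D' => //; exists r => // y /Dr /VU yx; apply: De => q.
  by rewrite sD; exact: yx.
have : {subset s <= [pred q | `[< G q >]]}.
  by move=> q qs; apply/asboolP/DG; rewrite sD.
elim: s {sD} => [_|q s IH sG'']; first by exists setT => //; exact: filterT.
have [|V nV Vs] := IH; first by move=> p ps; apply: sG''; rewrite inE ps orbT.
have /asboolP Gq : q \in [pred q | `[< G q >]] by apply: sG''; rewrite mem_head.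
have [q' Gq' [C qC]] := GG' q Gq.
have C0 : 0 < `|C| + 1 by rewrite ltr_wpDl.
exists (V `&` [set y | q' (y - x) < e / (`|C| + 1)]).
  by apply: filterI => //; apply: nbhs_seminorm => //; exact: divr_gt0.
move=> y [Vy q'y] p; rewrite inE => /predU1P[->|]; last exact: Vs.
apply: le_lt_trans (qC _) _.
move: q'y; rewrite /= ltr_pdivlMr // => q'y; apply: le_lt_trans q'y.
rewrite mulrC ler_wpM2l ?seminorm_ge0 //; first exact: sG'.
by rewrite (le_trans (ler_norm C)) // lerDl.
Qed.

Lemma norm_topology_seminorm N : is_seminorm N ->
  forall q, [set N] q -> is_seminorm q.
Proof. by move=> sN _ ->. Qed.

Lemma linear_topology_nbhs0 (tau : topology X) x (U : set X) :
  linear_topology tau -> nbhs (x : tspace tau) U ->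
  nbhs (0 : tspace tau) [set y | U (x + y)].
Proof.
move=> [ca _] xU; have := ca ((x : tspace tau), (0 : tspace tau)) U.
rewrite /= addr0 => /(_ xU)[[A B] [/= Ax B0] AB].
apply: filterS B0 => y By; apply: (AB (x, y)); split=> //=.
exact: (@nbhs_singleton (tspace tau)).
Qed.

Lemma linear_topology_half (tau : topology X) (U : set X) :
  linear_topology tau -> nbhs (0 : tspace tau) U ->
  exists2 V : set X, nbhs (0 : tspace tau) V &
    forall x y, V x -> V y -> U (x + y).
Proof.
move=> [ca _] U0; have := ca ((0 : tspace tau), (0 : tspace tau)) U.
rewrite /= addr0 => /(_ U0)[[A B] [/= A0 B0] AB].
exists (A `&` B); first exact: filterI.
by move=> x y [Ax _] [_ By]; exact: (AB (x, y)).
Qed.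

Lemma open_setsP (tau : topology X) (U : set X) :
  open_sets tau U <-> forall x, U x -> nbhs (x : tspace tau) U.
Proof.
split=> [oU x Ux|H]; first by apply/nbhs_tspaceP; exists U; split.
by rewrite -[open_sets tau U]/(open (U : set (tspace tau))) openE.
Qed.

Lemma agree_onP (B : set X) (t1 t2 : topology X) :
  (forall x (U : set X), B x -> nbhs (x : tspace t1) U ->
     exists2 V : set X, nbhs (x : tspace t2) V & V `&` B `<=` U) ->
  (forall x (U : set X), B x -> nbhs (x : tspace t2) U ->
     exists2 V : set X, nbhs (x : tspace t1) V & V `&` B `<=` U) ->
  agree_on B t1 t2.
Proof.
have sub s1 s2 : (forall x (U : set X), B x -> nbhs (x : tspace s1) U ->
     exists2 V : set X, nbhs (x : tspace s2) V & V `&` B `<=` U) ->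
    [set U `&` B | U in open_sets s1] `<=` [set U `&` B | U in open_sets s2].
  move=> H _ [U oU <-].
  (* The union over [I] is the largest [s2]-open set whose trace on [B] lies in [U]. *)
  pose I := {V : set X | open_sets s2 V /\ V `&` B `<=` U}.
  exists (\bigcup_(V : I) sval V).
    by apply: open_sets_bigU => -[V []].
  apply/seteqP; split=> x [].
    by move=> [[V /= [oV VU]] _ Vx] Bx; split=> //; exact: VU.
  move=> Ux Bx; split=> //.
  have [V [W [oW Wx WV]] VU] := H x U Bx ((open_setsP _ _).1 oU x Ux).
  have WU : open_sets s2 W /\ W `&` B `<=` U.
    by split=> // y [/WV Vy By]; apply: VU.
  by exists (exist _ W WU).
by move=> H1 H2; apply/seteqP; split; exact: sub.
Qed.

Lemma agree_on_nbhs (B : set X) (t1 t2 : topology X) x (U : set X) :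
  agree_on B t1 t2 -> B x -> nbhs (x : tspace t1) U ->
  exists2 V : set X, nbhs (x : tspace t2) V & V `&` B `<=` U.
Proof.
move=> agr Bx [W [oW Wx WU]].
have : [set U `&` B | U in open_sets t1] (W `&` B) by exists W.
rewrite agr => -[V oV VW]; exists V.
  exists V; split=> //; suff: (V `&` B) x by case.
  by rewrite VW.
by rewrite VW => y [/WU].
Qed.

Lemma nbhs_norm_topologyP N (x : X) (A : set X) : is_seminorm N ->
  nbhs (x : tspace (norm_topology N)) A <->
  exists2 e : R, 0 < e & [set y | N (y - x) < e] `<=` A.
Proof.
move=> sN; split.
  move=> /(nbhs_seminormP (norm_topology_seminorm sN))[D [fD DN] [e e0 De]].
  by exists e => // y yx; apply: De => q /DN ->.
move=> [e e0 eA]; apply: filterS eA _.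
exact: (nbhs_seminorm (norm_topology_seminorm sN)).
Qed.

End Seminorms.

(** * The mixed topology *)

(** The radii [r0 + n] grow from a ball already known to be good; their inverses are the null
    sequence of weights in [mixed_string] and [submixed_string]. *)
Lemma inv_shift_le (R : realType) (r e : R) : 0 < r -> 0 < e ->
  exists M : nat, forall n, (M <= n)%N -> (r + n%:R)^-1 <= e.
Proof.
move=> r0 e0; exists (Num.truncn e^-1).+1 => n Mn.
have rn : 0 < r + n%:R by rewrite ltr_wpDr.
rewrite -[leRHS]invrK lef_pV2 ?posrE ?invr_gt0 //.
apply: (@le_trans _ _ n%:R); last by rewrite lerDr ltW.
by apply/ltW/(lt_le_trans (truncnS_gt _)); rewrite ler_nat.
Qed.

Lemma cvg_inv_shift (R : realType) (r : R) : 0 < r ->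
  (fun n : nat => (r + n%:R)^-1) @ \oo --> (0 : R).
Proof.
move=> r0; apply/cvgrPdist_le => e e0; have [M HM] := inv_shift_le r0 e0.
by exists M => // n /HM; rewrite /= sub0r normrN ger0_norm // invr_ge0 addr_ge0 // ltW.
Qed.

(** The vector is rescaled to [N]-size just below [d]; the summand [e * d] keeps the denominator
    positive when [N x = 0]. *)
Lemma seminorm_bound (R : realType) (F : RorC) (X : lmodType (scalar_field R F))
    (p N : X -> R) (d : R) : is_seminorm p -> is_seminorm N -> 0 < d ->
  (forall x, N x < d -> p x < 1) -> forall x, p x <= d^-1 * N x.
Proof.
move=> sp sN d0 H x; apply/ler_addgt0Pr => e e0.
have D0 : 0 < N x + e * d by rewrite ltr_wpDl ?seminorm_ge0 // mulr_gt0.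
have t0 : 0 < d / (N x + e * d) by rewrite divr_gt0.
have : p (real_scalar F (d / (N x + e * d)) *: x) < 1.
  apply: H; rewrite seminormZr // gtr0_norm // mulrAC ltr_pdivrMr //.
  by rewrite ltr_pM2l // ltrDl mulr_gt0.
rewrite seminormZr // gtr0_norm // mulrAC ltr_pdivrMr // mul1r => h.
have -> : d^-1 * N x + e = d^-1 * (N x + e * d).
  by rewrite mulrDr mulrCA mulVf ?mulr1 // gt_eqF.
by rewrite ler_pdivlMl // ltW.
Qed.

(** * Infimal convolutions and suprema of seminorms *)

Section InfConvolution.
Variables (R : realType) (F : RorC).
Local Notation K := (scalar_field R F).
Variable X : lmodType K.
Implicit Types (p q N P : X -> R) (x y : X).

(** For seminorms, this is the largest seminorm below both [P] and [N]; its open unit ball is the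
    convex hull of the union of theirs. *)
Definition inf_convolution P N x : R := inf [set P (x - b) + N b | b in [set: X]].

Section Theory.
Variables P N : X -> R.
Hypotheses (sP : is_seminorm P) (sN : is_seminorm N).
Local Notation k := (inf_convolution P N).

Let lb x : lbound [set P (x - b) + N b | b in [set: X]] 0.
Proof. by move=> _ [b _ <-]; rewrite addr_ge0 ?seminorm_ge0. Qed.

Lemma inf_convolution_le x b : k x <= P (x - b) + N b.
Proof. by apply: ge_inf; [exists 0; exact: lb|exists b]. Qed.

Lemma inf_convolution_ge c x : (forall b, c <= P (x - b) + N b) -> c <= k x.
Proof.
move=> H; apply: lb_le_inf; first by exists (P (x - 0) + N 0), 0.
by move=> _ [b _ <-]; exact: H.
Qed.

Lemma inf_convolution_lt c x : k x < c -> exists b, P (x - b) + N b < c.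
Proof.
move=> kc; apply: contrapT => /forallNP H; move: kc; rewrite ltNge.
by rewrite inf_convolution_ge // => b; rewrite leNgt; apply/negP/H.
Qed.

Lemma inf_convolution_le1 x : k x <= P x.
Proof. by apply: le_trans (inf_convolution_le x 0) _; rewrite subr0 seminorm0 ?addr0. Qed.

Lemma inf_convolution_le2 x : k x <= N x.
Proof. by apply: le_trans (inf_convolution_le x x) _; rewrite subrr seminorm0 ?add0r. Qed.

Lemma inf_convolution_seminorm : is_seminorm k.
Proof.
have k0 x : 0 <= k x by apply: inf_convolution_ge => b; rewrite addr_ge0 ?seminorm_ge0.
have [[_ _ PZ] [_ _ NZ]] := (sP, sN).
have kZ a x : k (a *: x) <= rabs a * k x.
  have [->|a0] := eqVneq a 0.
    by rewrite rabs0 mul0r scale0r (le_trans (inf_convolution_le1 _)) ?seminorm0.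
  rewrite -ler_pdivrMl ?rabs_gt0 //; apply: inf_convolution_ge => b.
  rewrite ler_pdivrMl ?rabs_gt0 // mulrDr -PZ -NZ scalerBr.
  exact: inf_convolution_le.
apply: seminormI => // x y.
apply/ler_addgt0Pr => e e0.
have e2 : 0 < e / 2 by exact: divr_gt0.
have [b Hb] : exists b, P (x - b) + N b < k x + e / 2.
  by apply: inf_convolution_lt; rewrite ltrDl.
have [c Hc] : exists b, P (y - b) + N b < k y + e / 2.
  by apply: inf_convolution_lt; rewrite ltrDl.
apply: le_trans (inf_convolution_le _ (b + c)) _.
apply: (@le_trans _ _ ((P (x - b) + N b) + (P (y - c) + N c))).
  rewrite addrACA; apply: lerD; last exact: seminormD.
  by rewrite opprD addrACA seminormD.
by rewrite [e]splitr [leRHS]addrACA; exact/ltW/ltrD.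
Qed.

End Theory.

Definition sup_fun (q : nat -> X -> R) x : R := sup [set q n x | n in [set: nat]].

(** Every sublevel set of [p] is closed for [P]: the form in which a bound passes to a [P]-limit. *)
Definition lsc P p := forall x c,
  (forall e, 0 < e -> exists2 y, P (x - y) < e & p y <= c) -> p x <= c.

(** Continuity at 0 relative to [N]-balls, hence at every point of an [N]-ball. [mixed_topologyE]
    shows that these seminorms generate the mixed topology. *)
Definition mixed_seminorms N P : set (X -> R) := [set p |
  is_seminorm p /\ forall r e, 0 < e -> exists2 del, 0 < del &
    forall x, N x <= r -> P x < del -> p x < e].

Section SupFun.
Variables (N P : X -> R) (q : nat -> X -> R) (a C : nat -> R).
Hypotheses (sN : is_seminorm N) (sP : is_seminorm P).
Hypotheses (sq : forall n, is_seminorm (q n)).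
Hypotheses (qP : forall n x, q n x <= C n * P x).
Hypotheses (qN : forall n x, q n x <= a n * N x).
Hypotheses (a0 : forall e, 0 < e -> exists m, forall n, (m <= n)%N -> a n <= e).

Let bounded x : has_ubound [set q n x | n in [set: nat]].
Proof.
have [m am] := a0 ltr01.
exists (N x + \sum_(i < m) q i x) => _ [n _ <-].
have q0 (i : nat) : 0 <= q i x by exact: seminorm_ge0.
have [mn|nm] := leqP m n.
  apply: le_trans (qN _ _) _; apply: (@le_trans _ _ (N x)).
    by rewrite ler_piMl ?seminorm_ge0 ?am.
  by rewrite lerDl sumr_ge0.
rewrite (bigD1 (Ordinal nm)) //= addrCA lerDl addr_ge0 ?seminorm_ge0 //.
exact: sumr_ge0.
Qed.

Lemma sup_fun_ub n x : q n x <= sup_fun q x.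
Proof. by apply: ub_le_sup; [exact: bounded|exists n]. Qed.

Lemma sup_fun_le x c : (forall n, q n x <= c) -> sup_fun q x <= c.
Proof.
move=> H; apply: ge_sup; first by exists (q 0 x), 0.
by move=> _ [n _ <-].
Qed.

Lemma sup_fun_seminorm : is_seminorm (sup_fun q).
Proof.
apply: seminormI => [x|x y|b x].
- by apply: le_trans (sup_fun_ub 0 x); exact: seminorm_ge0.
- apply: sup_fun_le => n; apply: le_trans (seminormD _ _ (sq n)) _.
  by rewrite lerD ?sup_fun_ub.
apply: sup_fun_le => n; have [_ _ ->] := sq n.
by rewrite ler_wpM2l ?rabs_ge0 ?sup_fun_ub.
Qed.

Lemma sup_fun_lsc : lsc P (sup_fun q).
Proof.
move=> x c H; apply: sup_fun_le => n; apply/ler_addgt0Pr => e e0.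
have C0 : 0 < `|C n| + 1 by rewrite ltr_wpDl.
have [y Py yc] := H (e / (`|C n| + 1)) (divr_gt0 e0 C0).
apply: le_trans (seminorm_ge_dist x y (sq n)) _; rewrite addrC lerD //.
  exact: le_trans (sup_fun_ub n y) yc.
apply: le_trans (qP _ _) _; move/ltW: Py; rewrite ler_pdivlMr // mulrC.
apply: le_trans; rewrite ler_wpM2r ?seminorm_ge0 //.
by rewrite (le_trans (ler_norm _)) // lerDl.
Qed.

(** On an [N]-ball the terms with [n >= m] are uniformly small since [a n] tends to 0; the finitely
    many others are bounded by multiples of [P]. *)
Lemma sup_fun_mixed : mixed_seminorms N P (sup_fun q).
Proof.
split; first exact: sup_fun_seminorm.
move=> r e e0; have e2 : 0 < e / 2 by rewrite divr_gt0.
have r1 : 0 < `|r| + 1 by rewrite ltr_wpDl.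
have [m am] := a0 (divr_gt0 e2 r1).
have S0 : 0 < \sum_(i < m) `|C i| + 1 by rewrite ltr_wpDl // sumr_ge0.
exists (e / 2 / (\sum_(i < m) `|C i| + 1)); first exact: divr_gt0.
move=> x xr xP; apply: (@le_lt_trans _ _ (e / 2)); last first.
  by rewrite ltr_pdivrMr // mulr_natr mulr2n ltrDl.
apply: sup_fun_le => n; have [mn|nm] := leqP m n.
  apply: le_trans (qN _ _) _.
  apply: (@le_trans _ _ (e / 2 / (`|r| + 1) * N x)).
    by rewrite ler_wpM2r ?seminorm_ge0 ?am.
  rewrite mulrAC ler_pdivrMr // ler_wpM2l ?(ltW e2) // (le_trans xr) //.
  by rewrite (le_trans (ler_norm r)) // lerDl.
apply: le_trans (qP _ _) _; move/ltW: xP; rewrite ler_pdivlMr // mulrC.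
apply: le_trans; rewrite ler_wpM2r ?seminorm_ge0 //.
rewrite (le_trans (ler_norm _)) // (bigD1 (Ordinal nm)) //= -addrA lerDl.
by rewrite addr_ge0 // sumr_ge0.
Qed.

End SupFun.
End InfConvolution.

Section MixedTopology.
Variables (R : realType) (F : RorC).
Local Notation K := (scalar_field R F).
Variable X : lmodType K.
Implicit Types (p q : X -> R) (x y : X).
Variables N P : X -> R.
Hypotheses (sN : is_seminorm N) (sP : is_seminorm P) (PN : forall x, P x <= N x).

(* A string of N-bounded P-neighbourhoods of 0 contains the unit ball of the
   supremum of the seminorms K_n(x) = inf_b (P(x - b) / eps_n + N(b) / r_n):
   telescope x = b_0 + (b_1 - b_0) + ... + (x - b_m) along almost optimal b_n,
   where N x <= r_m. *)
Lemma mixed_string (W : nat -> set X) :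
  (forall n x y, W n.+1 x -> W n.+1 y -> W n (x + y)) ->
  (forall n r, exists2 del, 0 < del & forall x, N x <= r -> P x < del -> W n x) ->
  exists p, [/\ mixed_seminorms N P p, lsc P p & forall x, p x < 1 -> W 0 x].
Proof.
move=> WD Wn.
have WS n x : W n.+1 x -> W n x.
  have [d d0 dW] := Wn n.+1 0 => Wx; rewrite -[x]addr0; apply: WD => //.
  by apply: dW; rewrite seminorm0.
have [r0 r0gt0 r0W] : exists2 r0, 0 < r0 & forall x, N x < r0 -> W 1 x.
  have [d d0 dW] := Wn 1 1; exists (Num.min 1 d); first by rewrite lt_min ltr01.
  move=> x; rewrite lt_min => /andP[/ltW N1 Nd]; apply: dW => //.
  exact: le_lt_trans Nd.
pose r (n : nat) := r0 + n%:R.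
have rgt0 n : 0 < r n by rewrite ltr_wpDr.
(* The bound [2 * r n.+1] covers [b n.+1 - b n], as [N (b n) < r n]. The target [W n.+2] leaves one
   level for each addition in the telescope. *)
have /choice[d Hd] : forall n, exists d, 0 < d /\
    forall x, N x <= 2 * r n.+1 -> P x < d -> W n.+2 x.
  by move=> n; have [d d0 dW] := Wn n.+2 (2 * r n.+1); exists d.
(* A running minimum, so that [eps] decreases and [eps n.+1 + eps n] stays below [d n]. *)
pose fix m n := if n is n'.+1 then Num.min (m n') (d n) else d 0.
have mgt0 n : 0 < m n.
  by elim: n => [|n IH] /=; [case: (Hd 0)|rewrite lt_min IH; case: (Hd n.+1)].
have md n : m n <= d n by case: n => //= n; rewrite ge_min lexx orbT.
have mS n : m n.+1 <= m n by rewrite /= ge_min lexx.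
pose eps n := m n / 2.
have egt0 n : 0 < eps n by rewrite divr_gt0.
have eS n : eps n.+1 <= eps n by rewrite ler_wpM2r.
have ed n : eps n + eps n <= d n by rewrite -splitr.
pose q n := inf_convolution (fun x => P x * (eps n)^-1) (fun x => N x * (r n)^-1).
have sPn n : is_seminorm (fun x => P x * (eps n)^-1).
  by apply: seminorm_scale => //; rewrite invr_ge0 ltW.
have sNn n : is_seminorm (fun x => N x * (r n)^-1).
  by apply: seminorm_scale => //; rewrite invr_ge0 ltW.
have sq n : is_seminorm (q n) by exact: inf_convolution_seminorm.
have qP n x : q n x <= (eps n)^-1 * P x by rewrite mulrC; exact: inf_convolution_le1.
have qN n x : q n x <= (r n)^-1 * N x by rewrite mulrC; exact: inf_convolution_le2.
have a0 e : 0 < e -> exists M, forall n, (M <= n)%N -> (r n)^-1 <= e.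
  exact: inv_shift_le.
exists (sup_fun q); split.
- exact: sup_fun_mixed sN sP sq qP qN a0.
- exact: sup_fun_lsc sN sP sq qP qN a0.
move=> x px.
have /choice[b Hb] : forall n, exists b, P (x - b) < eps n /\ N b < r n.
  move=> n; have qx : q n x < 1.
    by apply: le_lt_trans px; exact: (sup_fun_ub sN sq qN a0).
  have [b Hb] := inf_convolution_lt qx.
  exists b; split.
    have : P (x - b) * (eps n)^-1 < 1.
      by apply: le_lt_trans Hb; rewrite lerDl (seminorm_ge0 _ (sNn n)).
    by rewrite ltr_pdivrMr // mul1r.
  have : N b * (r n)^-1 < 1.
    by apply: le_lt_trans Hb; rewrite lerDr (seminorm_ge0 _ (sPn n)).
  by rewrite ltr_pdivrMr // mul1r.
have [M NM] : exists M, N x <= r M.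
  exists (Num.truncn (N x)).+1; apply: (@le_trans _ _ (Num.truncn (N x)).+1%:R).
    by apply/ltW/truncnS_gt.
  by rewrite /r lerDr ltW.
have rS n : r n <= r n.+1 by rewrite lerD2l ler_nat.
(* Downward induction from the index [M] with [N x <= r M], where the remainder [x - b M] is itself
   bounded by [2 * r M]; each step spends one level of the string. *)
have key j : (j <= M)%N -> W (M - j).+1 (x - b (M - j)%N).
  elim: j => [_|j IH jM].
    rewrite subn0; apply/WS/(Hd M).2; last first.
      apply: lt_le_trans (Hb M).1 _; apply: le_trans (ed M).
      by rewrite lerDl ltW.
    apply: le_trans (seminormB _ _ sN) _; rewrite mulr_natl mulr2n.
    by rewrite lerD ?(le_trans _ (rS M)) // ltW // (Hb M).2.
  have {IH} := IH (ltnW jM); rewrite -(subnSK jM); set i := (M - j.+1)%N => IH.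
  have -> : x - b i = (x - b i.+1) + (b i.+1 - b i) by rewrite subrKA.
  apply: WD => //; apply: (Hd i).2.
    apply: le_trans (seminormB _ _ sN) _; rewrite mulr_natl mulr2n.
    rewrite lerD //; first by rewrite ltW // (Hb _).2.
    by rewrite (le_trans _ (rS i)) // ltW // (Hb _).2.
  apply: lt_le_trans (ed i).
  apply: le_lt_trans (seminorm_dist _ _ x sP) _; rewrite addrC.
  apply: ltrD; first by case: (Hb i).
  by rewrite (seminorm_distC _ _ sP) (lt_le_trans _ (eS i)) //; case: (Hb i.+1).
have := key M (leqnn M); rewrite subnn => W1.
by rewrite -[x](subrK (b 0%N)); apply: WD W1 _; apply: r0W; have := (Hb 0%N).2; rewrite /r addr0.
Qed.

Local Notation tau := (norm_topology P).
Local Notation gamma := (seminorm_topology (mixed_seminorms N P)).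

Lemma mixed_seminorms_seminorm p : mixed_seminorms N P p -> is_seminorm p.
Proof. by case. Qed.

Lemma mixed_seminorms_le : mixed_seminorms N P P.
Proof. by split=> // r e e0; exists e. Qed.

Lemma norm_topology_linear : linear_topology tau.
Proof. exact/seminorm_topology_linear/norm_topology_seminorm. Qed.

Lemma norm_topology_le : open_sets tau `<=` open_sets (norm_topology N).
Proof.
apply: seminorm_topology_sub; try exact: norm_topology_seminorm.
by move=> _ ->; exists N => //; exists 1 => x; rewrite mul1r.
Qed.

Lemma mixed_nbhs_bounded p x r e : mixed_seminorms N P p -> 0 < e ->
  exists2 del, 0 < del & forall y, N y <= r -> P (y - x) < del -> p (y - x) < e.
Proof.
move=> [sp Hp] e0; have [del del0 Hd] := Hp (r + N x) e e0.
exists del => // y Ny; apply: Hd; apply: le_trans (seminormB _ _ sN) _.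
by rewrite lerD2r.
Qed.

Lemma mixed_candidate_seminorms : mixed_candidate N tau gamma.
Proof.
split; first exact: seminorm_topology_linear mixed_seminorms_seminorm.
- move=> B [r Br]; apply: agree_onP => x U Bx.
    move=> /(nbhs_seminormP mixed_seminorms_seminorm)[D [fD DG] [e e0 De]].
    suff [del del0 Hd] : exists2 del, 0 < del & forall y, N y <= r ->
        P (y - x) < del -> forall p, D p -> p (y - x) < e.
      exists [set y | P (y - x) < del].
        exact: (nbhs_seminorm (norm_topology_seminorm sP)).
      by move=> y [/= yx By]; apply: De => p; apply: Hd => //; exact: Br.
    have /finite_seqP[s sD] := fD.
    have : {subset s <= [pred q | `[< mixed_seminorms N P q >]]}.
      by move=> q qs; apply/asboolP/DG; rewrite sD.
    suff : {subset s <= [pred q | `[< mixed_seminorms N P q >]]} ->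
        exists2 del, 0 < del & forall y, N y <= r ->
        P (y - x) < del -> forall p, p \in s -> p (y - x) < e.
      by move=> H /H[d d0 Hd]; exists d => // y yr yd p; rewrite sD; exact: Hd.
    elim: s {sD} => [_|q s IH sG]; first by exists 1.
    have [|d d0 Hd] := IH; first by move=> p ps; apply: sG; rewrite inE ps orbT.
    have /asboolP mq := sG q (mem_head _ _).
    have [d' d'0 Hd'] := mixed_nbhs_bounded x r mq e0.
    exists (Num.min d d'); first by rewrite lt_min d0.
    move=> y yr; rewrite lt_min => /andP[yd yd'] p; rewrite inE => /predU1P[->|].
      exact: Hd'.
    exact: Hd.
  move=> /(nbhs_norm_topologyP _ _ sP)[e e0 eU].
  exists [set y | P (y - x) < e]; last by move=> y [/eU].
  exact: (nbhs_seminorm mixed_seminorms_seminorm x mixed_seminorms_le e0).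
- apply: seminorm_topology_sub; [exact: norm_topology_seminorm|exact: mixed_seminorms_seminorm|].
  by move=> _ ->; exists P; [exact: mixed_seminorms_le|exists 1 => x; rewrite mul1r].
- apply: seminorm_topology_sub; [exact: mixed_seminorms_seminorm|exact: norm_topology_seminorm|].
  move=> p [sp Hp]; exists N => //.
  have [d d0 Hd] := Hp 1 1 ltr01.
  have m0 : 0 < Num.min 1 d by rewrite lt_min ltr01.
  exists (Num.min 1 d)^-1; apply: seminorm_bound => // x.
  rewrite lt_min => /andP[N1 Nd]; apply: Hd; first exact: ltW.
  exact: le_lt_trans Nd.
Qed.

(** Repeated halving of [W] is a string, and agreement with the [P]-topology on [N]-balls gives the
    second hypothesis of [mixed_string]. Convexity is thus produced by the construction, not by the
    candidate. *)
Lemma mixed_candidate_nbhs gamma' (W : set X) : mixed_candidate N tau gamma' ->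
  nbhs (0 : tspace gamma') W ->
  exists p, [/\ mixed_seminorms N P p, lsc P p & forall x, p x < 1 -> W x].
Proof.
move=> [lg agr _ _] W0.
pose Q (U V : set X) := nbhs (0 : tspace gamma') U ->
  nbhs (0 : tspace gamma') V /\ forall x y, V x -> V y -> U (x + y).
have /choice[h Hh] : forall U, exists V, Q U V.
  move=> U; have [U0|nU] := pselect (nbhs (0 : tspace gamma') U).
    by have [V V0 VU] := linear_topology_half lg U0; exists V.
  (* A dummy value: [h] is only iterated on neighbourhoods of 0. *)
  by exists set0.
pose V n := iter n h W.
have V0 n : nbhs (0 : tspace gamma') (V n).
  by elim: n => //= n IH; case: (Hh _ IH).
have [||p [mp lp pW]] := @mixed_string V; last by exists p.
  by move=> n x y; case: (Hh _ (V0 n)) => _; exact.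
move=> n r.
have r0 : norm_bounded N [set x | N x <= r] by exists r.
have [r_ge0|r_lt0] := lerP 0 r; last first.
  exists 1 => // x xr; have := seminorm_ge0 x sN.
  by rewrite leNgt (le_lt_trans xr).
have B0 : [set x | N x <= r] 0 by rewrite /= seminorm0.
have [U U0 UV] := agree_on_nbhs (agr _ r0) B0 (V0 n).
have [e e0 eU] := (nbhs_norm_topologyP _ _ sP).1 U0.
by exists e => // x xr xe; apply: UV; split=> //; apply: eU; rewrite /= subr0.
Qed.

Lemma mixed_topologyE : mixed_topology N tau = gamma.
Proof.
have [_] := mixed_topologyP norm_topology_linear norm_topology_le.
move=> /(_ gamma) ->//; split; first exact: mixed_candidate_seminorms.
move=> g cg U oU; apply/open_setsP => x Ux.
have [lg _ _ _] := cg.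
have xU := (open_setsP _ _).1 oU x Ux.
have [p [mp _ pU]] := mixed_candidate_nbhs cg (linear_topology_nbhs0 lg xU).
apply: filterS (nbhs_seminorm mixed_seminorms_seminorm x mp ltr01) => y /pU /=.
by rewrite addrC subrK.
Qed.

(** [gamma] is itself a candidate, so the comparison replaces its generating seminorms by lower
    semicontinuous ones. Completeness depends on this gain. *)
Lemma mixed_nbhsP x (U : set X) : nbhs (x : tspace gamma) U ->
  exists p, [/\ mixed_seminorms N P p, lsc P p & forall y, p (y - x) < 1 -> U y].
Proof.
have [lg _ _ _] := mixed_candidate_seminorms.
move=> /(linear_topology_nbhs0 lg)/(mixed_candidate_nbhs mixed_candidate_seminorms).
move=> [p [mp lp pU]]; exists p; split=> // y /pU /=.
by rewrite addrC subrK.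
Qed.

(** For convex [U] containing [x], the sets 2^-n (U - x) form a string. If one of them contained no
    [P]-neighbourhood of 0 within some [N]-ball, there would be an [N]-bounded sequence outside it
    tending to 0 for [P], hence for [gamma], against sequential openness. *)
Lemma mixed_topology_C_sequential : C_sequential gamma.
Proof.
move=> U cU oU; apply/open_setsP => x Ux.
pose V := [set y | U (x + y)].
pose W n := [set y | V (real_scalar F (2 ^+ n) *: y)].
have half y z : V y -> V z -> V (real_scalar F 2^-1 *: (y + z)).
  move=> Vy Vz.
  have h0 : 0 <= real_scalar F (2^-1 : R) by rewrite -real_scalar0 ler_real_scalar.
  have h1 : real_scalar F (2^-1 : R) <= 1.
    by rewrite -real_scalar1 ler_real_scalar invf_le1 // ler1n.
  have := cU (x + y : convex_lmodType X) (x + z) (Itv01 h0 h1) (mem_set Vy) (mem_set Vz).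
  move/set_mem; rewrite -[conv _ _ _]/(_ *: _ + (1 - _) *: _) /=.
  have -> : 1 - real_scalar F (2^-1 : R) = real_scalar F 2^-1.
    by rewrite -real_scalar1 -real_scalarB; congr real_scalar; lra.
  rewrite /V /=; congr (U _).
  change (real_scalar F 2^-1 *: (x + y) + real_scalar F 2^-1 *: (x + z) =
    x + real_scalar F 2^-1 *: (y + z)).
  rewrite -scalerDr addrACA scalerDr; congr (_ + _).
  rewrite -[in LHS](scale1r x) -scalerDl scalerA -real_scalar1 -real_scalarD.
  by rewrite -real_scalarM mulVf ?real_scalar1 ?scale1r.
have [||p [mp _ pV]] := @mixed_string W.
- move=> n y z; rewrite /W /= => Vy Vz; have := half _ _ Vy Vz.
  by rewrite -scalerDr scalerA -real_scalarM exprS mulrA mulVf ?mul1r.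
- move=> n r.
  apply: contrapT => H.
  have /choice[u Hu] : forall i : nat, exists y, [/\ N y <= r, P y < i.+1%:R^-1 & ~ W n y].
    move=> i; apply: contrapT => /forallNP Hi; apply: H; exists i.+1%:R^-1 => //.
    by move=> y yr yi; apply: contrapT => nW; apply: (Hi y).
  pose v i : tspace gamma := x + real_scalar F (2 ^+ n) *: u i.
  have vx : v @ \oo --> (x : tspace gamma).
    move=> A /mixed_nbhsP[p [mp _ pA]].
    have [sp Hp] := mp.
    have [d d0 Hd] := Hp r (2 ^+ n)^-1 ltac:(by rewrite invr_gt0 exprn_gt0).
    change (\forall i \near \oo, A (v i)); near=> i; apply: pA.
    change (p (x + real_scalar F (2 ^+ n) *: u i - x) < 1).
    rewrite [x + _]addrC addrK seminormZr // ger0_norm ?exprn_ge0 //.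
    rewrite mulrC -ltr_pdivlMr ?exprn_gt0 // mul1r.
    have [ur ui _] := Hu i; apply: Hd => //; apply: lt_trans ui _.
    by near: i; exact: near_infty_natSinv_lt (PosNum d0).
  have := oU v x Ux vx; move=> [i _ Hi].
  by have [_ _] := Hu i; apply; exact: (Hi i (leqnn i)).
apply: filterS (nbhs_seminorm mixed_seminorms_seminorm x mp ltr01) => y /pV.
by rewrite /W /= expr0 real_scalar1 scale1r /V /= addrC subrK.
Unshelve. all: by end_near.
Qed.

End MixedTopology.

(** * Saks spaces *)

Section SaksSpaces.
Variables (R : realType) (F : RorC).
Local Notation K := (scalar_field R F).
Variable X : lmodType K.
Implicit Types (p q : X -> R) (x y : X).
Variables N P : X -> R.
Hypotheses (sN : is_seminorm N) (sP : is_seminorm P) (PN : forall x, P x <= N x).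
Hypothesis P0 : forall x, P x = 0 -> x = 0.
Local Notation tau := (norm_topology P).
Local Notation gamma := (seminorm_topology (mixed_seminorms N P)).

Section System.
Variable G : set (X -> R).
Hypothesis SG : saks_system N tau G.

Lemma saks_seminorm q : G q -> is_seminorm q.
Proof. by case: SG => _ H _ _ /H[]. Qed.

Lemma saks_le q x : G q -> q x <= N x.
Proof.
case: SG => _ _ _ /(_ x) sup_eq Gq; rewrite -lee_fin -sup_eq.
by apply: ereal_sup_ubound; exists q.
Qed.

Lemma saks_lt x c : c < N x -> exists2 q, G q & c < q x.
Proof.
case: SG => _ _ _ /(_ x) sup_eq; rewrite -lte_fin -sup_eq.
by move=> /ereal_sup_gt[_ [q Gq <-]]; rewrite lte_fin; exists q.
Qed.

Lemma saks_continuous q : G q -> exists C, forall x, q x <= C * P x.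
Proof.
move=> Gq; have [_ /(_ q Gq)[sq cq] _ _] := SG.
have : nbhs (0 : tspace tau) [set x | q x < 1].
  have := cq (0 : tspace tau) [set t | t < 1].
  rewrite seminorm0 //; apply; exact: lt_nbhsl.
move=> /(nbhs_norm_topologyP _ _ sP)[e e0 eq1].
exists e^-1; apply: seminorm_bound => // x xe; apply: eq1.
by rewrite /= subr0.
Qed.

Lemma saks_lsc : lsc P N.
Proof.
move=> x c H; rewrite leNgt; apply/negP => /saks_lt[q Gq].
apply/negP; rewrite -leNgt; apply/ler_addgt0Pr => e e0.
have [C qC] := saks_continuous Gq.
have C0 : 0 < `|C| + 1 by rewrite ltr_wpDl.
have [y Py yc] := H (e / (`|C| + 1)) (divr_gt0 e0 C0).
apply: le_trans (seminorm_ge_dist x y (saks_seminorm Gq)) _; rewrite addrC lerD //.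
  exact: le_trans (saks_le y Gq) yc.
apply: le_trans (qC _) _; move/ltW: Py; rewrite ler_pdivlMr // mulrC.
apply: le_trans; rewrite ler_wpM2r ?seminorm_ge0 //.
by rewrite (le_trans (ler_norm _)) // lerDl.
Qed.

Lemma saks_mixed q : G q -> mixed_seminorms N P q.
Proof.
move=> Gq; split=> [|r e e0]; first exact: saks_seminorm.
have [C qC] := saks_continuous Gq.
have C0 : 0 < `|C| + 1 by rewrite ltr_wpDl.
exists (e / (`|C| + 1)); first exact: divr_gt0.
move=> x _; rewrite ltr_pdivlMr // mulrC; apply: le_lt_trans.
apply: le_trans (qC _) _; rewrite ler_wpM2r ?seminorm_ge0 //.
by rewrite (le_trans (ler_norm _)) // lerDl.
Qed.

(** Members of [G] lie below [N] and are dominated by multiples of [P], so a null sequence of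
    weights gives exactly the setting of [sup_fun_mixed]. *)
Lemma submixed_mixed p : submixed_seminorms G p -> mixed_seminorms N P p.
Proof.
move=> [q [a [Gq a0 acvg ->]]].
have /choice[C HC] : forall n, exists C, forall x, q n x <= C * P x.
  by move=> n; exact: saks_continuous.
apply: (@sup_fun_mixed _ _ _ _ _ (fun n x => q n x * a n) a (fun n => a n * C n)) => //.
- by move=> n; apply: seminorm_scale => //; exact: saks_seminorm.
- by move=> n x; rewrite mulrC -mulrA ler_wpM2l.
- by move=> n x; rewrite mulrC ler_wpM2l // saks_le.
move=> e e0; have /cvgrPdist_le/(_ e e0)[m _ Hm] := acvg.
exists m => n /Hm /=; rewrite sub0r normrN; apply: le_trans; exact: ler_norm.
Qed.

(* If N(x_n) > (n + 1)^2 on a bounded set, pick q_n in G with q_n(x_n) > (n + 1)^2: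
   the submixed seminorm sup_n q_n / (n + 1) is unbounded on the set. *)
Lemma mixed_bounded (B : set X) : tvs_bounded gamma B -> norm_bounded N B.
Proof.
move=> bB; apply: contrapT => /forallNP nB.
have /choice[u Hu] : forall n : nat, exists x, B x /\ n.+1%:R ^+ 2 < N x.
  move=> n; apply: contrapT => /forallNP H; apply: (nB (n.+1%:R ^+ 2)) => x Bx.
  by rewrite leNgt; apply/negP => xn; apply: (H x).
have /choice[q Hq] : forall n : nat, exists q, G q /\ n.+1%:R ^+ 2 < q (u n).
  by move=> n; have [q Gq qn] := saks_lt (Hu n).2; exists q.
pose p := sup_fun (fun n x => q n x * n.+1%:R^-1).
have mp : mixed_seminorms N P p.
  apply: submixed_mixed; exists q, (fun n => n.+1%:R^-1); split => //.
  - by move=> n; case: (Hq n).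
  - exact: cvg_harmonic.
have sq n : is_seminorm (fun x => q n x * n.+1%:R^-1).
  by apply: seminorm_scale => //; apply: saks_seminorm; case: (Hq n).
have p_ub n x : q n x * n.+1%:R^-1 <= p x.
  apply: (@sup_fun_ub _ _ _ N (fun n x => q n x * n.+1%:R^-1) (fun n => n.+1%:R^-1)) => //.
    by move=> k y; rewrite mulrC ler_wpM2l // saks_le //; case: (Hq k).
  move=> e e0; have /cvgrPdist_le/(_ e e0)[m _ Hm] := @cvg_harmonic R.
  exists m => k /Hm /=; rewrite sub0r normrN; apply: le_trans; exact: ler_norm.
have U0 : nbhs (0 : tspace gamma) [set x | p (x - 0) < 1].
  by apply: nbhs_seminorm => // ? [].
have [r r0 Br] := bB _ U0.
(* Absorption of [u n] by [r] bounds [p (u n)] by the modulus of [r], which is below [n.+1], whereas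
   [p (u n) > n.+1] by construction. *)
pose n := Num.truncn (real_part r).
have [Bu un] := Hu n.
have [w /= pw uw] : [set r *: w | w in [set x | p (x - 0) < 1]] (u n).
  by apply: (Br r) => //; rewrite ger0_norm // ltW.
have [[_ _ pZ] _] := mp.
have : n.+1%:R < p (u n).
  apply: lt_le_trans (p_ub n _); rewrite ltr_pdivlMr // -expr2.
  by case: (Hq n).
rewrite -uw pZ; apply/negP; rewrite -leNgt.
have rr : rabs r = real_part r by rewrite /rabs gtr0_norm.
rewrite subr0 in pw.
apply: (@le_trans _ _ (rabs r)); last by rewrite rr ltW // truncnS_gt.
by rewrite ler_piMr ?rabs_ge0 // ltW.
Qed.

End System.

Hypothesis N_lsc : lsc P N.
Hypothesis ball_complete : forall (u : nat -> X) r, (forall n, N (u n) <= r) ->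
  (forall e, 0 < e -> exists m, forall i j, (m <= i)%N -> (m <= j)%N -> P (u i - u j) < e) ->
  exists x, forall e, 0 < e -> exists m, forall i, (m <= i)%N -> P (x - u i) < e.

(** Members of [H] only come close to the ball. Points [(z n).1] of shrinking members are shadowed
    by points [(z n).2] of the ball, and the shadows form a Cauchy sequence to which [ball_complete]
    applies. *)
Lemma ball_filter_cvg (H : set_system X) r : ProperFilter H ->
  (forall e, 0 < e -> exists2 A, H A & forall x y, A x -> A y -> P (x - y) < e) ->
  (forall e A, 0 < e -> H A -> exists2 g, A g & exists2 b, N b <= r & P (g - b) < e) ->
  exists2 x, N x <= r & forall e, 0 < e -> H [set g | P (x - g) < e].
Proof.
move=> PH cH Hr.
have /choice[A HA] : forall n : nat, exists A, H A /\
    forall x y, A x -> A y -> P (x - y) < n.+1%:R^-1.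
  by move=> n; have [|A HA dA] := cH n.+1%:R^-1; last by exists A.
pose fix B n := if n is n'.+1 then B n' `&` A n else A 0%N.
have HB n : H (B n).
  elim: n => [|n IH] /=; first by case: (HA 0%N).
  by apply: filterI => //; case: (HA n.+1).
have BA n m : (n <= m)%N -> B m `<=` A n.
  elim: m => [|m IH]; first by rewrite leqn0 => /eqP->.
  by rewrite leq_eqVlt => /predU1P[->|]; [move=> x []|move=> /IH h x [/h]].
have /choice[z Hz] : forall n : nat, exists z : X * X,
    [/\ B n z.1, N z.2 <= r & P (z.1 - z.2) < n.+1%:R^-1].
  move=> n; have [|g Bg [b br gb]] := Hr n.+1%:R^-1 (B n) _ (HB n) => //.
  by exists (g, b).
have small (e : R) : 0 < e -> exists m : nat, forall n, (m <= n)%N -> n.+1%:R^-1 < e.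
  by move=> e0; have [m _ Hm] := near_infty_natSinv_lt (PosNum e0); exists m => n /Hm.
have [||x Hx] := @ball_complete (fun n => (z n).2) r.
- by move=> n; case: (Hz n).
- move=> e e0; have e3 : 0 < e / 3 by rewrite divr_gt0.
  have [m Hm] := small _ e3; exists m => i j mi mj.
  have [Bi _ zi] := Hz i; have [Bj _ zj] := Hz j.
  apply: le_lt_trans (seminorm_dist _ _ (z i).1 sP) _.
  have -> : e = e / 3 + (e / 3 + e / 3) by lra.
  apply: ltrD; first by rewrite seminorm_distC // (lt_trans zi) // Hm.
  apply: le_lt_trans (seminorm_dist _ _ (z j).1 sP) _.
  apply: ltrD; last by rewrite (lt_trans zj) // Hm.
  apply: lt_trans (Hm m (leqnn m)).
  by apply: (HA m).2; [exact: (BA m i mi)|exact: (BA m j mj)].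
have xA e : 0 < e -> H [set g | P (x - g) < e].
  move=> e0; have e3 : 0 < e / 3 by rewrite divr_gt0.
  have [m Hm] := small _ e3; have [m' Hm'] := Hx _ e3.
  pose n := maxn m m'.
  have [Bn _ zn] := Hz n.
  apply: filterS (HA n).1 => g Ag /=.
  apply: le_lt_trans (seminorm_dist _ _ (z n).2 sP) _.
  have -> : e = e / 3 + (e / 3 + e / 3) by lra.
  apply: ltrD; first by apply: Hm'; rewrite leq_maxr.
  apply: le_lt_trans (seminorm_dist _ _ (z n).1 sP) _.
  have n3 : n.+1%:R^-1 < e / 3 by apply: Hm; rewrite leq_maxl.
  apply: ltrD; first by rewrite seminorm_distC // (lt_trans zn).
  by apply: lt_trans n3; apply: (HA n).2 => //; exact: (BA n n).
(* [ball_complete] provides a limit somewhere in the space; lower semicontinuity of [N] places it in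
   the ball. *)
exists x => //; apply: N_lsc => e e0.
have [m Hm] := Hx e e0; exists (z m).2; first exact: Hm.
by case: (Hz m).
Qed.

(** Once the filter is [P]-close to a single [N]-ball it has a [P]-limit. Were it not, for each [n]
    some member would keep a positive [P]-distance from the ball of radius [n]; infimal convolutions
    scaled by these distances have a supremum that is a mixed seminorm, and the filter fails to be
    Cauchy for it. *)
Lemma mixed_complete : tvs_complete gamma.
Proof.
move=> G PG cG.
have cauchy p e : mixed_seminorms N P p -> 0 < e ->
    exists2 A : set X, G A & forall x y, A x -> A y -> p (x - y) < e.
  move=> mp e0.
  have /cG[A GA HA] := nbhs_seminorm (@mixed_seminorms_seminorm _ _ _ N P) 0 mp e0.
  by exists A => // x y Ax /(HA x y Ax) /=; rewrite subr0.
have [r Hr] : exists r, forall e A, 0 < e -> G A ->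
    exists2 g, A g & exists2 b, N b <= r & P (g - b) < e.
  apply: contrapT => /forallNP H.
  have /choice[z Hz] : forall n : nat, exists z : R * set X, [/\ 0 < z.1, G z.2 &
      forall g b, z.2 g -> N b <= n%:R -> z.1 <= P (g - b)].
    move=> n; apply: contrapT => /forallNP Hn; apply: (H n%:R) => e A e0 GA.
    apply: contrapT => /forall2NP Hg; apply: (Hn (e, A)); split=> //= g b Ag bn.
    have [//|] := Hg g; move/forall2NP/(_ b) => [//|/negP].
    by rewrite -leNgt.
  (* The radius is doubled because the contradiction is reached at [g0 + b], where [N g0] and [N b]
     are both below [n.+1]. *)
  pose e n := (z n.+1.*2).1.
  have e0 n : 0 < e n by case: (Hz n.+1.*2).
  pose q n := inf_convolution (fun x => P x * (e n)^-1) (fun x => N x * n.+1%:R^-1).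
  have sPn n : is_seminorm (fun x => P x * (e n)^-1).
    by apply: seminorm_scale => //; rewrite invr_ge0 ltW.
  have sNn n : is_seminorm (fun x => N x * n.+1%:R^-1).
    by apply: seminorm_scale => //; rewrite invr_ge0.
  have sq n : is_seminorm (q n) by exact: inf_convolution_seminorm.
  have qP n x : q n x <= (e n)^-1 * P x by rewrite mulrC; exact: inf_convolution_le1.
  have qN n x : q n x <= n.+1%:R^-1 * N x by rewrite mulrC; exact: inf_convolution_le2.
  have a0 (c : R) : 0 < c -> exists M, forall n, (M <= n)%N -> n.+1%:R^-1 <= c.
    move=> c0; have [m _ Hm] := near_infty_natSinv_lt (PosNum c0).
    by exists m => n /Hm /ltW.
  have [A GA HA] := cauchy _ _ (sup_fun_mixed sN sP sq qP qN a0) ltr01.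
  have [g0 Ag0] := filter_ex GA.
  pose n := Num.truncn (N g0).
  have Ng0 : N g0 < n.+1%:R by exact: truncnS_gt.
  have [_ GAn An] := Hz n.+1.*2.
  have [g [Ag Ang]] := filter_ex (filterI GA GAn).
  have qn : q n (g - g0) < 1.
    by apply: le_lt_trans (HA _ _ Ag Ag0); exact: (sup_fun_ub sN sq qN a0).
  have [b Hb] := inf_convolution_lt qn.
  have : P (g - g0 - b) * (e n)^-1 < 1.
    by apply: le_lt_trans Hb; rewrite lerDl (seminorm_ge0 _ (sNn n)).
  rewrite ltr_pdivrMr // mul1r ltNge -addrA -opprD => /negP; apply; apply: An => //.
  have : N b * n.+1%:R^-1 < 1.
    by apply: le_lt_trans Hb; rewrite lerDr (seminorm_ge0 _ (sPn n)).
  rewrite ltr_pdivrMr // mul1r => Nb.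
  by apply: le_trans (seminormD _ _ sN) _; rewrite -addnn natrD lerD // ltW.
have [x _ Px] := ball_filter_cvg PG (fun e => cauchy P e (mixed_seminorms_le N sP)) Hr.
exists x => U /(mixed_nbhsP sN sP PN)[p [mp lp pU]].
(* For [g] in [A] the vector [x - g] is a [P]-limit of vectors [g' - g] with [p (g' - g) < 1 / 2];
   lower semicontinuity carries the bound over to [x - g]. *)
have [A GA HA] := cauchy p (1 / 2) mp ltac:(by rewrite divr_gt0).
have [sp _] := mp.
apply: (filterS _ GA) => g Ag; apply: pU; rewrite seminorm_distC //.
apply: (@le_lt_trans _ _ (1 / 2)); last by lra.
apply: lp => e e0; have [g' [Ag' Pg']] := filter_ex (filterI GA (Px e e0)).
exists (g' - g); last by apply/ltW/HA.
by rewrite opprB addrA subrK.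
Qed.

(** Total boundedness of the [N]-balls for [P], in its ultrafilter form. *)
Hypothesis ball_ultra_cauchy : forall (H : set_system X) r, UltraFilter H ->
  H [set x | N x <= r] ->
  forall e, 0 < e -> exists2 A, H A & forall x y, A x -> A y -> P (x - y) < e.

(** An ultrafilter on the ball is Cauchy for [P], hence [P]-convergent within the ball, and on
    [N]-balls [P]-convergence is [gamma]-convergence. *)
Lemma mixed_ball_compact r : compact ([set x | N x <= r] : set (tspace gamma)).
Proof.
rewrite compact_ultra => H UH Hr.
have [|x xr Px] := ball_filter_cvg _ (ball_ultra_cauchy UH Hr) (r := r).
  move=> e A e0 HA; have [g [Ag gr]] := filter_ex (filterI HA Hr).
  by exists g => //; exists g => //; rewrite subrr seminorm0.
exists x; split=> //= U /(mixed_nbhsP sN sP PN)[p [mp lp pU]].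
have [d d0 Hd] := mixed_nbhs_bounded sN x r mp ltr01.
apply: filterS (filterI Hr (Px d d0)) => g [gr xg]; apply: pU; apply: Hd => //.
by rewrite seminorm_distC.
Qed.

Lemma mixed_hausdorff : hausdorff_space (tspace gamma).
Proof.
apply: seminorm_topology_hausdorff; first exact: mixed_seminorms_seminorm.
by move=> x H; apply/P0/H; exact: mixed_seminorms_le.
Qed.

Lemma mixed_semi_Montel : (exists G, saks_system N tau G) -> semi_Montel gamma.
Proof.
move=> [G SG]; split.
- exact/seminorm_topology_convex/mixed_seminorms_seminorm.
- exact: mixed_hausdorff.
move=> B /(mixed_bounded SG)[r Br]; rewrite precompactE.
have cr := @mixed_ball_compact r.
apply: (subclosed_compact (@closed_closure _ _) cr).
have /closure_id -> := compact_closed mixed_hausdorff cr.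
exact: closure_subset.
Qed.

(* Banach-Dieudonne: if {N <= r_n, q_i <= r_i (i < n)} lies in the open set V,
   compactness of {N <= r_(n+1)} \ V yields q_n in G such that this persists at
   n + 1, because sup_G q = N. *)
Lemma submixed_string G (V : set X) : saks_system N tau G ->
  open (V : set (tspace gamma)) -> V 0 ->
  exists p, submixed_seminorms G p /\ forall x, p x < 1 -> V x.
Proof.
move=> SG oV V0.
have [r0 r0gt0 r0V] : exists2 r0, 0 < r0 & forall x, N x <= r0 -> V x.
  have [_ _ _ gN] := mixed_candidate_seminorms sN sP PN.
  have /(_ 0 V0) := (open_setsP _ _).1 (gN V oV).
  move=> /(nbhs_norm_topologyP _ _ sN)[e e0 eV].
  exists (e / 2); first by rewrite divr_gt0.
  move=> x xe; apply: eV => /=; rewrite subr0 (le_lt_trans xe) //.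
  by rewrite ltr_pdivrMr // mulr_natr mulr2n ltrDl.
pose r (n : nat) := r0 + n%:R.
have rgt0 n : 0 < r n by rewrite ltr_wpDr.
have G_dir : forall p q, G p -> G q -> exists2 s, G s & forall x, p x <= s x /\ q x <= s x.
  by case: SG => -[].
have step n (C : set X) : (closed (C : set (tspace gamma))) ->
    (forall x, N x <= r n -> C x -> V x) ->
    exists2 q, G q & forall x, N x <= r n.+1 -> C x -> q x <= r n -> V x.
  move=> cC CV; apply: contrapT => /forall2NP Hq.
  have Hq' q : G q -> exists x, [/\ N x <= r n.+1, C x, q x <= r n & ~ V x].
    move=> Gq; have [//|H] := Hq q; apply: contrapT => /forallNP Hx.
    by apply: H => x x1 x2 x3; apply: contrapT => x4; apply: (Hx x); split.
  (* The counterexamples for [q]. They decrease along the directed system [G], so they are a filter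
     base and compactness gives a cluster point. *)
  pose S q := [set x | [/\ N x <= r n.+1, C x, q x <= r n & ~ V x]].
  have FF : ProperFilter (filter_from G S).
    apply: filter_from_proper; last by move=> q /Hq'[x Hx]; exists x.
    apply: filter_from_filter; first by case: SG => -[[q Gq] _] _ _ _; exists q.
    move=> p q Gp Gq; have [s Gs Hs] := G_dir p q Gp Gq; exists s => // x [x1 x2 x3 x4].
    by split; split=> //; apply: le_trans x3; case: (Hs x).
  have FS q : G q -> filter_from G S (S q) by exists q.
  have [q0 Gq0] : G !=set0 by case: SG => -[].
  have [|x [xr clx]] := mixed_ball_compact (r := r n.+1) FF.
    by apply: filterS (FS _ Gq0) => x [].
  have Cx : C x.
    apply: cC => B xB; have [y [[_ Cy _ _] By]] := clx _ _ (FS _ Gq0) xB.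
    by exists y.
  have nVx : ~ V x.
    move=> Vx; have [|y [[_ _ _ nVy]]] := clx _ V (FS _ Gq0); last by [].
    exact: (open_setsP _ _).1 oV x Vx.
  (* If [N x > r n], some [q] in [G] has [q x > r n], which a cluster point of vectors with
     [q <= r n] cannot satisfy. *)
  apply/nVx/CV => //; rewrite leNgt; apply/negP => /(saks_lt SG)[q Gq rq].
  have rq0 : 0 < q x - r n by rewrite subr_gt0.
  have := nbhs_seminorm (@mixed_seminorms_seminorm _ _ _ N P) x (saks_mixed SG Gq) rq0.
  move=> /(clx _ _ (FS _ Gq))[y [[_ _ yr _] /=]].
  have sq := saks_seminorm SG Gq.
  rewrite seminorm_distC // ltrBrDr; apply/negP; rewrite -leNgt.
  apply: le_trans (seminorm_ge_dist x y sq) _; exact: lerD.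
(* The choice ranges over all pairs, with [P] as a dummy value where the induction hypothesis fails;
   the recursion below only meets good pairs. *)
have /choice[h Hh] : forall z : nat * set X, exists q, closed (z.2 : set (tspace gamma)) ->
    (forall x, N x <= r z.1 -> z.2 x -> V x) ->
    G q /\ forall x, N x <= r z.1.+1 -> z.2 x -> q x <= r z.1 -> V x.
  move=> [n C]; have [cC|nC] := pselect (closed (C : set (tspace gamma))); last by exists P.
  have [CV|nV] := pselect (forall x, N x <= r n -> C x -> V x); last by exists P.
  by have [q Gq Hq] := step n C cC CV; exists q.
pose fix C n := if n is n'.+1 then C n' `&` [set x | h (n', C n') x <= r n'] else setT.
pose q n := h (n, C n).
have HC n : closed (C n : set (tspace gamma)) /\ (forall x, N x <= r n -> C n x -> V x).
  elim: n => [|n [cC CV]].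
    split; first exact: closedT.
    by move=> x; rewrite /r addr0 => xr _; exact: r0V.
  have [Gq HV] := Hh (n, C n) cC CV; split; last by move=> x xr [Cx]; exact: HV.
  apply: closedI => //= x clx; rewrite /= -/(q n); apply/ler_addgt0Pr => e e0.
  have sq := saks_seminorm SG Gq.
  have := nbhs_seminorm (@mixed_seminorms_seminorm _ _ _ N P) x (saks_mixed SG Gq) e0.
  move=> /clx[y [/= yr yx]].
  rewrite addrC; apply: le_trans (seminorm_ge_dist x y sq) _; apply: lerD => //.
  by rewrite seminorm_distC // ltW.
have Gq n : G (q n) by have [cC CV] := HC n; case: (Hh (n, C n) cC CV).
exists (sup_fun (fun n x => q n x * (r n)^-1)); split.
  exists q, (fun n => (r n)^-1); split=> //; last exact: cvg_inv_shift.
  by move=> n; rewrite invr_ge0 ltW.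
move=> x px.
have qr n : q n x <= r n.
  suff : q n x * (r n)^-1 <= 1 by rewrite ler_pdivrMr // mul1r.
  apply: le_trans (ltW px).
  apply: (@sup_fun_ub _ _ _ N (fun n x => q n x * (r n)^-1) (fun n => (r n)^-1)) => //.
  - move=> m; have rm : 0 <= (r m)^-1 by rewrite invr_ge0 ltW.
    exact: (seminorm_scale rm (saks_seminorm SG (Gq m))).
  - by move=> m y; rewrite mulrC ler_wpM2l ?(saks_le SG) // invr_ge0 ltW.
  - by move=> e; exact: inv_shift_le.
have Cx n : C n x by elim: n => [|n IH] //=; split=> //; exact: qr.
apply: ((HC (Num.truncn (N x)).+1).2 x _ (Cx _)).
apply: (@le_trans _ _ (Num.truncn (N x)).+1%:R); first exact/ltW/truncnS_gt.
by rewrite /r lerDr ltW.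
Qed.

Lemma mixed_submixed G : saks_system N tau G ->
  gamma = seminorm_topology (submixed_seminorms G).
Proof.
move=> SG; have sG q : submixed_seminorms G q -> is_seminorm q.
  by move=> /(submixed_mixed SG)[].
apply: topology_ext; apply/seteqP; split; last first.
  apply: seminorm_topology_sub => //; first exact: mixed_seminorms_seminorm.
  move=> q Gq; exists q; first exact: (submixed_mixed SG).
  by exists 1 => x; rewrite mul1r.
move=> U oU; apply/open_setsP => x Ux.
have lg := seminorm_topology_linear (@mixed_seminorms_seminorm _ _ _ N P).
have [V [oV V0 VU]] := linear_topology_nbhs0 lg ((open_setsP _ _).1 oU x Ux).
have [p [Gp pV]] := submixed_string SG oV V0.
apply: filterS (nbhs_seminorm sG x Gp ltr01) => y /pV /VU /=.
by rewrite addrC subrK.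
Qed.

End SaksSpaces.

(** * Hahn-Banach and uniform boundedness *)

(* Completeness of the scalar field is needed for both R and R[i], and the latter
   has no completeNormedModType structure: hence a predicate. *)
Definition cauchy_complete (R : realType) (F : RorC)
    (E : normedModType (scalar_field R F)) := forall G : set_system E,
  ProperFilter G ->
  (forall e : R, 0 < e -> exists2 A, G A & forall x y, A x -> A y -> rnorm (x - y) < e) ->
  cvg G.

Lemma complete_cauchy_complete (R : realType) (F : RorC)
    (E : completeNormedModType (scalar_field R F)) : cauchy_complete E.
Proof.
move=> G PG H; apply: cauchy_cvg; apply: cauchy_exP => e e0.
have e0' : 0 < real_part e.
  by rewrite -(ltr_real_scalar F) real_scalar0 real_partK ?ltW.
have [A GA HA] := H _ e0'.
have [x Ax] := filter_ex GA.
exists x; apply: filterS GA => y Ay; rewrite -ball_normE /=.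
by rewrite norm_rnorm -(real_partK (ltW e0)) ltr_real_scalar; exact: HA.
Qed.

Lemma cauchy_rnorm_cvg (R : realType) (F : RorC)
    (E : normedModType (scalar_field R F)) (T : Type) (G : set_system T)
    (f : T -> E) : cauchy_complete E -> ProperFilter G ->
  (forall e : R, 0 < e ->
    exists2 A, G A & forall x y, A x -> A y -> rnorm (f x - f y) < e) ->
  cvg (f @ G).
Proof.
move=> cE PG H; apply: cE => e /H[A GA HA]; exists (f @` A).
  by change (G (f @^-1` (f @` A))); apply: filterS GA => x Ax; exists x.
by move=> _ _ [x Ax <-] [y Ay <-]; exact: HA.
Qed.

Section HahnBanach.
Variables (R : realType) (F : RorC).
Local Notation K := (scalar_field R F).
Variable X : lmodType K.
Implicit Types (p q : X -> R) (x y : X).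
Local Notation "t ** x" := (real_scalar F t *: x) (at level 40).

Definition sublinear p :=
  (forall x y, p (x + y) <= p x + p y) /\
  forall (t : R) x, 0 <= t -> p (t ** x) = t * p x.

Definition real_linear p :=
  (forall x y, p (x + y) = p x + p y) /\ forall (t : R) x, p (t ** x) = t * p x.

Lemma sublinear0 p : sublinear p -> p 0 = 0.
Proof. by move=> [_ pZ]; rewrite -(scaler0 _ (real_scalar F (0 : R))) pZ ?mul0r. Qed.

Lemma sublinear_geN p x : sublinear p -> - p (- x) <= p x.
Proof.
move=> sp; have [pD _] := sp.
by have := pD x (- x); rewrite subrr sublinear0 // => h; rewrite -subr_ge0 opprK.
Qed.

Section Shift.
Variables (p : X -> R) (y : X).
Hypothesis sp : sublinear p.

(** For sublinear [p], the largest sublinear functional below [p] with value at most [- p y] at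
    [- y]. Coinciding with it for every [y] makes a minimal sublinear functional odd. *)
Definition sublinear_shift x : R :=
  inf [set p (x + t ** y) - t * p y | t in [set t | 0 <= t]].

Let lb x t : 0 <= t -> - p (- x) <= p (x + t ** y) - t * p y.
Proof.
have [pD pZ] := sp; move=> t0; rewrite lerBrDr addrC lerBlDr -pZ //.
by apply: le_trans (pD _ _); rewrite addrC addKr.
Qed.

Lemma sublinear_shift_le x t : 0 <= t -> sublinear_shift x <= p (x + t ** y) - t * p y.
Proof.
move=> t0; apply: ge_inf; last by exists t.
by exists (- p (- x)) => _ [s s0 <-]; exact: lb.
Qed.

Lemma sublinear_shift_ge x c :
  (forall t, 0 <= t -> c <= p (x + t ** y) - t * p y) -> c <= sublinear_shift x.
Proof.
move=> H; apply: lb_le_inf; first by exists (p (x + 0 ** y) - 0 * p y), 0 => /=.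
by move=> _ [t t0 <-]; exact: H.
Qed.

Lemma sublinear_shift_sublinear : sublinear sublinear_shift.
Proof.
have [pD pZ] := sp; split=> [x x'|].
  rewrite -lerBlDr; apply: sublinear_shift_ge => t t0.
  rewrite lerBlDr [leRHS]addrC -lerBlDr; apply: sublinear_shift_ge => s s0.
  rewrite lerBlDr; apply: le_trans (sublinear_shift_le _ (addr_ge0 t0 s0)) _.
  rewrite real_scalarD scalerDl addrACA mulrDl.
  by have := pD (x + t ** y) (x' + s ** y); lra.
have le c x : 0 < c -> sublinear_shift (c ** x) <= c * sublinear_shift x.
  move=> c0; rewrite -ler_pdivrMl //; apply: sublinear_shift_ge => t t0.
  rewrite ler_pdivrMl // mulrBr -(pZ c _ (ltW c0)) scalerDr scalerA -real_scalarM mulrA.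
  by apply: sublinear_shift_le; rewrite mulr_ge0 // ltW.
move=> c x; rewrite le_eqVlt => /predU1P[<-|c0].
  rewrite mul0r real_scalar0 scale0r; apply/eqP; rewrite eq_le; apply/andP; split.
    apply: le_trans (sublinear_shift_le 0 (lexx 0)) _.
    by rewrite mul0r subr0 real_scalar0 scale0r addr0 sublinear0.
  by apply: sublinear_shift_ge => t t0; rewrite add0r pZ // subrr.
apply/eqP; rewrite eq_le le //= -ler_pdivlMl //.
have {1}-> : x = c^-1 ** (c ** x).
  by rewrite scalerA -real_scalarM mulVf ?gt_eqF // real_scalar1 scale1r.
by apply: le; rewrite invr_gt0.
Qed.

Lemma sublinear_shift_le1 x : sublinear_shift x <= p x.
Proof.
by have := sublinear_shift_le x (lexx 0); rewrite mul0r subr0 real_scalar0 scale0r addr0.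
Qed.

Lemma sublinear_shiftN : sublinear_shift (- y) <= - p y.
Proof.
have := sublinear_shift_le (- y) ler01.
by rewrite mul1r real_scalar1 scale1r addNr sublinear0 // sub0r.
Qed.

End Shift.

(* A minimal sublinear functional equals each of its shifts, hence is odd. *)
Lemma sublinear_minorant p : sublinear p ->
  exists u, real_linear u /\ forall x, u x <= p x.
Proof.
move=> sp.
pose T := {q : X -> R | sublinear q /\ forall x, q x <= p x}.
pose r (s t : T) := `[< forall x, sval t x <= sval s x >].
have pp : sublinear p /\ forall x, p x <= p x by split.
have [||||u Hu] := @Zorn T r.
- by move=> s; apply/asboolP.
- move=> s t w /asboolP st /asboolP tw; apply/asboolP => x.
  exact: le_trans (tw x) (st x).
- move=> [s s'] [t t'] /asboolP /= st /asboolP /= ts; apply/eq_exist => /=.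
  by apply/funext => x; apply/eqP; rewrite eq_le st ts.
- move=> A totA; have [[s0 As0]|nA] := pselect (A !=set0); last first.
    by exists (exist _ p pp) => s As; case: nA; exists s.
  pose m x : R := inf [set sval s x | s in A].
  have lb x (s : T) : - p (- x) <= sval s x.
    have [ss sp'] := svalP s; apply: le_trans (sublinear_geN x ss).
    by rewrite lerN2.
  have mle x (s : T) : A s -> m x <= sval s x.
    by move=> As; apply: ge_inf; [exists (- p (- x)) => _ [t _ <-]|exists s].
  have mge x c : (forall s : T, A s -> c <= sval s x) -> c <= m x.
    move=> H; apply: lb_le_inf; first by exists (sval s0 x), s0.
    by move=> _ [s As <-]; exact: H.
  have mZ (c : R) x : 0 < c -> m (c ** x) <= c * m x.
    move=> c0; rewrite -ler_pdivrMl //; apply: (mge _ _) => s As.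
    rewrite ler_pdivrMl //; have [_ sZ] := (svalP s).1.
    by rewrite -(sZ _ _ (ltW c0)) mle.
  have sm : sublinear m.
    split=> [x y|c x].
      rewrite -lerBlDr; apply: (mge _ _) => s As.
      rewrite lerBlDr [leRHS]addrC -lerBlDr; apply: (mge _ _) => t At; rewrite lerBlDr.
      (* Subadditivity of the infimum uses that [A] is a chain: the smaller of [s] and [t] serves
         for both terms. *)
      have [/asboolP st|/asboolP ts] := totA s t As At.
        apply: (le_trans (mle _ t At)); have [[tD _] _] := svalP t.
        by apply: (le_trans (tD _ _)); rewrite addrC lerD.
      apply: (le_trans (mle _ s As)); have [[sD _] _] := svalP s.
      by apply: (le_trans (sD _ _)); rewrite addrC lerD.
    rewrite le_eqVlt => /predU1P[<-|c0].
      rewrite mul0r real_scalar0 scale0r; apply/eqP; rewrite eq_le; apply/andP; split.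
        by apply: le_trans (mle 0 _ As0) _; rewrite sublinear0 //; exact: (svalP s0).1.
      by apply: (mge _ _) => s As; rewrite sublinear0 //; exact: (svalP s).1.
    apply/eqP; rewrite eq_le mZ //= -ler_pdivlMl //.
    have {1}-> : x = c^-1 ** (c ** x).
      by rewrite scalerA -real_scalarM mulVf ?gt_eqF // real_scalar1 scale1r.
    by apply: mZ; rewrite invr_gt0.
  have mp : sublinear m /\ forall x, m x <= p x.
    by split=> // x; apply: le_trans (mle x _ As0) _; exact: (svalP s0).2.
  by exists (exist _ m mp) => s As; apply/asboolP => x; exact: mle.
have {}Hu t : (forall x, sval t x <= sval u x) -> t = u.
  by move=> tu; apply: Hu; apply/asboolP.
move: u Hu => [u' [su up]] /= Hu.
have uN y : u' (- y) = - u' y.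
  apply/eqP; rewrite eq_le; apply/andP; split; last by rewrite lerNl sublinear_geN.
  have HS : sublinear (sublinear_shift u' y) /\ forall x, sublinear_shift u' y x <= p x.
    split; first exact: sublinear_shift_sublinear.
    by move=> x; apply: le_trans (sublinear_shift_le1 y su x) (up x).
  have /(congr1 sval) /= e := Hu (exist _ _ HS) (sublinear_shift_le1 y su).
  by have := sublinear_shiftN y su; rewrite e.
have [uD uZ] := su.
exists u'; split=> //; split=> [x y|t x].
  apply/eqP; rewrite eq_le uD /=.
  by have := uD (- x) (- y); rewrite -opprD !uN -opprD lerN2.
have [t0|t0] := lerP 0 t; first exact: uZ.
have := uZ (- t) x; rewrite oppr_ge0 ltW // => /(_ isT).
have -> : (- t) ** x = - (t ** x).
  by rewrite -[- t]sub0r real_scalarB real_scalar0 sub0r scaleNr.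
by rewrite uN mulNr => /oppr_inj.
Qed.

End HahnBanach.

(** * Norming functionals and the uniform boundedness principle *)

Section WeakBoundedness.
Variables (R : realType) (F : RorC).
Local Notation K := (scalar_field R F).
Variable E : normedModType K.
Implicit Types (u : E -> R) (v x y : E).

Lemma rnorm_seminorm : is_seminorm (fun v => rnorm v).
Proof. by split=> *; rewrite ?rnorm_ge0 ?ler_rnormD ?rnormZ. Qed.

(** The linear minorant is taken below the shift of the norm along [v], which forces
    [u (- v) <= - rnorm v]. *)
Lemma norming_functional v :
  exists u, [/\ real_linear u, forall x, `|u x| <= rnorm x & u v = rnorm v].
Proof.
have sn : sublinear (fun x => rnorm x).
  by split=> [x y|t x t0]; rewrite ?ler_rnormD // rnormZr ger0_norm.
have [u [ul us]] := sublinear_minorant (sublinear_shift_sublinear v sn).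
have [uD uZ] := ul.
have u0 : u 0 = 0 by rewrite -(scaler0 _ (real_scalar F (0 : R))) uZ mul0r.
have uN x : u (- x) = - u x by apply/eqP; rewrite -addr_eq0 addrC -uD subrr u0.
have ule x : u x <= rnorm x by apply: le_trans (us x) (sublinear_shift_le1 v sn x).
exists u; split=> // [x|].
  by rewrite ler_norml ule andbT lerNl -uN -(rnormN x) ule.
apply/eqP; rewrite eq_le ule /= -lerN2 -uN.
exact: le_trans (us _) (sublinear_shiftN v sn).
Qed.

(** [3 ^- n / 2] is the tail of the geometric series. Ratio 1/3 makes the tail after a term half the
    weight of that term; with ratio 1/2 the two would be equal and the gliding hump would fail. *)
Lemma real_linear_bounded_limit (w : nat -> E -> R) :
  (forall n, real_linear (w n)) -> (forall n x, `|w n x| <= rnorm x) ->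
  exists u, [/\ real_linear u, forall x, `|u x| <= rnorm x &
    forall n x, `|u x - \sum_(i < n) w i x / 3 ^+ i.+1| <= 3 ^- n / 2 * rnorm x].
Proof.
move=> wl wb.
pose s n x := \sum_(i < n) w i x / 3 ^+ i.+1.
have p3 n : 0 < (3 : R) ^+ n by rewrite exprn_gt0.
have diff n k x : `|s (n + k)%N x - s n x| <= (3 ^- n - 3 ^- (n + k)) / 2 * rnorm x.
  elim: k => [|k IH]; first by rewrite addn0 !subrr normr0 mul0r mul0r.
  rewrite addnS {1}/s big_ord_recr /= -/(s _ _) addrAC.
  apply: le_trans (ler_normD _ _) _.
  have h : `|w (n + k)%N x / 3 ^+ (n + k).+1| <= 3 ^- (n + k).+1 * rnorm x.
    by rewrite normrM mulrC normfV [ `|3 ^+ _|]gtr0_norm // ler_pM2l ?invr_gt0.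
  apply: le_trans (lerD IH h) _.
  rewrite -mulrDl ler_wpM2r ?rnorm_ge0 //.
  have -> : (3 : R) ^- (n + k) = 3 * 3 ^- (n + k).+1.
    by rewrite exprS invfM mulrA mulfV ?mul1r.
  lra.
have diff' n m x : (n <= m)%N -> `|s m x - s n x| <= 3 ^- n / 2 * rnorm x.
  move=> nm; rewrite -(subnKC nm); apply: le_trans (diff _ _ _) _.
  rewrite ler_wpM2r ?rnorm_ge0 // ler_wpM2r // gerBl invr_ge0 ltW //.
have cs x : cvg (s ^~ x @ \oo).
  apply: (@cauchy_rnorm_cvg R RealScalars R^o) => [|e e0].
    exact: (@complete_cauchy_complete R RealScalars R^o).
  have x1 : 0 < rnorm x + 1 by rewrite ltr_wpDl ?rnorm_ge0.
  have e1 : 0 < e / (rnorm x + 1) by rewrite divr_gt0.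
  have [M HM] : exists M : nat, (3 : R) ^- M < e / (rnorm x + 1).
    have /cvgrPdist_lt/(_ _ e1)[M _ /(_ M (leqnn M))] := @cvg_expr R 3^-1 ltac:(by
      rewrite ger0_norm ?invr_ge0 // invf_lt1 // ltr1n).
    by rewrite /= sub0r normrN ger0_norm ?exprn_ge0 ?invr_ge0 // exprVn => h; exists M.
  exists [set n | (M <= n)%N]; first by exists M.
  move=> i j Mi Mj; change (`|s i x - s j x| < e).
  rewrite -(subrKA (s M x)); apply: le_lt_trans (ler_normD _ _) _.
  rewrite [X in _ + X]distrC.
  apply: le_lt_trans (lerD (diff' _ _ x Mi) (diff' _ _ x Mj)) _.
  rewrite -mulrDl -splitr; move: HM; rewrite ltr_pdivlMr //; apply: le_lt_trans.
  by rewrite ler_pM2l ?invr_gt0 // lerDl.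
have sD n x y : s n (x + y) = s n x + s n y.
  by rewrite /s -big_split /=; apply: eq_bigr => i _; rewrite (wl i).1 mulrDl.
have sZ n t x : s n (real_scalar F t *: x) = t * s n x.
  by rewrite /s mulr_sumr; apply: eq_bigr => i _; rewrite (wl i).2 mulrA.
pose u x := lim (s ^~ x @ \oo).
have su x : s ^~ x @ \oo --> u x by exact: cs.
have us n x : `|u x - s n x| <= 3 ^- n / 2 * rnorm x.
  have h : (fun m => `|s m x - s n x|) @ \oo --> `|u x - s n x|.
    by apply: cvg_norm; apply: cvgB; [exact: su|exact: cvg_cst].
  apply: (cvgr_to_le h); exists n => // m; exact: diff'.
exists u; split=> //.
  split=> [x y|t x].
    apply: (cvg_unique _ (su (x + y))) => //.
    rewrite (_ : s ^~ (x + y) = fun n => s n x + s n y); last exact/funext.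
    exact: cvgD.
  apply: (cvg_unique _ (su (real_scalar F t *: x))) => //.
  rewrite (_ : s ^~ (real_scalar F t *: x) = fun n => t * s n x); last exact/funext.
  by apply: cvgM; [exact: cvg_cst|exact: su].
move=> x; have := us 0%N x; rewrite /s big_ord0 subr0 expr0 invr1 => h.
by apply: le_trans h _; rewrite ler_piMl ?rnorm_ge0 //; lra.
Qed.

(* Gliding hump: with w_n norming v_n, the signs c_n in u = sum_n c_n w_n / 3^(n+1)
   are chosen so that |s_(n+1)(v_n)| >= |v_n| / 3^(n+1) for the partial sums s_n;
   the tail is at most half of that. *)
Lemma weakly_bounded_real (A : set E) :
  (forall u, real_linear u -> (forall x, `|u x| <= rnorm x) ->
    exists M, forall v, A v -> `|u v| <= M) ->
  exists M, forall v, A v -> rnorm v <= M.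
Proof.
move=> Hu; apply: contrapT => /forallNP nA.
have p3 n : 0 < (3 : R) ^+ n by rewrite exprn_gt0.
(* The tail may cancel half of [rnorm (v n) / 3 ^+ n.+1]; the factor 2 leaves more than [n]. *)
have /choice[v Hv] : forall n : nat, exists v, A v /\ 2 * n%:R * 3 ^+ n.+1 < rnorm v.
  move=> n; apply: contrapT => /forallNP H; apply: (nA (2 * n%:R * 3 ^+ n.+1)) => v Av.
  by rewrite leNgt; apply/negP => h; apply: (H v).
have /choice[w Hw] : forall n : nat, exists u,
    [/\ real_linear u, forall x, `|u x| <= rnorm x & u (v n) = rnorm (v n)].
  by move=> n; exact: norming_functional.
pose sg (n : nat) (t : R) : R := if 0 <= t then 1 else -1.
pose fix s n : E -> R := if n is n'.+1
  then fun x => s n' x + sg n' (s n' (v n')) * w n' x / 3 ^+ n'.+1 else fun=> 0.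
pose c n := sg n (s n (v n)).
have c1 n : `|c n| = 1 by rewrite /c /sg; case: ifP; rewrite ?normrN1 ?normr1.
pose w' n x := c n * w n x.
have sE n x : s n x = \sum_(i < n) w' i x / 3 ^+ i.+1.
  by elim: n => [|n IH]; rewrite ?big_ord0 // big_ord_recr /= -IH.
have [||u [ul ub us]] := @real_linear_bounded_limit w'.
- move=> n; have [[wD wZ] _ _] := Hw n.
  by split=> [x y|t x]; rewrite /w' ?wD ?mulrDr // wZ mulrCA.
- by move=> n x; rewrite /w' normrM c1 mul1r; case: (Hw n).
have [M HM] := Hu u ul ub.
pose n := Num.truncn `|M|; have Mn : M < n.+1%:R.
  by apply: le_lt_trans (truncnS_gt _); exact: ler_norm.
have [Av vn] := Hv n.+1.
have big : 3 ^- n.+2 * rnorm (v n.+1) <= `|s n.+2 (v n.+1)|.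
  have [_ _ wv] := Hw n.+1.
  rewrite /= -/(s n.+1 _) -/(s _ _) wv /sg; set a := (X in if 0 <= X then _ else _).
  rewrite [X in X <= _]mulrC; case: ifPn => a0.
    by rewrite mul1r; apply: le_trans (ler_norm _); rewrite lerDr.
  rewrite mulN1r mulNr -normrN opprD opprK.
  by apply: le_trans (ler_norm _); rewrite lerDr oppr_ge0 ltW // ltNge.
have := us n.+2 (v n.+1); rewrite -sE => h.
have := HM _ Av; apply/negP; rewrite -ltNge; apply: lt_le_trans Mn _.
have : 2 * n.+1%:R < 3 ^- n.+2 * rnorm (v n.+1) by rewrite ltr_pdivlMl // mulrC.
move: big h; set X1 := _ * rnorm _; rewrite mulrAC -/X1 => big.
have : `|s n.+2 (v n.+1)| <= `|u (v n.+1)| + `|u (v n.+1) - s n.+2 (v n.+1)|.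
  rewrite -[X in `|X| <= _](subKr (u (v n.+1))); apply: le_trans (ler_normB _ _) _; exact: lexx.
lra.
Qed.

End WeakBoundedness.

Lemma linear_functional (K : numFieldType) (E : lmodType K) (f : E -> K^o) :
  linear f -> exists e : {linear E -> K^o}, forall x, e x = f x.
Proof.
move=> lf; pose g : {linear E -> K^o} := HB.pack f (GRing.isLinear.Build K E K^o _ f lf).
by exists g.
Qed.

Section Functionals.
Variables (R : realType) (F : RorC).
Local Notation K := (scalar_field R F).

Lemma continuous_functional_bounded (E : normedModType K) (e : {linear E -> K^o}) :
  continuous e -> exists C, forall x, rabs (e x) <= C * rnorm x.
Proof.
move=> ce; have se : is_seminorm (fun x => rabs (e x)).
  split=> [x|x y|a x]; first exact: rabs_ge0.
    by rewrite linearD; exact: (ler_rnormD (e x : K^o)).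
  by rewrite linearZ /= rabsM.
have /nbhs_rnormP[d d0 Hd] : nbhs (0 : E) (e @^-1` [set v : K^o | rnorm ((0 : K^o) - v) < 1]).
  by apply: ce; rewrite linear0; apply/nbhs_rnormP; exists 1.
exists d^-1; apply: seminorm_bound => //; first exact: rnorm_seminorm.
move=> x xd; have := Hd x; rewrite /= !sub0r !rnormN rabs_regular; apply.
exact: xd.
Qed.

Lemma bounded_functional_continuous (E : normedModType K) (e : {linear E -> K^o}) C :
  (forall x, rabs (e x) <= C * rnorm x) -> continuous e.
Proof.
move=> eC x; apply/(@cvg_rnormP R F K^o) => d d0.
have C0 : 0 < `|C| + 1 by rewrite ltr_wpDl.
have /nbhs_rnormP : exists2 r : R, 0 < r & [set v | rnorm (x - v) < r] `<=`
    [set v | rnorm ((e x : K^o) - e v) < d]; last by [].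
exists (d / (`|C| + 1)); first exact: divr_gt0.
move=> v /=; rewrite -linearB ltr_pdivlMr // mulrC; apply: le_lt_trans.
apply: le_trans (eC _) _; rewrite ler_wpM2r ?rnorm_ge0 //.
by rewrite (le_trans (ler_norm _)) // lerDl.
Qed.

Lemma ler_real_part (z : K) : `|real_part z| <= rabs z.
Proof.
rewrite /rabs; case: F z => //= -[a b].
by rewrite /= -sqrtr_sqr ler_wsqrtr // lerDl sqr_ge0.
Qed.

End Functionals.

Lemma ler_rabs_complex (R : realType) (a b : R) :
  @rabs R ComplexScalars (a +i* b)%C <= `|a| + `|b|.
Proof.
rewrite /rabs /=.
have ab : 0 <= `|a| + `|b| by rewrite addr_ge0.
rewrite -[leRHS]ger0_norm // -sqrtr_sqr ler_wsqrtr //.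
by rewrite -(real_normK (num_real a)) -(real_normK (num_real b)) sqrrD lerD2r lerDl
  mulrn_wge0 // mulr_ge0.
Qed.

(** Over the complex numbers the functional is u(x) - i u(i x); bounding its two parts separately
    gives the constant 2, enough for continuity. *)
Lemma real_functional_extension (R : realType) (F : RorC)
    (E : normedModType (scalar_field R F)) (u : E -> R) :
  real_linear u -> (forall x, `|u x| <= rnorm x) ->
  exists e : {linear E -> (scalar_field R F)^o},
    continuous e /\ forall x, real_part (e x) = u x.
Proof.
case: F E u => E u [uD uZ] ub.
  have [|e He] := @linear_functional R E u; first by move=> a x y; rewrite uD uZ.
  exists e; split; last exact: He.
  apply: (@bounded_functional_continuous R RealScalars E e 1) => x.
  by rewrite He mul1r; exact: ub.
pose f (x : E) : R[i]^o := (u x +i* - u ('i *: x))%C.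
have uN x : u (- x) = - u x.
  have := uZ (-1) x; rewrite mulN1r -[real_scalar _ _]/((-1)%:C)%C rmorphN1.
  by rewrite scaleN1r.
have [|e He] := @linear_functional R[i] E f.
  move=> [p q] x y.
  have decomp z : (p +i* q)%C *: z = p%:C%C *: z + q%:C%C *: ('i *: z).
    by rewrite scalerA -scalerDl; congr (_ *: _); simpc.
  have ii (z : E) : 'i *: ('i *: z) = - z.
    by rewrite scalerA -expr2 sqr_i scaleN1r.
  have H z : u ((p +i* q)%C *: z) = p * u z + q * u ('i *: z).
    by rewrite decomp uD (uZ p z) (uZ q).
  have Hi : u ('i *: ((p +i* q)%C *: x)) = p * u ('i *: x) - q * u x.
    by rewrite scalerA mulrC -scalerA H ii uN mulrN.
  rewrite /f scalerDr !uD H Hi.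
  rewrite -[(p +i* q)%C *: _]/((p +i* q)%C * (u x +i* - u ('i *: x))%C).
  simpc; congr (_ +i* _)%C; ring.
exists e; split=> [|x]; last by rewrite He.
apply: (@bounded_functional_continuous R ComplexScalars E e 2) => x.
rewrite He; apply: le_trans (ler_rabs_complex _ _) _.
have xi : rnorm ('i *: x) = rnorm x.
  rewrite (@rnormZ R ComplexScalars).
  by rewrite /rabs /= expr0n expr1n add0r sqrtr1 mul1r.
rewrite mulr_natl mulr2n normrN; apply: lerD => //.
by rewrite -[leRHS]xi.
Qed.

(** Reduces to the real case: each bounded real-linear functional is the real part of a continuous
    [K]-linear one. *)
Lemma weakly_bounded (R : realType) (F : RorC)
    (E : normedModType (scalar_field R F)) (A : set E) :
  (forall e : {linear E -> (scalar_field R F)^o}, continuous e ->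
    exists M, forall v, A v -> rabs (e v) <= M) ->
  exists M, forall v, A v -> rnorm v <= M.
Proof.
move=> He; apply: weakly_bounded_real => u ul ub.
have [e [ce eu]] := real_functional_extension ul ub.
have [M HM] := He e ce; exists M => v Av; apply: le_trans (HM v Av).
rewrite -eu; exact: ler_real_part.
Qed.

Lemma scalar_cauchy_complete (R : realType) (F : RorC) :
  @cauchy_complete R F (scalar_field R F)^o.
Proof.
case: F; first exact: (@complete_cauchy_complete R RealScalars R^o).
move=> G PG H.
have part (pr : R[i] -> R) : (forall z w, `|pr z - pr w| <= complex.Re `|z - w|) ->
    exists l, forall e, 0 < e -> G [set z | `|l - pr z| < e].
  move=> prle.
  have : cvg (pr @ G).
    apply: (@cauchy_rnorm_cvg R RealScalars R^o) => [|e /H[A GA HA]].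
      exact: (@complete_cauchy_complete R RealScalars R^o).
    by exists A => // z w Az Aw; apply: le_lt_trans (prle z w) (HA z w Az Aw).
  move=> /cvgrPdist_lt Hl; exists (lim (pr @ G)); exact: Hl.
have [|a Ha] := part (@complex.Re R).
  by move=> [x y] [x' y'] /=; rewrite -sqrtr_sqr ler_wsqrtr // lerDl sqr_ge0.
have [|b Hb] := part (@complex.Im R).
  by move=> [x y] [x' y'] /=; rewrite -sqrtr_sqr ler_wsqrtr // lerDr sqr_ge0.
apply/cvg_ex; exists (a +i* b)%C.
apply/(@cvg_rnormP R ComplexScalars R[i]^o) => e e0.
have e2 : 0 < e / 2 by rewrite divr_gt0.
apply: filterS (filterI (Ha _ e2) (Hb _ e2)) => -[x y] [/= xa yb].
apply: le_lt_trans (ler_rabs_complex (a - x) (b - y)) _.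
by rewrite [e]splitr; exact: ltrD.
Qed.

(** * Mean value inequalities and iterated partial derivatives *)

Section RowVectorNorm.
Variables (R : realType) (d : nat).
Implicit Types x y : 'rV[R]_d.

Lemma ler_coord x j : `|x 0 j| <= `|x|.
Proof.
change (`|x 0 j| <= mx_norm x); rewrite mx_normrE.
exact: (le_bigmax _ (fun ij : 'I_1 * 'I_d => `|x ij.1 ij.2|) (0, j)).
Qed.

Lemma ltr_rV_norm x r : 0 < r -> (forall j, `|x 0 j| < r) -> `|x| < r.
Proof.
move=> r0 xr; change (mx_norm x < r); rewrite mx_normrE.
by apply/bigmax_ltP; split=> // -[i j] _ /=; rewrite ord1.
Qed.

Lemma rV_norm_delta j : `|delta_mx 0 j : 'rV[R]_d| = 1.
Proof.
apply/eqP; rewrite eq_le; apply/andP; split; last first.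
  by have := ler_coord (delta_mx 0 j) j; rewrite mxE !eqxx normr1.
apply/ler_addgt0Pr => e e0; apply/ltW/ltr_rV_norm; first by rewrite addr_gt0.
move=> i; rewrite mxE eqxx /=; case: eqP => _; rewrite ?normr1 ?normr0 ?ltrDl //.
by rewrite addr_gt0.
Qed.

Lemma edot_ge0 x : 0 <= edot x x.
Proof. by apply: sumr_ge0 => j _; rewrite -expr2 sqr_ge0. Qed.

Lemma ler_norm_enorm x : `|x| <= enorm x.
Proof.
apply/ler_addgt0Pr => e e0; apply/ltW/ltr_rV_norm.
  by rewrite ltr_wpDl // sqrtr_ge0.
move=> j; apply: (@le_lt_trans _ _ (enorm x)); last by rewrite ltrDl.
rewrite -sqrtr_sqr ler_wsqrtr // /edot (bigD1 j) //= -expr2 lerDl.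
by apply: sumr_ge0 => i _; rewrite -expr2 sqr_ge0.
Qed.

(** The crude factor [d.+1] in place of the square root of [d] is always positive and avoids a
    second root. *)
Lemma ler_enorm_norm x : enorm x <= d.+1%:R * `|x|.
Proof.
rewrite -[leRHS]ger0_norm ?mulr_ge0 // -sqrtr_sqr ler_wsqrtr //.
apply: (@le_trans _ _ (\sum_(j < d) `|x| ^+ 2)).
  apply: ler_sum => j _; rewrite -expr2 -real_normK ?num_real //.
  by rewrite lerXn2r ?nnegrE // ler_coord.
rewrite sumr_const card_ord exprMn -[leLHS]mulr_natl ler_wpM2r ?sqr_ge0 //.
by rewrite -natrX ler_nat (leq_trans (leqnSn d)) // -mulnn leq_pmulr.
Qed.

Lemma enorm_ge0 x : 0 <= enorm x.
Proof. exact: sqrtr_ge0. Qed.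

Lemma enorm_gt0 x : x != 0 -> 0 < enorm x.
Proof. by move=> x0; apply: lt_le_trans (ler_norm_enorm x); rewrite normr_gt0. Qed.

End RowVectorNorm.

Section OneDim.
Variables (R : realType) (F : RorC).
Local Notation K := (scalar_field R F).
Variable E : normedModType K.
Local Notation "t ** x" := (real_scalar F t *: x) (at level 40).
Implicit Types (phi : R -> E) (v : E).

(* Compare phi with the real function |phi b - phi t| + M (t - a), M > L, which
   increases strictly to the right of each of its points: its maximum over
   [a, b] is attained at b only. *)
Lemma local_lipschitz phi a b L : a <= b ->
  (forall t, a <= t <= b -> forall e, 0 < e -> exists2 del, 0 < del &
     forall s, a <= s <= b -> `|s - t| < del ->
       rnorm (phi s - phi t) <= (L + e) * `|s - t|) ->
  rnorm (phi b - phi a) <= L * (b - a).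
Proof.
move=> ab Hphi; rewrite le_eqVlt in ab; case/predU1P: ab => [->|ab].
  by rewrite !subrr rnorm0 mulr0.
have ba0 : 0 < b - a by rewrite subr_gt0.
apply/ler_addgt0Pr => e0 e0gt0.
pose e := e0 / (b - a); have egt0 : 0 < e by rewrite divr_gt0.
have -> : L * (b - a) + e0 = (L + e) * (b - a).
  by rewrite mulrDl /e divfK // gt_eqF.
pose M := L + e.
pose psi t := rnorm (phi b - phi t) + M * (t - a).
have [||c cab cmax] := @EVT_max R psi a b; first exact: ltW.
  apply/subspace_continuousP => t; rewrite /= in_itv /= => tab.
  apply/cvgrPdist_le => r r0.
  have [del del0 Hdel] := Hphi t tab 1 ltr01.
  pose C := `|L + 1| + `|M| + 1.
  have C0 : 0 < C by rewrite ltr_wpDl // addr_ge0.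
  have rC : 0 < Num.min del (r / C) by rewrite lt_min del0 divr_gt0.
  rewrite /within /=; apply/nbhs_ballP; exists (Num.min del (r / C)) => //= s.
  rewrite /ball /= distrC lt_min => /andP[sd sr]; rewrite in_itv /= => sab.
  rewrite distrC /psi.
  have -> : rnorm (phi b - phi s) + M * (s - a) - (rnorm (phi b - phi t) + M * (t - a))
    = (rnorm (phi b - phi s) - rnorm (phi b - phi t)) + M * (s - t) by ring.
  apply: le_trans (ler_normD _ _) _.
  apply: (@le_trans _ _ (C * `|s - t|)); last first.
    by rewrite -ler_pdivlMl // mulrC ltW.
  have h1 : `|rnorm (phi b - phi s) - rnorm (phi b - phi t)| <= `|L + 1| * `|s - t|.
    apply: le_trans (ler_dist_rnorm _ _) _.
    rewrite opprB addrC subrKA rnorm_distC.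
    by apply: le_trans (Hdel _ sab sd) _; rewrite ler_wpM2r // ler_norm.
  have := normrM M (s - t); have := normr_ge0 (s - t); rewrite /C; lra.
move: cab; rewrite in_itv /= => cab; have /andP[ac cb] := cab.
have psib : psi a <= psi b.
  apply: (@le_trans _ _ (psi c)); first by apply: cmax; rewrite in_itv /= lexx ltW.
  rewrite le_eqVlt in cb; case/predU1P: cb => [->//|cb]; exfalso.
  have e2 : 0 < e / 2 by rewrite divr_gt0.
  have [del del0 Hdel] := Hphi c cab _ e2.
  (* From [c] to [c + h] the function [phi] moves by at most [(L + e / 2) * h] in norm, while the
     linear term of [psi] gains [(L + e) * h]; so [psi] exceeds its maximum. *)
  pose h := Num.min (del / 2) (b - c).
  have h0 : 0 < h by rewrite lt_min divr_gt0 //= subr_gt0.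
  have hd : h < del.
    by apply: (@le_lt_trans _ _ (del / 2)); rewrite ?ge_min ?lexx // ltr_pdivrMr //
      mulr_natr mulr2n ltrDl.
  have chb : c + h <= b by rewrite -lerBrDl ge_min lexx orbT.
  have cab' : a <= c + h <= b by rewrite chb andbT (le_trans ac) // lerDl ltW.
  have hn : `|c + h - c| = h by rewrite addrC addKr gtr0_norm.
  have := Hdel _ cab'; rewrite hn => /(_ hd) Hh.
  have : psi (c + h) <= psi c by apply: cmax; rewrite in_itv.
  apply/negP; rewrite -ltNge /psi.
  have := ler_rnorm_distD (phi (c + h)) (phi b) (phi c).
  have : 0 < e / 2 * h by rewrite mulr_gt0.
  have -> : M * (c + h - a) = M * (c - a) + (L + e / 2) * h + e / 2 * h.
    by rewrite /M; field.
  lra.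
by move: psib; rewrite /psi !subrr rnorm0 mulr0 addr0 add0r.
Qed.

(** The derivative of a curve in division-free form: the trivial point [s = t] is included, and the
    mean value argument uses the inequality directly. *)
Definition has_der phi (t : R) v := forall e, 0 < e -> exists2 del, 0 < del &
  forall s, `|s - t| < del -> rnorm (phi s - phi t - (s - t) ** v) <= e * `|s - t|.

Lemma has_derB phi psi t v w : has_der phi t v -> has_der psi t w ->
  has_der (fun s => phi s - psi s) t (v - w).
Proof.
move=> Hv Hw e e0; have e2 : 0 < e / 2 by rewrite divr_gt0.
have [a a0 Ha] := Hv _ e2; have [b b0 Hb] := Hw _ e2.
exists (Num.min a b); first by rewrite lt_min a0.
move=> s; rewrite lt_min => /andP[sa sb].
have -> : phi s - psi s - (phi t - psi t) - (s - t) ** (v - w) =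
    (phi s - phi t - (s - t) ** v) - (psi s - psi t - (s - t) ** w).
  have sub4 (p q r u : E) : p - q - (r - u) = p - r - (q - u).
    by rewrite !opprD addrACA.
  by rewrite scalerBr (sub4 (phi s)) (sub4 (phi s - phi t)).
apply: le_trans (ler_rnormB _ _) _; rewrite [e]splitr mulrDl.
by apply: lerD; [exact: Ha|exact: Hb].
Qed.

Lemma has_der_linear (c : R) t v : has_der (fun s => (s * c) ** v) t (c ** v).
Proof.
move=> e e0; exists 1 => // s _.
rewrite -scalerBl -real_scalarB scalerA -real_scalarM -mulrBl subrr rnorm0.
by rewrite mulr_ge0 // ltW.
Qed.

Lemma mean_value phi dphi a b L : a <= b ->
  (forall t, a <= t <= b -> has_der phi t (dphi t)) ->
  (forall t, a <= t <= b -> rnorm (dphi t) <= L) ->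
  rnorm (phi b - phi a) <= L * (b - a).
Proof.
move=> ab Hd HL; apply: local_lipschitz => // t tab e e0.
have [del del0 Hdel] := Hd t tab e e0; exists del => // s _ /Hdel h.
apply: le_trans (rnorm_ge_dist _ ((s - t) ** dphi t)) _.
rewrite rnormZr addrC mulrDl; apply: lerD => //.
by rewrite mulrC ler_wpM2r // HL.
Qed.

End OneDim.

Section PartialDerivatives.
Variables (R : realType) (F : RorC) (d : nat).
Local Notation K := (scalar_field R F).
Variables (Omega : set 'rV[R]_d) (E : normedModType K).
Hypothesis Omega_open : open Omega.
Local Notation "t ** x" := (real_scalar F t *: x) (at level 40).
Local Notation unit j := (delta_mx 0 j : 'rV[R]_d).
Implicit Types (f g : Omega -> E) (x y : 'rV[R]_d).

Definition zero_extension f : 'rV[R]_d -> E := 'valL_0 f.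

Lemma zero_extensionE f (x : Omega) : zero_extension f (val x) = f x.
Proof. by rewrite /zero_extension /valL_ /= oinv_set_val valK. Qed.

Lemma in_domain x : Omega x -> exists z : Omega, val z = x.
Proof. by move=> Ox; exists (exist _ x (mem_set Ox)). Qed.

Lemma domainP (x : Omega) : Omega (val x).
Proof. exact/set_mem/valP. Qed.

Lemma domain_ball x : Omega x -> exists2 r : R, 0 < r & forall y, `|y - x| < r -> Omega y.
Proof.
move=> Ox; have /nbhs_ballP[r /= r0 rO] := open_nbhs_nbhs (conj Omega_open Ox).
by exists r => // y yx; apply: rO; rewrite -ball_normE /= distrC.
Qed.

Lemma continuous_domainP f : continuous f <-> forall (x : Omega) (e : R), 0 < e ->
  exists2 r : R, 0 < r & forall y : Omega, `|val y - val x| < r -> rnorm (f x - f y) < e.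
Proof.
split=> [cf x e e0|H x].
  have fx : nbhs (f x) [set v | rnorm (f x - v) < e] by apply/nbhs_rnormP; exists e.
  have := cf x _ fx; move=> [_ /= [[W oW <-] /= Wx WV]].
  have /nbhs_ballP[r /= r0 rW] := open_nbhs_nbhs (conj oW Wx).
  by exists r => // y yx; apply: WV; apply: rW; rewrite -ball_normE /= distrC.
apply/(cvg_rnormP (nbhs_filter x)) => e /(H x)[r r0 Hr].
have h : nbhs x (set_val @^-1` ball (val x) r).
  by apply: (@initial_continuous Omega _ set_val x); exact: nbhsx_ballx.
by apply: (filterS _ h) => y; rewrite /= -ball_normE /= distrC; exact: Hr.
Qed.

Definition differentiable_along j f := forall x : Omega, cvg (diff_quotient j f x @ 0^').

Lemma diff_quotient_dist j f (x : Omega) v s : s != 0 ->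
  rnorm (v - diff_quotient j f x s) * `|s| =
  rnorm (zero_extension f (val x + s *: unit j) - f x - s ** v).
Proof.
move=> s0; rewrite mulrC -rnormZr scalerBr /diff_quotient scalerA.
rewrite -real_scalarM mulfV // real_scalar1 scale1r rnorm_distC.
by rewrite -/(zero_extension f).
Qed.

Lemma diff_quotient_cvgP j f (x : Omega) v : diff_quotient j f x @ 0^' --> v <->
  has_der (fun t => zero_extension f (val x + t *: unit j)) 0 v.
Proof.
split.
  move=> /cvg_rnormP H e e0; have /nbhs_ballP[r /= r0 Hr] := H e e0.
  exists r => // s; rewrite !subr0 scale0r addr0 zero_extensionE => sr.
  have [->|s0] := eqVneq s 0.
    by rewrite scale0r addr0 zero_extensionE subrr real_scalar0 scale0r subr0 rnorm0 normr0 mulr0.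
  rewrite -diff_quotient_dist // ler_wpM2r //; apply/ltW/Hr => //.
  by rewrite /ball /= sub0r normrN.
move=> H; apply/cvg_rnormP => e e0; have e2 : 0 < e / 2 by rewrite divr_gt0.
have [r r0 Hr] := H _ e2.
apply/nbhs_ballP; exists r => //= s; rewrite /ball /= sub0r normrN => sr s0.
have := Hr s; rewrite !subr0 scale0r addr0 zero_extensionE => /(_ sr).
rewrite -diff_quotient_dist // ler_pM2r ?normr_gt0 // => h; apply: le_lt_trans h _.
by rewrite ltr_pdivrMr // mulr_natr mulr2n ltrDl.
Qed.

Lemma partialP j f (x : Omega) v : diff_quotient j f x @ 0^' --> v -> partial j f x = v.
Proof. by move=> H; apply/cvg_lim. Qed.

Lemma has_der_line j f x (h t : R) : differentiable_along j f ->
  Omega (x + (t * h) *: unit j) ->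
  has_der (fun s => zero_extension f (x + (s * h) *: unit j)) t
    (h ** zero_extension (partial j f) (x + (t * h) *: unit j)).
Proof.
move=> df /in_domain[z zE] e e0.
(* The summand 1 covers [h = 0], where the line is constant. *)
have h1 : 0 < `|h| + 1 by rewrite ltr_wpDl.
have [r r0 Hr] := (diff_quotient_cvgP j f z _).1 (df z) _ (divr_gt0 e0 h1).
exists (r / (`|h| + 1)); first by rewrite divr_gt0.
move=> s; rewrite ltr_pdivlMr // => sr.
have sh : `|(s - t) * h| <= `|s - t| * (`|h| + 1).
  by rewrite normrM ler_wpM2l // lerDl.
have := Hr ((s - t) * h); rewrite !subr0 => /(_ (le_lt_trans sh sr)).
have -> : val z + ((s - t) * h) *: unit j = x + (s * h) *: unit j.
  by rewrite zE -addrA -scalerDl; congr (_ + _ *: _); ring.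
rewrite scale0r addr0 -zE !zero_extensionE scalerA -real_scalarM.
move=> H; apply: le_trans H _.
rewrite mulrAC ler_pdivrMr // -mulrA ler_wpM2l //; exact: ltW.
Qed.

(** The free vector [v] serves two purposes: [v = 0] gives Lipschitz estimates, a value of the
    derivative gives differentiability estimates. *)
Lemma partial_mean_value j f x (h M : R) v : differentiable_along j f ->
  (forall s, 0 <= s <= 1 -> Omega (x + (s * h) *: unit j)) ->
  (forall s, 0 <= s <= 1 ->
    rnorm (zero_extension (partial j f) (x + (s * h) *: unit j) - v) <= M) ->
  rnorm (zero_extension f (x + h *: unit j) - zero_extension f x - h ** v) <= M * `|h|.
Proof.
move=> df seg HM.
pose phi s := zero_extension f (x + (s * h) *: unit j) - (s * h) ** v.
have := @mean_value R F E phi (fun s =>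
  h ** zero_extension (partial j f) (x + (s * h) *: unit j) - h ** v) 0 1 (M * `|h|) ler01.
rewrite /phi !mul1r !mul0r real_scalar0 !scale0r addr0 !subr0 mulr1 addrAC; apply.
  move=> t t01; apply: has_derB; last exact: has_der_linear.
  by apply: has_der_line => //; exact: seg.
by move=> t t01; rewrite -scalerBr rnormZr mulrC ler_wpM2r // HM.
Qed.

(** The mean value inequality is applied to an approximant chosen after the increment [s]. Its error
    [m] enters once in the slope, absorbed by [e / 2], and at the two endpoints, absorbed by the
    slack [k]. *)
Lemma partial_limit j f g : continuous g ->
  (forall e : R, 0 < e -> exists2 f', differentiable_along j f' &
    forall z, rnorm (f' z - f z) <= e /\ rnorm (partial j f' z - g z) <= e) ->
  forall x : Omega, diff_quotient j f x @ 0^' --> g x.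
Proof.
move=> /continuous_domainP cg H x; apply/diff_quotient_cvgP => e e0.
have e2 : 0 < e / 2 by rewrite divr_gt0.
have [r r0 Hr] := cg x _ e2.
have [r' r'0 Hr'] := domain_ball (domainP x).
exists (Num.min r r'); first by rewrite lt_min r0.
move=> s; rewrite !subr0 scale0r addr0 zero_extensionE lt_min => /andP[sr sr'].
have seg t : 0 <= t <= 1 -> `|val x + (t * s) *: unit j - val x| <= `|s|.
  move=> /andP[t0 t1]; rewrite addrC addKr normrZ rV_norm_delta mulr1 normrM.
  by rewrite ger0_norm // ler_piMl.
apply/ler_addgt0Pr => k k0.
pose m := Num.min (e / 2) (k / 2).
have m0 : 0 < m by rewrite lt_min e2 divr_gt0.
have [f' df' Hf'] := H m m0.
have Oseg t : 0 <= t <= 1 -> Omega (val x + (t * s) *: unit j).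
  by move=> t01; apply: Hr'; apply: le_lt_trans (seg t t01) sr'.
have bound t : 0 <= t <= 1 ->
    rnorm (zero_extension (partial j f') (val x + (t * s) *: unit j) - g x) <= e / 2 + m.
  move=> t01; have [z zE] := in_domain (Oseg t t01); rewrite -zE zero_extensionE.
  apply: le_trans (ler_rnorm_distD (g z) _ _) _; rewrite addrC; apply: lerD.
    by rewrite rnorm_distC; apply/ltW/Hr; rewrite zE; apply: le_lt_trans (seg t t01) sr.
  by case: (Hf' z).
have := partial_mean_value df' Oseg bound.
have := Oseg 1; rewrite mul1r lexx ler01 => /(_ isT)/in_domain[y yE].
rewrite -yE !zero_extensionE => h.
have -> : f y - f x - s ** g x = (f' y - f' x - s ** g x) - ((f' y - f y) - (f' x - f x)).
  have sub4 (p q v u : E) : p - q - (v - u) = p - v - (q - u).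
    by rewrite !opprD addrACA.
  by rewrite (sub4 (f' y)) [RHS]sub4 subrr sub0r opprB.
apply: le_trans (ler_rnormB _ _) _.
have hs : (e / 2 + m) * `|s| <= e * `|s|.
  rewrite ler_wpM2r // [leRHS](splitr e) lerD2l /m ge_min lexx //.
apply: (@le_trans _ _ (e * `|s| + (m + m))).
  apply: lerD; first exact: le_trans h hs.
  by apply: le_trans (ler_rnormB _ _) _; apply: lerD; [case: (Hf' y)|case: (Hf' x)].
by rewrite lerD2l [leRHS](splitr k) lerD // /m ge_min lexx orbT.
Qed.

End PartialDerivatives.

Section IteratedPartials.
Variables (R : realType) (F : RorC) (d : nat).
Local Notation K := (scalar_field R F).
Variables (Omega : set 'rV[R]_d) (E : normedModType K).
Hypothesis Omega_open : open Omega.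
Local Notation "t ** x" := (real_scalar F t *: x) (at level 40).
Local Notation unit j := (delta_mx 0 j : 'rV[R]_d).
Implicit Types (f g : Omega -> E) (w : seq 'I_d).

(** Words, whose last letter is applied first, can be extended one derivative at a time, which
    multi-indices in their fixed order do not allow; [wpartial_perm] links the two on C^k
    functions. *)
Definition wpartial w f : Omega -> E := foldr (fun j g => partial j g) f w.

Definition mi_word (b : multi_index d) : seq 'I_d :=
  flatten [seq nseq (b j) j | j <- enum 'I_d].

Lemma mpartial_word b f : mpartial b f = wpartial (mi_word b) f.
Proof.
rewrite /mpartial /mi_word; elim: (enum _) => //= j s ->.
rewrite /wpartial foldr_cat; elim: (b j) => //= n ->.
by [].
Qed.

Lemma size_mi_word b : size (mi_word b) = mi_order b.
Proof.
rewrite /mi_word size_flatten /shape -map_comp sumnE big_map /mi_order.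
by rewrite big_enum; apply: eq_bigr => j _; rewrite /= size_nseq.
Qed.

Lemma word_mi w : exists2 b, mi_order b = size w & perm_eq w (mi_word b).
Proof.
pose b : multi_index d := [ffun j => count_mem j w].
have pw : perm_eq w (mi_word b).
  apply/allP => i _ /=; apply/eqP; rewrite /mi_word count_flatten -map_comp.
  rewrite sumnE big_map big_enum (bigD1 i) //= big1 => [|j ji].
    by rewrite /= count_nseq /= eqxx mul1n addn0 ffunE.
  by rewrite /= count_nseq /= (negbTE ji).
by exists b => //; rewrite -size_mi_word (perm_size pw).
Qed.

Lemma is_Ck_continuous k f : is_Ck k f -> continuous f.
Proof. by case: k => [|k] []. Qed.

Lemma is_CkS k f : is_Ck k.+1 f -> is_Ck k f.
Proof.
elim: k f => [|k IH] f [cf df]; split=> // j.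
by have [dj Cj] := df j; split=> //; exact: IH.
Qed.

Lemma is_CkW k m f : (m <= k)%N -> is_Ck k f -> is_Ck m f.
Proof.
elim: k => [|k IH]; first by rewrite leqn0 => /eqP->.
by rewrite leq_eqVlt => /predU1P[->//|mk /is_CkS]; exact: IH.
Qed.

Lemma is_Ck_wpartial k w f : (size w <= k)%N -> is_Ck k f ->
  is_Ck (k - size w) (wpartial w f).
Proof.
elim: w => [|j w IH]; first by rewrite subn0.
move=> wk Ckf; have := IH (ltnW wk) Ckf.
by rewrite -(subnSK wk) => -[_ /(_ j)[]].
Qed.

Lemma is_Ck_differentiable k f j : is_Ck k.+1 f -> differentiable_along j f.
Proof. by move=> [_ /(_ j)[]]. Qed.

Lemma is_Ck_partial k f j : is_Ck k.+1 f -> is_Ck k (partial j f).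
Proof. by move=> [_ /(_ j)[]]. Qed.

(* The second difference is symmetric in i and j, the derivative is not. *)
Lemma mixed_difference i j f (x : Omega) (e : R) : is_Ck 2 f -> 0 < e ->
  exists2 r : R, 0 < r & forall h, 0 < h < r ->
    rnorm (zero_extension f (val x + h *: unit j + h *: unit i)
      - zero_extension f (val x + h *: unit i)
      - (zero_extension f (val x + h *: unit j) - zero_extension f (val x))
      - (h * h) ** partial j (partial i f) x) <= e * (h * h).
Proof.
move=> Cf e0; set v := partial j _ x.
have Ci := is_Ck_partial i Cf.
have [r r0 Hr] := (continuous_domainP _).1 (is_Ck_continuous (is_Ck_partial j Ci)) x e e0.
have [r' r'0 Hr'] := domain_ball Omega_open (domainP x).
exists (Num.min r r' / 2); first by rewrite divr_gt0 // lt_min r0.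
move=> h /andP[h0]; rewrite ltr_pdivlMr // lt_min => /andP[hr hr'].
have dist s t : 0 <= s <= 1 -> 0 <= t <= 1 ->
    `|val x + (s * h) *: unit i + (t * h) *: unit j - val x| <= h * 2.
  move=> /andP[s0 s1] /andP[t0 t1].
  rewrite addrC !addrA addNr add0r; apply: le_trans (ler_normD _ _) _.
  have nE (a : R) k : `|a *: unit k| = `|a| by rewrite normrZ rV_norm_delta mulr1.
  rewrite !nE !normrM (gtr0_norm h0) !ger0_norm //.
  by rewrite mulr_natr mulr2n; apply: lerD; rewrite ler_piMl // ltW.
have O s t : 0 <= s <= 1 -> 0 <= t <= 1 ->
    Omega (val x + (s * h) *: unit i + (t * h) *: unit j).
  by move=> s01 t01; apply: Hr'; apply: le_lt_trans (dist s t s01 t01) hr'.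
have i01 : 0 <= (1 : R) <= 1 by rewrite ler01 lexx.
have i00 : 0 <= (0 : R) <= 1 by rewrite ler01 lexx.
have O1 s : 0 <= s <= 1 -> Omega (val x + h *: unit j + (s * h) *: unit i).
  by move=> s01; have := O s 1 s01 i01; rewrite mul1r addrAC.
have O0 s : 0 <= s <= 1 -> Omega (val x + (s * h) *: unit i).
  by move=> s01; have := O s 0 s01 i00; rewrite mul0r scale0r addr0.
pose G := zero_extension (partial i f).
(* [phi 1 - phi 0] is the second difference minus its expected value. The derivative of [phi]
   contains a first difference of [partial i f] along [j], to which a second mean value inequality
   applies. *)
pose phi s := zero_extension f (val x + h *: unit j + (s * h) *: unit i)
   - zero_extension f (val x + (s * h) *: unit i) - (s * (h * h)) ** v.
pose dphi s := h ** G (val x + h *: unit j + (s * h) *: unit i)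
   - h ** G (val x + (s * h) *: unit i) - (h * h) ** v.
have dif : differentiable_along i f := is_Ck_differentiable Cf.
have := @mean_value R F E phi dphi 0 1 (e * (h * h)) ler01.
rewrite /phi !mul1r !mul0r real_scalar0 !scale0r !addr0 !subr0 mulr1 addrAC; apply.
  move=> t t01; apply: has_derB; last exact: has_der_linear.
  by apply: has_derB; apply: has_der_line => //; [exact: O1|exact: O0].
move=> s s01; rewrite /dphi.
have -> : (h * h) ** v = h ** (h ** v) by rewrite real_scalarM scalerA.
rewrite -!scalerBr rnormZr gtr0_norm //.
rewrite mulrCA ler_pM2l // -[in leRHS](gtr0_norm h0).
rewrite [val x + h *: unit j + _]addrAC /G.
have dj : differentiable_along j (partial i f) := is_Ck_differentiable Ci.
apply: (partial_mean_value dj).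
  by move=> t t01; exact: O.
move=> t t01; have [z zE] := in_domain (O s t s01 t01); rewrite -zE zero_extensionE.
by rewrite rnorm_distC; apply/ltW/Hr; rewrite zE; apply: le_lt_trans (dist s t s01 t01) hr.
Qed.

Lemma schwarz i j f : is_Ck 2 f -> partial i (partial j f) = partial j (partial i f).
Proof.
move=> Cf; apply/funext => x; apply/eqP; rewrite -subr_eq0; apply/eqP/rnorm0_eq0.
apply/eqP; rewrite eq_le rnorm_ge0 andbT; apply/ler_addgt0Pr => e e0; rewrite add0r.
have e2 : 0 < e / 2 by rewrite divr_gt0.
have [r r0 Hr] := mixed_difference i j x Cf e2.
have [r' r'0 Hr'] := mixed_difference j i x Cf e2.
pose h := Num.min r r' / 2.
have m0 : 0 < Num.min r r' by rewrite lt_min r0.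
have h0 : 0 < h by rewrite divr_gt0.
have hm : h < Num.min r r' by rewrite ltr_pdivrMr // mulr_natr mulr2n ltrDl.
have := hm; rewrite lt_min => /andP[hr hr'].
have := Hr h; rewrite h0 hr => /(_ isT); set A := (X in rnorm (X - _)) => H1.
have := Hr' h; rewrite h0 hr' => /(_ isT); set B := (X in rnorm (X - _)) => H2.
have AB : A = B.
  rewrite /A /B [val x + h *: unit i + _]addrAC.
  by rewrite !opprD addrACA.
rewrite -AB in H2.
have hh : 0 < h * h by rewrite mulr_gt0.
rewrite -(ler_pM2r hh) -[X in _ * X <= _]gtr0_norm // mulrC -rnormZr scalerBr.
apply: le_trans (ler_rnorm_distD A _ _) _; rewrite [X in X + _]rnorm_distC.
have -> : e * (h * h) = e / 2 * (h * h) + e / 2 * (h * h) by rewrite -mulrDl -splitr.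
exact: lerD H2 H1.
Qed.

Lemma wpartial_perm k w w' f : is_Ck k f -> (size w <= k)%N -> perm_eq w w' ->
  wpartial w f = wpartial w' f.
Proof.
have comm1 i u g : is_Ck (size u).+1 g -> partial i (wpartial u g) = wpartial u (partial i g).
  elim: u => // j u IH Cg; rewrite -[LHS]/(partial i (partial j (wpartial u g))).
  rewrite -[RHS]/(partial j (wpartial u (partial i g))) -(IH (is_CkS Cg)).
  have := is_Ck_wpartial (w := u) _ Cg; rewrite -addn2 leq_addr => /(_ isT).
  by rewrite addKn => /schwarz ->.
have comm u u' g : is_Ck (size u + size u') g ->
    wpartial u (wpartial u' g) = wpartial u' (wpartial u g).
  elim: u => // i u IH Cg; rewrite -[LHS]/(partial i (wpartial u (wpartial u' g))).
  rewrite (IH (is_CkS Cg)) comm1 //.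
  have := is_Ck_wpartial (w := u) _ Cg; rewrite addSn -addnS leq_addr => /(_ isT).
  by rewrite addKn.
move=> Cf wk ww'.
(* Permutations are generated by exchanges of adjacent blocks; carrying the length along keeps the
   regularity budget. *)
pose P u := size u = size w /\ wpartial w f = wpartial u f.
suff : P w' by case.
apply: (catCA_perm_ind (P := P)) ww' _ => // s1 s2 s3 [sw fw].
split; first by rewrite -sw !size_cat addnCA.
rewrite fw /wpartial !foldr_cat -/(wpartial s3 f); apply: comm.
have s3k : (size s3 <= k)%N.
  by apply: leq_trans wk; rewrite -sw !size_cat addnA leq_addl.
apply: is_CkW (is_Ck_wpartial s3k Cf).
by rewrite leq_subRL // addnC -addnA -!size_cat sw.
Qed.

End IteratedPartials.

(** * Uniform limits of C^k functions and Lipschitz estimates on segments *)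

Section UniformLimits.
Variables (R : realType) (F : RorC) (d : nat).
Local Notation K := (scalar_field R F).
Variables (Omega : set 'rV[R]_d) (E : normedModType K).
Hypothesis Omega_open : open Omega.
Implicit Types (f : Omega -> E) (w : seq 'I_d).

Lemma uniform_limit_continuous f :
  (forall e : R, 0 < e -> exists2 f' : Omega -> E, continuous f' &
    forall z, rnorm (f' z - f z) <= e) -> continuous f.
Proof.
move=> H; apply/continuous_domainP => x e e0.
have e4 : 0 < e / 4 by rewrite divr_gt0.
have [f' /continuous_domainP cf' Hf'] := H _ e4.
have [r r0 Hr] := cf' x _ e4; exists r => // y /Hr xy.
apply: le_lt_trans (ler_rnorm_distD (f' x) _ _) _.
have := ler_rnorm_distD (f' y) (f' x) (f y).
have := Hf' x; have := Hf' y; rewrite (rnorm_distC (f x)); lra.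
Qed.

(** All limits are carried at once, indexed by words. The induction passes to the family of words
    ending in [j], the limits of the derivatives of [partial j f]. *)
Lemma Ck_limit k (g : seq 'I_d -> Omega -> E) :
  (forall e : R, 0 < e -> exists2 f, is_Ck k f &
    forall w, (size w <= k)%N -> forall z, rnorm (wpartial w f z - g w z) <= e) ->
  is_Ck k (g [::]) /\ forall w, (size w <= k)%N -> wpartial w (g [::]) = g w.
Proof.
elim: k g => [|k IH] g H.
  split; last by move=> w; rewrite leqn0 size_eq0 => /eqP->.
  split=> //; apply: uniform_limit_continuous => e /H[f [cf _] Hf].
  by exists f => // z; exact: (Hf [::]).
have cg w : (size w <= k.+1)%N -> continuous (g w).
  move=> wk; apply: uniform_limit_continuous => e /H[f Cf Hf].
  exists (wpartial w f); last by move=> z; exact: Hf.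
  exact: is_Ck_continuous (is_Ck_wpartial wk Cf).
have dg j x : diff_quotient j (g [::]) x @ 0^' --> g [:: j] x.
  apply: partial_limit => //; first exact: cg.
  move=> e /H[f Cf Hf]; exists f; first exact: is_Ck_differentiable Cf.
  by move=> z; split; [exact: (Hf [::])|exact: (Hf [:: j])].
have pg j : partial j (g [::]) = g [:: j].
  by apply/funext => x; exact: partialP.
have IHj j : is_Ck k (g [:: j]) /\
    forall w, (size w <= k)%N -> wpartial w (g [:: j]) = g (rcons w j).
  apply: (IH (fun w => g (rcons w j))) => e /H[f Cf Hf].
  exists (partial j f); first exact: is_Ck_partial.
  by move=> w wk z; have := Hf (rcons w j); rewrite size_rcons /wpartial foldr_rcons; exact.
split.
  split; first exact: cg.
  by move=> j; split=> [x|]; [apply/cvg_ex; eexists; exact: dg|rewrite pg; case: (IHj j)].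
case/lastP => [//|w j]; rewrite size_rcons => wk.
by rewrite /wpartial foldr_rcons pg; case: (IHj j) => _; exact.
Qed.

Lemma in_cube (c x : 'rV[R]_d) r : 0 < r ->
  (forall j, `|x 0 j - c 0 j| < r) -> `|x - c| < r.
Proof. by move=> r0 H; apply: ltr_rV_norm => // j; rewrite !mxE; exact: H. Qed.

Lemma convex_gt0 (a b s : R) : 0 < a -> 0 < b -> 0 <= s <= 1 -> 0 < (1 - s) * a + s * b.
Proof.
move=> a0 b0 /andP[]; rewrite le_eqVlt => /predU1P[<- _|s0 s1].
  by rewrite subr0 mul1r mul0r addr0.
by rewrite ltr_wpDl ?mulr_gt0 // mulr_ge0 ?subr_ge0 // ltW.
Qed.

(** Coordinates are changed one at a time along the points [z i]. Balls of the maximum norm are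
    cubes, so the whole staircase stays inside. *)
Lemma cube_lipschitz f (c x y : 'rV[R]_d) r M :
  (forall z, `|z - c| < r -> Omega z) ->
  (forall j, differentiable_along j f) ->
  (forall j z, rnorm (partial j f z) <= M) ->
  `|x - c| < r -> `|y - c| < r ->
  rnorm (zero_extension f y - zero_extension f x) <= d%:R * (M * `|y - x|).
Proof.
move=> cO df HM xc yc.
have r0 : 0 < r by apply: le_lt_trans xc.
pose z i : 'rV[R]_d := \row_j (if (j < i)%N then y 0 j else x 0 j).
have z0 : z 0%N = x by apply/rowP => j; rewrite mxE.
have zd : z d = y by apply/rowP => j; rewrite mxE ltn_ord.
have coord i j : `|(x - c) 0 j| < r /\ `|(y - c) 0 j| < r /\ `|z i 0 j - c 0 j| < r.
  have hx := le_lt_trans (ler_coord (x - c) j) xc.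
  have hy := le_lt_trans (ler_coord (y - c) j) yc.
  by split=> //; split=> //; rewrite mxE; move: hx hy; rewrite !mxE; case: ifP.
have key i : (i <= d)%N ->
    rnorm (zero_extension f (z i) - zero_extension f x) <= i%:R * (M * `|y - x|).
  elim: i => [_|i IH id]; first by rewrite z0 subrr rnorm0 mul0r.
  apply: le_trans (ler_rnorm_distD (zero_extension f (z i)) _ _) _.
  rewrite -natr1 mulrDl mul1r addrC; apply: lerD; first exact: IH (ltnW id).
  pose j := Ordinal id; pose h := y 0 j - x 0 j.
  have zS : z i.+1 = z i + h *: delta_mx 0 j.
    apply/rowP => l; rewrite !mxE eqxx /= ltnS leq_eqVlt.
    have [->|lj] := eqVneq l j; first by rewrite eqxx ltnn mulr1 /h addrC subrK.
    by rewrite (_ : (l == i :> nat) = false) ?mulr0 ?addr0 //; apply/negbTE.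
  have seg s : 0 <= s <= 1 -> Omega (z i + (s * h) *: delta_mx 0 j).
    move=> s01; apply: cO; apply: in_cube => // l.
    have [hx [hy hz]] := coord i l.
    have -> : (z i + (s * h) *: delta_mx 0 j) 0 l = z i 0 l + (s * h) * (l == j)%:R.
      by rewrite !mxE eqxx.
    have [lj|lj] := eqVneq l j; last by rewrite mulr0 addr0.
    move: hx hy; rewrite lj !mxE ltnn !ltr_norml /h => /andP[x1 x2] /andP[y1 y2].
    have A1 : 0 < r + (x 0 j - c 0 j) by lra.
    have A2 : 0 < r + (y 0 j - c 0 j) by lra.
    have B1 : 0 < r - (x 0 j - c 0 j) by lra.
    have B2 : 0 < r - (y 0 j - c 0 j) by lra.
    have := convex_gt0 A1 A2 s01; have := convex_gt0 B1 B2 s01.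
    by move=> H1 H2; rewrite mulr1; apply/andP; split; lra.
  have bound s : 0 <= s <= 1 ->
      rnorm (zero_extension (partial j f) (z i + (s * h) *: delta_mx 0 j) - 0) <= M.
    move=> s01; have [v vE] := in_domain (seg s s01).
    by rewrite subr0 -vE zero_extensionE.
  have := partial_mean_value (df j) seg bound.
  rewrite scaler0 subr0 -zS; move/le_trans; apply.
  rewrite ler_wpM2l //; last by have := ler_coord (y - x) j; rewrite !mxE.
  by have [v _] := in_domain (seg 0 ltac:(by rewrite lexx ler01)); apply: le_trans (HM j
    v); exact: rnorm_ge0.
by have := key d (leqnn d); rewrite zd.
Qed.

(** A coordinate staircase between distant points may leave Omega, so it is used in small cubes
    along the segment and [local_lipschitz] glues the estimates without losing in the constant. *)
Lemma segment_lipschitz f (x y : 'rV[R]_d) M :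
  (forall j, differentiable_along j f) ->
  (forall j z, rnorm (partial j f z) <= M) ->
  (forall t, 0 <= t <= 1 -> Omega (x + t *: (y - x))) ->
  rnorm (zero_extension f y - zero_extension f x) <= d%:R * (M * `|y - x|).
Proof.
move=> df HM seg.
pose phi t := zero_extension f (x + t *: (y - x)).
have := @local_lipschitz R F E phi 0 1 (d%:R * (M * `|y - x|)) ler01.
have -> : phi 0 = zero_extension f x by rewrite /phi scale0r addr0.
have -> : phi 1 = zero_extension f y by rewrite /phi scale1r addrC subrK.
rewrite subr0 mulr1; apply=> t t01 e e0; rewrite /phi.
have [r r0 Hr] := domain_ball Omega_open (seg t t01).
have n0 : 0 < `|y - x| + 1 by rewrite ltr_wpDl.
exists (r / (`|y - x| + 1)); first by rewrite divr_gt0.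
move=> s s01; rewrite ltr_pdivlMr // => st.
have distE : x + s *: (y - x) - (x + t *: (y - x)) = (s - t) *: (y - x).
  by rewrite opprD addrACA subrr add0r scalerBl.
apply: le_trans (@cube_lipschitz f (x + t *: (y - x)) _ _ r M Hr df HM _ _) _.
- by rewrite subrr normr0.
- by rewrite distE normrZ; apply: le_lt_trans st; rewrite ler_wpM2l // lerDl.
rewrite distE normrZ mulrDl -!mulrA [ `|s - t| * _]mulrC lerDl.
by rewrite mulr_ge0 // ltW.
Qed.

End UniformLimits.

Section Composition.
Variables (R : realType) (F : RorC) (d : nat).
Local Notation K := (scalar_field R F).
Variables (Omega : set 'rV[R]_d) (E : normedModType K).
Variable e : {linear E -> K^o}.
Hypothesis e_cont : continuous e.
Implicit Types (f : Omega -> E) (w : seq 'I_d).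
Local Notation "e ∘ f" := ((e : E -> K^o) \o f : Omega -> K^o) (at level 50).

Lemma zero_extension_comp f y :
  zero_extension (e ∘ f) y = (e (zero_extension f y) : K^o).
Proof.
rewrite /zero_extension /valL_ /=; case: 'oinv_ _ => [x|] //=.
by rewrite linear0.
Qed.

Lemma diff_quotient_comp j f (x : Omega) h :
  diff_quotient j (e ∘ f) x h = (e (diff_quotient j f x h) : K^o).
Proof.
change (real_scalar F h^-1 *: (zero_extension (e ∘ f) (val x + h *: delta_mx 0 j)
  - (e (f x) : K^o)) = e (real_scalar F h^-1 *:
    (zero_extension f (val x + h *: delta_mx 0 j) - f x))).
by rewrite zero_extension_comp [RHS]linearZ /= (raddfB e).
Qed.

Lemma partial_comp j f : differentiable_along j f ->
  differentiable_along j (e ∘ f) /\ partial j (e ∘ f) = e ∘ (partial j f).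
Proof.
move=> df.
have H (x : Omega) : diff_quotient j (e ∘ f) x @ 0^' --> (e (partial j f x) : K^o).
  rewrite (_ : diff_quotient j (e ∘ f) x = (e : E -> K^o) \o diff_quotient j f x).
    by apply: continuous_cvg; [exact: e_cont|exact: df].
  by apply/funext => h; exact: diff_quotient_comp.
split=> [x|]; first by apply/cvg_ex; eexists; exact: H.
by apply/funext => x; exact: partialP.
Qed.

Lemma is_Ck_comp k f : is_Ck k f -> is_Ck k (e ∘ f).
Proof.
elim: k f => [|k IH] f [cf df].
  by split=> // x; apply: continuous_comp; [exact: cf|exact: e_cont].
split=> [x|j]; first by apply: continuous_comp; [exact: cf|exact: e_cont].
have [dj Cj] := df j; have [de ->] := partial_comp dj.
by split=> //; exact: IH.
Qed.

Lemma wpartial_comp k w f : is_Ck k f -> (size w <= k)%N ->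
  wpartial w (e ∘ f) = e ∘ (wpartial w f).
Proof.
move=> Cf; elim: w => //= j w IH wk; rewrite (IH (ltnW wk)).
apply: (partial_comp _).2; have := is_Ck_wpartial (ltnW wk) Cf.
by rewrite -(subnSK wk) => /is_Ck_differentiable.
Qed.

End Composition.

(** * Hoelder spaces *)

Section Esup0.
Variable R : realType.
Implicit Types A B : set R.

Lemma esup0_fineK A : (esup0 A < +oo)%E -> (fine (esup0 A))%:E = esup0 A.
Proof. by move=> Aoo; rewrite fineK // fin_numElt Aoo andbT (lt_le_trans _ (esup0_ge0 A)). Qed.

Lemma esup0_bound A M : (forall r, A r -> r <= M) -> (esup0 A < +oo)%E.
Proof. by move=> AM; apply/esup0_ltP; exists M. Qed.

Lemma fine_esup0_ge A r : (esup0 A < +oo)%E -> A r -> r <= fine (esup0 A).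
Proof.
move=> Aoo Ar; rewrite -lee_fin esup0_fineK //.
by apply: ereal_sup_ubound; right; exists r.
Qed.

Lemma fine_esup0_le A M : 0 <= M -> (forall r, A r -> r <= M) -> fine (esup0 A) <= M.
Proof.
move=> M0 AM; rewrite -lee_fin esup0_fineK ?(esup0_bound AM) //.
by apply: ge_ereal_sup => _ [->|[r /AM rM <-]]; rewrite lee_fin.
Qed.

Lemma fine_esup0_ge0 A : 0 <= fine (esup0 A).
Proof. by apply: fine_ge0; exact: esup0_ge0. Qed.

End Esup0.

Section SeminormFamilies.
Variables (R : realType) (F : RorC) (X : lmodType (scalar_field R F)).
Implicit Types (Q : set (X -> R)) (q P : X -> R).

Lemma seminorm_add q q' : is_seminorm q -> is_seminorm q' ->
  is_seminorm (fun x => q x + q' x).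
Proof.
move=> sq sq'; apply: seminormI => [x|x y|a x].
- by rewrite addr_ge0 ?seminorm_ge0.
- by rewrite addrACA lerD ?seminormD.
- by case: sq sq' => _ _ -> [_ _ ->]; rewrite mulrDr.
Qed.

Definition sup_seminorm Q x : R := fine (esup0 [set q x | q in Q]).

Lemma sup_seminorm_le Q x M : 0 <= M -> (forall q, Q q -> q x <= M) ->
  sup_seminorm Q x <= M.
Proof. by move=> M0 H; apply: fine_esup0_le => // _ [q /H h <-]. Qed.

Lemma sup_seminorm_ge Q q x : (exists M, forall q, Q q -> q x <= M) -> Q q ->
  q x <= sup_seminorm Q x.
Proof.
move=> [M HM] Qq; apply: fine_esup0_ge; last by exists q.
by apply: (@esup0_bound _ _ M) => _ [p /HM h <-].
Qed.

Lemma sup_seminorm_seminorm Q : (forall q, Q q -> is_seminorm q) ->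
  (forall x, exists M, forall q, Q q -> q x <= M) -> is_seminorm (sup_seminorm Q).
Proof.
move=> sQ bQ; apply: seminormI => [x|x y|a x]; first exact: fine_esup0_ge0.
  apply: sup_seminorm_le => [|q Qq]; first by rewrite addr_ge0 ?fine_esup0_ge0.
  apply: le_trans (seminormD _ _ (sQ q Qq)) _.
  by apply: lerD; exact: sup_seminorm_ge.
apply: sup_seminorm_le => [|q Qq]; first by rewrite mulr_ge0 ?rabs_ge0 ?fine_esup0_ge0.
have [_ _ ->] := sQ q Qq; rewrite ler_wpM2l ?rabs_ge0 //; exact: sup_seminorm_ge.
Qed.

Lemma seminorm_continuous P q C : is_seminorm P -> is_seminorm q ->
  (forall x, q x <= C * P x) -> continuous (q : tspace (norm_topology P) -> R).
Proof.
move=> sP sq qC x U /nbhs_ballP[e /= e0 eU].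
change (nbhs (x : tspace (norm_topology P)) (q @^-1` U)).
have C0 : 0 < `|C| + 1 by rewrite ltr_wpDl.
have h := nbhs_seminorm (norm_topology_seminorm sP) x (erefl : [set P] P) (divr_gt0 e0 C0).
apply: (filterS _ h) => y; rewrite /= ltr_pdivlMr // mulrC => yx.
apply: eU; rewrite -ball_normE /=.
have yx' : q (y - x) < e.
  apply: le_lt_trans yx; apply: le_trans (qC _) _; rewrite ler_wpM2r ?seminorm_ge0 //.
  by rewrite (le_trans (ler_norm _)) // lerDl.
have := seminorm_ge_dist x y sq; have := seminorm_ge_dist y x sq.
rewrite (seminorm_distC x) // ltr_distl => h1 h2.
by apply/andP; split; lra.
Qed.

Lemma finite_dominated (D : set (X -> R)) P : is_seminorm P -> finite_set D ->
  (forall q, D q -> exists C, forall x, q x <= C * P x) ->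
  exists2 C, 0 <= C & forall q, D q -> forall x, q x <= C * P x.
Proof.
move=> sP /finite_seqP[s sD] H.
have {}H q : q \in s -> exists C, forall x, q x <= C * P x.
  by move=> qs; apply: H; rewrite sD.
suff [C C0 HC] : exists2 C, 0 <= C & forall q, q \in s -> forall x, q x <= C * P x.
  by exists C => // q; rewrite sD; exact: HC.
elim: s H {sD} => [_|p s IH H]; first by exists 0.
have [|C C0 HC] := IH; first by move=> q qs; apply: H; rewrite inE qs orbT.
have [C' HC'] := H p (mem_head _ _).
exists (C + `|C'|) => [|q]; first by rewrite addr_ge0.
rewrite inE => /predU1P[->|qs] x.
  apply: le_trans (HC' x) _; rewrite ler_wpM2r ?seminorm_ge0 //.
  by rewrite (le_trans (ler_norm _)) // lerDr.
by apply: le_trans (HC q qs x) _; rewrite ler_wpM2r ?seminorm_ge0 // lerDl.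
Qed.

(** Finite subfamilies of [Q] make the system directed and keep each member dominated by a multiple
    of [P]; the empty one gives [P] itself, and singletons already recover the full supremum. *)
Lemma sup_saks_system P Q : is_seminorm P -> (forall q, Q q -> is_seminorm q) ->
  (forall q, Q q -> exists C, forall x, q x <= C * P x) ->
  (forall x, exists M, forall q, Q q -> q x <= M) ->
  saks_system (fun x => P x + sup_seminorm Q x) (norm_topology P)
    [set (fun x => P x + sup_seminorm D x) | D in [set D | finite_set D /\ D `<=` Q]].
Proof.
move=> sP sQ QP bQ.
have bD D x : D `<=` Q -> exists M, forall q, D q -> q x <= M.
  by move=> DQ; have [M HM] := bQ x; exists M => q /DQ; exact: HM.
have sD D : D `<=` Q -> is_seminorm (fun x => P x + sup_seminorm D x).
  move=> DQ; apply: seminorm_add => //; apply: sup_seminorm_seminorm.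
    by move=> q /DQ /sQ.
  by move=> x; exact: bD.
have mono D D' x : D `<=` D' -> D' `<=` Q -> sup_seminorm D x <= sup_seminorm D' x.
  move=> DD' DQ; apply: sup_seminorm_le; first exact: fine_esup0_ge0.
  by move=> q /DD' Dq; apply: sup_seminorm_ge => //; exact: bD.
have domD D : finite_set D -> D `<=` Q ->
    exists C, forall x, P x + sup_seminorm D x <= C * P x.
  move=> fD DQ; have [|C C0 HC] := finite_dominated sP fD; first by move=> q /DQ /QP.
  exists (1 + C) => x; rewrite mulrDl mul1r lerD2l.
  by apply: sup_seminorm_le => [|q Dq]; [rewrite mulr_ge0 ?seminorm_ge0|exact: HC].
split.
- split.
    exists (fun x => P x + sup_seminorm set0 x), set0 => //.
    by split; [exact: finite_set0|exact: sub0set].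
  move=> _ _ [D [fD DQ] <-] [D' [fD' D'Q] <-].
  have DDQ : D `|` D' `<=` Q by rewrite subUset.
  exists (fun x => P x + sup_seminorm (D `|` D') x).
    by exists (D `|` D') => //; split; rewrite ?finite_setU.
  move=> x; rewrite !lerD2l.
  by split; [exact: (mono _ _ _ (@subsetUl _ D D') DDQ)|exact: (mono _ _ _ (@subsetUr _ D D') DDQ)].
- move=> _ [D [fD DQ] <-]; split; first exact: sD.
  by have [C HC] := domD D fD DQ; apply: seminorm_continuous HC => //; exact: sD.
- apply: topology_ext; apply/seteqP; split; apply: seminorm_topology_sub.
  + exact: norm_topology_seminorm.
  + by move=> _ [D [_ DQ] <-]; exact: sD.
  + move=> _ ->; exists (fun x => P x + sup_seminorm set0 x).
      by exists set0 => //; split; [exact: finite_set0|exact: sub0set].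
    by exists 1 => x; rewrite mul1r lerDl fine_esup0_ge0.
  + by move=> _ [D [_ DQ] <-]; exact: sD.
  + exact: norm_topology_seminorm.
  + by move=> _ [D [fD DQ] <-]; exists P => //; exact: domD.
- move=> x; apply/eqP; rewrite eq_le; apply/andP; split.
    apply: ge_ereal_sup => _ [_ [D [_ DQ] <-] <-].
    by rewrite lee_fin lerD2l mono.
  apply/lee_addgt0Pr => e e0.
  have [M HM] := bQ x.
  have Qoo : (esup0 [set q x | q in Q] < +oo)%E.
    by apply: (@esup0_bound _ _ M) => _ [p /HM h <-].
  have : ((sup_seminorm Q x - e)%:E < esup0 [set q x | q in Q])%E.
    by rewrite -esup0_fineK // lte_fin ltrBlDr ltrDl.
  move=> /ereal_sup_gt[z Hz zlt].
  suff [D [fD DQ] zD] : exists2 D, finite_set D /\ D `<=` Q & (z <= (sup_seminorm D x)%:E)%E.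
    have : ((P x + sup_seminorm D x)%R%:E <=
        ereal_sup [set (q x)%:E | q in [set (fun x => P x + sup_seminorm D x)%R |
          D in [set D | finite_set D /\ D `<=` Q]]])%E.
      apply: ereal_sup_ubound; exists (fun x => P x + sup_seminorm D x) => //.
      by exists D.
    move=> h; rewrite -leeBlDr // -EFinB; apply: le_trans h.
    rewrite lee_fin -addrA lerD2l -lee_fin.
    exact: le_trans (ltW zlt) zD.
  case: Hz => [->|[_ [q Qq <-] <-]].
    by exists set0; [split; [exact: finite_set0|exact: sub0set]|rewrite lee_fin fine_esup0_ge0].
  exists [set q]; first by split; [exact: finite_set1|move=> _ ->].
  by rewrite lee_fin; apply: sup_seminorm_ge => //; apply: bD => _ ->.
Qed.

End SeminormFamilies.

Section HoelderNorms.
Variables (R : realType) (F : RorC) (d : nat).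
Local Notation K := (scalar_field R F).
Variables (Omega : set 'rV[R]_d) (E : normedModType K) (k : nat) (alpha : R).
Local Notation X := (@Hoelder_space R F d Omega E k alpha).
Implicit Types (f g : X) (b : multi_index d).

Lemma Hoelder_spaceP f : Hoelder k alpha (val f).
Proof. exact/set_mem/(valP f). Qed.

Lemma Hoelder_is_Ck f : is_Ck k (val f).
Proof. by case: (Hoelder_spaceP f) => -[]. Qed.

Lemma mpartial_val b a f g : (mi_order b <= k)%N ->
  mpartial b (val (a *: f + g)) = a *: mpartial b (val f) + mpartial b (val g).
Proof.
move=> bk; rewrite -(mpartial_lin a bk (Hoelder_is_Ck f) (Hoelder_is_Ck g)).
by rewrite linearP.
Qed.

Lemma mpartial_valD b f g : (mi_order b <= k)%N ->
  mpartial b (val (f + g)) = mpartial b (val f) + mpartial b (val g).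
Proof. by move=> bk; rewrite -[f]scale1r mpartial_val // !scale1r. Qed.

Lemma mpartial_valZ b a f : (mi_order b <= k)%N ->
  mpartial b (val (a *: f)) = a *: mpartial b (val f).
Proof.
by move=> bk; rewrite -[a *: f]addr0 mpartial_val // linear0 mpartial0 addr0.
Qed.

Lemma mpartial_valB b f g : (mi_order b <= k)%N ->
  mpartial b (val (f - g)) = mpartial b (val f) - mpartial b (val g).
Proof. by move=> bk; rewrite mpartial_valD // -scaleN1r mpartial_valZ // scaleN1r. Qed.

(** Both norms are presented as suprema of evaluation seminorms, so that [sup_seminorm] yields the
    seminorm laws and the Saks system. *)
Definition Ck_functionals : set (X -> R) := [set q | exists b (x : Omega),
  (mi_order b <= k)%N /\ q = fun f => rnorm (mpartial b (val f) x)].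

Definition quotient_functionals : set (X -> R) := [set q | exists b (x y : Omega),
  [/\ mi_order b = k, x <> y & q = fun f =>
    rnorm (mpartial b (val f) x - mpartial b (val f) y) / enorm (val x - val y) `^ alpha]].

Lemma Ck_functional_seminorm q : Ck_functionals q -> is_seminorm q.
Proof.
move=> [b [x [bk ->]]]; apply: seminormI => [f|f g|a f]; first exact: rnorm_ge0.
  by rewrite mpartial_valD // ler_rnormD.
by rewrite mpartial_valZ // rnormZ.
Qed.

Lemma quotient_functional_seminorm q : quotient_functionals q -> is_seminorm q.
Proof.
move=> [b [x [y [bk _ ->]]]].
have e0 : 0 <= (enorm (val x - val y) `^ alpha)^-1 by rewrite invr_ge0 powR_ge0.
have bk' : (mi_order b <= k)%N by rewrite bk.
apply: (seminorm_scale e0); apply: seminormI => [f|f g|a f]; first exact: rnorm_ge0.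
  rewrite mpartial_valD //.
  rewrite (_ : _ - _ = (mpartial b (val f) x - mpartial b (val f) y) +
    (mpartial b (val g) x - mpartial b (val g) y)) ?ler_rnormD //.
  by rewrite addrACA -opprD.
rewrite mpartial_valZ // (_ : _ - _ = a *: (mpartial b (val f) x - mpartial b (val f) y))
  ?rnormZ //.
by rewrite scalerBr.
Qed.

Lemma Hoelder_bounds f : exists M : R,
  (forall b x, (mi_order b <= k)%N -> rnorm (mpartial b (val f) x) <= M) /\
  (forall b x y, mi_order b = k -> x <> y ->
      rnorm (mpartial b (val f) x - mpartial b (val f) y) /
        enorm (val x - val y) `^ alpha <= M).
Proof. by case: (Hoelder_spaceP f) => _ /Hoelder_enorm_ltP. Qed.

Lemma Ck_functionals_bounded f : exists M, forall q, Ck_functionals q -> q f <= M.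
Proof. by have [M [HM _]] := Hoelder_bounds f; exists M => _ [b [x [bk ->]]]; exact: HM. Qed.

Lemma quotient_functionals_bounded f :
  exists M, forall q, quotient_functionals q -> q f <= M.
Proof.
by have [M [_ HM]] := Hoelder_bounds f; exists M => _ [b [x [y [bk xy ->]]]]; exact: HM.
Qed.

Lemma Ck_normE : @Ck_norm R F d Omega E k alpha = sup_seminorm Ck_functionals.
Proof.
apply/funext => f; rewrite /Ck_norm /Ck_enorm /sup_seminorm; congr (fine (esup0 _)).
apply/seteqP; split=> r; first by move=> [b [x [bk ->]]]; eexists; [exists b, x; split|].
by move=> [_ [b [x [bk ->]]] <-]; exists b, x.
Qed.

Lemma Hoelder_normE : @Hoelder_norm R F d Omega E k alpha =
  fun f => Ck_norm f + sup_seminorm quotient_functionals f.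
Proof.
apply/funext => f; rewrite /Hoelder_norm /Hoelder_enorm.
have [M [HM HM']] := Hoelder_bounds f.
have Coo : (Ck_enorm k (val f) < +oo)%E.
  by apply: (@esup0_bound _ _ M) => _ [b [x [bk ->]]]; exact: HM.
have Qoo : (esup0 (Hoelder_quotients k alpha (val f)) < +oo)%E.
  by apply: (@esup0_bound _ _ M) => _ [b [x [y [bk xy ->]]]]; exact: HM'.
rewrite fineD ?fin_numElt ?Coo ?Qoo ?andbT ?(lt_le_trans _ (esup0_ge0 _)) //.
congr (_ + fine (esup0 _)).
apply/seteqP; split=> r.
  by move=> [b [x [y [bk xy ->]]]]; eexists; [exists b, x, y; split|].
by move=> [_ [b [x [y [bk xy ->]]]] <-]; exists b, x, y.
Qed.

Local Notation P := (@Ck_norm R F d Omega E k alpha).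
Local Notation N := (@Hoelder_norm R F d Omega E k alpha).

Lemma Ck_norm_seminorm : is_seminorm P.
Proof.
rewrite Ck_normE; apply: sup_seminorm_seminorm; first exact: Ck_functional_seminorm.
exact: Ck_functionals_bounded.
Qed.

Lemma Hoelder_norm_seminorm : is_seminorm N.
Proof.
rewrite Hoelder_normE; apply: seminorm_add; first exact: Ck_norm_seminorm.
apply: sup_seminorm_seminorm; first exact: quotient_functional_seminorm.
exact: quotient_functionals_bounded.
Qed.

Lemma Ck_norm_ge b f x : (mi_order b <= k)%N -> rnorm (mpartial b (val f) x) <= P f.
Proof.
move=> bk; rewrite Ck_normE.
apply: (@sup_seminorm_ge _ _ _ Ck_functionals (fun f => rnorm (mpartial b (val f) x))).
  exact: Ck_functionals_bounded.
by exists b, x.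
Qed.

Lemma Ck_norm_le f M : 0 <= M ->
  (forall b x, (mi_order b <= k)%N -> rnorm (mpartial b (val f) x) <= M) -> P f <= M.
Proof.
by move=> M0 H; rewrite Ck_normE; apply: sup_seminorm_le => // _ [b [x [bk ->]]]; exact: H.
Qed.

Lemma Ck_norm_le_Hoelder f : P f <= N f.
Proof. by rewrite Hoelder_normE lerDl fine_esup0_ge0. Qed.

Lemma Hoelder_norm_ge b f (x y : Omega) : mi_order b = k -> x <> y ->
  rnorm (mpartial b (val f) x - mpartial b (val f) y) / enorm (val x - val y) `^ alpha <= N f.
Proof.
move=> bk xy; rewrite Hoelder_normE.
apply: le_trans (_ : sup_seminorm quotient_functionals f <= _); last first.
  by rewrite lerDr fine_esup0_ge0.
apply: (@sup_seminorm_ge _ _ _ quotient_functionals (fun f => rnorm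
  (mpartial b (val f) x - mpartial b (val f) y) / enorm (val x - val y) `^ alpha)).
  exact: quotient_functionals_bounded.
by exists b, x, y.
Qed.

Lemma mpartial_0 (f : Omega -> E) : mpartial [ffun=> 0%N] f = f.
Proof.
by rewrite /mpartial; elim: (enum _) => //= j s ->; rewrite ffunE.
Qed.

Lemma mi_order_0 : mi_order ([ffun=> 0%N] : multi_index d) = 0%N.
Proof. by rewrite /mi_order big1 // => j _; rewrite ffunE. Qed.

Lemma Ck_norm_eq0 f : P f = 0 -> f = 0.
Proof.
move=> f0; apply/val_inj; rewrite linear0; apply/funext => x.
apply/rnorm0_eq0/eqP; rewrite eq_le rnorm_ge0 andbT -f0.
by have := @Ck_norm_ge [ffun=> 0%N] f x; rewrite mpartial_0 mi_order_0; apply.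
Qed.

Lemma Hoelder_norm_eq0 f : N f = 0 -> f = 0.
Proof.
move=> f0; apply: Ck_norm_eq0; apply/eqP; rewrite eq_le -{1}f0 Ck_norm_le_Hoelder.
exact: seminorm_ge0 Ck_norm_seminorm.
Qed.

(** At a fixed pair of distinct points the Hoelder quotient is dominated by [P], with a constant
    that grows as the pair approaches the diagonal. *)
Lemma Hoelder_saks_system :
  exists G, saks_system N (@Ck_topology R F d Omega E k alpha) G.
Proof.
rewrite Hoelder_normE; eexists; apply: sup_saks_system.
- exact: Ck_norm_seminorm.
- exact: quotient_functional_seminorm.
- move=> _ [b [x [y [bk xy ->]]]].
  exists (2 / enorm (val x - val y) `^ alpha) => f.
  rewrite mulrAC ler_wpM2r ?invr_ge0 ?powR_ge0 // mulr_natl mulr2n.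
  by apply: le_trans (ler_rnormB _ _) _; apply: lerD; apply: Ck_norm_ge; rewrite bk.
- exact: quotient_functionals_bounded.
Qed.

Lemma Hoelder_is_Saks : is_Saks N (@Ck_topology R F d Omega E k alpha).
Proof.
have sP := norm_topology_seminorm Ck_norm_seminorm.
split.
- by split; [exact: Hoelder_norm_seminorm|exact: Hoelder_norm_eq0].
- exact: seminorm_topology_convex.
- by apply: seminorm_topology_hausdorff => // f H; exact/Ck_norm_eq0/H.
- exact: norm_topology_le Hoelder_norm_seminorm Ck_norm_seminorm Ck_norm_le_Hoelder.
- exact: Hoelder_saks_system.
Qed.

End HoelderNorms.

(** * Continuous extension to the closure *)

Section Extension.
Variables (R : realType) (F : RorC) (d : nat).
Local Notation K := (scalar_field R F).
Variables (Omega : set 'rV[R]_d).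

Lemma closure_domain (p : 'rV[R]_d) r : closure Omega p -> 0 < r ->
  exists x : Omega, `|val x - p| < r.
Proof.
move=> clp r0; have [y [Oy yp]] := clp _ (nbhsx_ballx p r r0).
by have [x xE] := in_domain Oy; exists x; rewrite xE distrC; rewrite -ball_normE in yp.
Qed.

Lemma subset_closure_domain (x : Omega) : closure Omega (val x).
Proof. by apply: subset_closure; exact: domainP. Qed.
Arguments subset_closure_domain : clear implicits.

Section Normed.
Variable E : normedModType K.
Implicit Types (g : Omega -> E) (h : 'rV[R]_d -> E).

Lemma is_extensionP g h : is_extension g h <->
  (forall x : Omega, h (val x) = g x) /\
  forall p, closure Omega p -> forall e : R, 0 < e -> exists2 r : R, 0 < r &
    forall q, closure Omega q -> `|q - p| < r -> rnorm (h p - h q) < e.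
Proof.
split=> [[ch eh]|[eh ch]]; split=> //.
  move=> p clp e e0; have /subspace_continuousP/(_ p clp)/cvg_rnormP/(_ e e0) := ch.
  rewrite /within /= => /nbhs_ballP[r /= r0 Hr]; exists r => // q clq qp.
  by apply: Hr => //; change (ball p r q); rewrite -ball_normE /= distrC.
apply/subspace_continuousP => p clp; apply/cvg_rnormP => e e0.
have [r r0 Hr] := ch p clp e e0.
rewrite /within /=; apply/nbhs_ballP; exists r => //= q.
by rewrite -ball_normE /= distrC => qp clq; exact: Hr.
Qed.

(** The intrinsic criterion for a continuous extension with complete target. It involves only values
    inside Omega, hence passes to uniform limits. *)
Definition locally_cauchy g := forall p, closure Omega p -> forall e : R, 0 < e ->
  exists2 r : R, 0 < r & forall x y : Omega, `|val x - p| < r -> `|val y - p| < r ->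
    rnorm (g x - g y) <= e.

Lemma extension_locally_cauchy g h : is_extension g h -> locally_cauchy g.
Proof.
move=> /is_extensionP[eh ch] p clp e e0.
have e2 : 0 < e / 2 by rewrite divr_gt0.
have [r r0 Hr] := ch p clp _ e2; exists r => // x y xp yp.
rewrite -(eh x) -(eh y) [e]splitr.
have hx := Hr _ (subset_closure_domain x) xp.
have hy := Hr _ (subset_closure_domain y) yp.
rewrite rnorm_distC in hx.
exact: le_trans (ler_rnorm_distD (h p) _ _) (ltW (ltrD hx hy)).
Qed.

Lemma extension_spec g : (exists h, is_extension g h) -> is_extension g (extension g).
Proof. by move=> [h gh]; rewrite /extension; case: xgetP => [y _ //|/(_ h)]. Qed.

Lemma extension_approx g h p : is_extension g h -> closure Omega p ->
  forall e : R, 0 < e -> exists x : Omega, rnorm (h p - g x) < e.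
Proof.
move=> /is_extensionP[eh ch] clp e e0.
have [r r0 Hr] := ch p clp e e0; have [x xp] := closure_domain clp r0.
by exists x; rewrite -eh; apply: Hr => //; exact: subset_closure_domain.
Qed.

Lemma extension_bound g h p M : is_extension g h -> closure Omega p ->
  (forall x, rnorm (g x) <= M) -> rnorm (h p) <= M.
Proof.
move=> gh clp gM; apply/ler_addgt0Pr => e e0.
have [x px] := extension_approx gh clp e0.
by apply: le_trans (rnorm_ge_dist _ (g x)) _; rewrite addrC lerD // ltW.
Qed.

Lemma extension_unique g h h' p : is_extension g h -> is_extension g h' ->
  closure Omega p -> h p = h' p.
Proof.
move=> /is_extensionP[eh ch] /is_extensionP[eh' ch'] clp.
apply/eqP; rewrite -subr_eq0; apply/eqP/rnorm0_eq0/eqP.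
rewrite eq_le rnorm_ge0 andbT; apply/ler_addgt0Pr => e e0; rewrite add0r.
have e2 : 0 < e / 2 by rewrite divr_gt0.
have [r r0 Hr] := ch p clp _ e2; have [r' r'0 Hr'] := ch' p clp _ e2.
have m0 : 0 < Num.min r r' by rewrite lt_min r0.
have [x] := closure_domain clp m0; rewrite lt_min => /andP[xr xr'].
have clx := subset_closure_domain x.
have hx := Hr _ clx xr; have hx' := Hr' _ clx xr'.
rewrite rnorm_distC eh' -eh in hx'; rewrite [e]splitr.
exact: le_trans (ler_rnorm_distD (h (val x)) _ _) (ltW (ltrD hx hx')).
Qed.

End Normed.

Lemma locally_cauchy_extension (E : normedModType K) (g : Omega -> E) :
  cauchy_complete E -> locally_cauchy g -> exists h, is_extension g h.
Proof.
move=> cE lc.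
have lim p : closure Omega p -> exists v : E, forall e : R, 0 < e ->
    exists2 r : R, 0 < r & forall y : Omega, `|val y - p| < r -> rnorm (v - g y) <= e.
  move=> clp.
  pose B (r : R) : set Omega := [set x | `|val x - p| < r].
  have PF : ProperFilter (filter_from [set r : R | 0 < r] B).
    apply: filter_from_proper; last by move=> r /= r0; exact: closure_domain.
    apply: filter_from_filter; first by exists 1 => /=.
    move=> r s /= r0 s0; exists (Num.min r s); rewrite /= ?lt_min ?r0 //.
    by move=> x; rewrite /B /= lt_min => /andP[].
  have cF : cvg (g @ filter_from [set r : R | 0 < r] B).
    apply: cauchy_rnorm_cvg => // e e0; have e2 : 0 < e / 2 by rewrite divr_gt0.
    have [r r0 Hr] := lc p clp _ e2; exists (B r); first by exists r.
    move=> x y xp yp; apply: le_lt_trans (Hr x y xp yp) _.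
    by rewrite ltr_pdivrMr // mulr_natr mulr2n ltrDl.
  exists (lim (g @ filter_from [set r : R | 0 < r] B)) => e e0.
  have e2 : 0 < e / 2 by rewrite divr_gt0.
  have [r r0 Hr] := lc p clp _ e2; exists r => // y yp.
  have /cvg_rnormP/(_ _ e2) [s /= s0 Hs] := cF.
  have m0 : 0 < Num.min r s by rewrite lt_min r0.
  have [x] := closure_domain clp m0; rewrite lt_min => /andP[xr xs].
  rewrite [e]splitr; apply: le_trans (ler_rnorm_distD (g x) _ _) _.
  by apply: lerD; [exact/ltW/(Hs x xs)|exact: Hr].
have /choice[h Hh] : forall p, exists v : E, closure Omega p -> forall e : R, 0 < e ->
    exists2 r : R, 0 < r & forall y : Omega, `|val y - p| < r -> rnorm (v - g y) <= e.
  move=> p; have [/lim[v Hv]|nclp] := pselect (closure Omega p); first by exists v.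
  by exists 0.
exists h; apply/is_extensionP; split=> [x|p clp e e0].
  apply/eqP; rewrite -subr_eq0; apply/eqP/rnorm0_eq0/eqP.
  rewrite eq_le rnorm_ge0 andbT; apply/ler_addgt0Pr => e e0; rewrite add0r.
  have [r r0 Hr] := Hh _ (subset_closure_domain x) e e0.
  by apply: Hr; rewrite subrr normr0.
have e3 : 0 < e / 3 by rewrite divr_gt0.
have [r r0 Hr] := Hh p clp _ e3; exists (r / 2); first by rewrite divr_gt0.
move=> q clq qp; have [s s0 Hs] := Hh q clq _ e3.
have m0 : 0 < Num.min (r / 2) s by rewrite lt_min s0 divr_gt0.
have [x] := closure_domain clq m0; rewrite lt_min => /andP[xr xs].
have xp : `|val x - p| < r.
  rewrite -(subrKA q) (splitr r); apply: le_lt_trans (ler_normD _ _) _.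
  exact: ltrD.
have := Hr x xp; have := Hs x xs; have := ler_rnorm_distD (g x) (h p) (h q).
rewrite (rnorm_distC (g x)); lra.
Qed.

End Extension.

Section FamilyTopology.
Variables (R : realType) (F : RorC) (d : nat).
Local Notation K := (scalar_field R F).
Variables (Omega : set 'rV[R]_d) (E : normedModType K) (k : nat) (alpha : R).
Local Notation X := (@Hoelder_space R F d Omega E k alpha).
Local Notation N := (@Hoelder_norm R F d Omega E k alpha).
Local Notation P := (@Ck_norm R F d Omega E k alpha).
Implicit Types (f g : X) (b : multi_index d).

Lemma extension_val b f : (mi_order b <= k)%N ->
  is_extension (mpartial b (val f)) (extension (mpartial b (val f))).
Proof.
move=> bk; apply: extension_spec.
by have [[_ H] _] := Hoelder_spaceP f; exact: H.
Qed.

Lemma extension_lin b a f g p : (mi_order b <= k)%N -> closure Omega p ->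
  extension (mpartial b (val (a *: f + g))) p =
  a *: extension (mpartial b (val f)) p + extension (mpartial b (val g)) p.
Proof.
move=> bk clp.
have := is_extension_lin a (extension_val f bk) (extension_val g bk).
rewrite -mpartial_val // => H.
exact: (extension_unique (extension_val _ bk) H clp).
Qed.

Lemma extension_difference_seminorm b p q (c : R) : (mi_order b <= k)%N ->
  closure Omega p -> closure Omega q -> 0 <= c ->
  is_seminorm (fun f : X => rnorm (extension (mpartial b (val f)) p -
     extension (mpartial b (val f)) q) * c).
Proof.
move=> bk clp clq c0; apply: (seminorm_scale c0).
have L a f g : extension (mpartial b (val (a *: f + g))) p -
    extension (mpartial b (val (a *: f + g))) q =
    a *: (extension (mpartial b (val f)) p - extension (mpartial b (val f)) q) +
    (extension (mpartial b (val g)) p - extension (mpartial b (val g)) q).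
  by rewrite !extension_lin // opprD addrACA -scalerBr.
have E0 : extension (mpartial b (val (0 : X))) p - extension (mpartial b (val (0 : X))) q = 0.
  by have := L (-1) 0 0; rewrite scaler0 add0r scaleN1r addNr.
apply: seminormI => [f|f g|a f]; first exact: rnorm_ge0.
  by have := L 1 f g; rewrite !scale1r => ->; exact: ler_rnormD.
by have := L a f 0; rewrite addr0 E0 addr0 => ->; rewrite rnormZ.
Qed.

Lemma compact_off_diagonal (D : set ('rV[R]_d * 'rV[R]_d)) : D `<=` off_diagonal Omega ->
  compact D -> exists2 r : R, 0 < r & forall p q, D (p, q) -> r <= enorm (p - q).
Proof.
move=> DO cD; have [->|/set0P[z0 Dz0]] := eqVneq D set0; first by exists 1.
pose phi (z : 'rV[R]_d * 'rV[R]_d) : R := `|z.1 - z.2|.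
have cphi : {within D, continuous phi}.
  apply: continuous_subspaceT => z; apply: cvg_norm; apply: cvgB; [exact: cvg_fst|exact: cvg_snd].
have [z Dz zmin] := compact_EVT_min (ex_intro _ z0 Dz0) cD cphi.
exists (phi z).
  have [_ _ z12] := DO _ (set_mem Dz); rewrite normr_gt0 subr_eq0; exact/eqP.
move=> p q Dpq; apply: le_trans (ler_norm_enorm _).
exact: (zmin (p, q) (mem_set Dpq)).
Qed.

Hypothesis alpha_gt0 : 0 < alpha.

(** A compact [D] at distance at least [r] from the diagonal gives the constant [1 + 2 / r ^ alpha];
    conversely any single member of [SS] gives a seminorm above [P], whence the nonemptiness. *)
Lemma family_topologyE (SS : set (set (multi_index d * ('rV[R]_d * 'rV[R]_d)))) :
  SS !=set0 ->
  (forall S, SS S -> exists D, [/\ D `<=` off_diagonal Omega, compact D &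
     S = [set b | mi_order b = k] `*` D]) ->
  @family_topology R F d Omega E k alpha SS = @Ck_topology R F d Omega E k alpha.
Proof.
move=> [S0 SS0] HSS.
have sP := @Ck_norm_seminorm R F d Omega E k alpha.
have key S : SS S -> is_seminorm (@Hoelder_seminorm R F d Omega E k alpha S) /\
    exists C, forall f, @Hoelder_seminorm R F d Omega E k alpha S f <= C * P f.
  move=> /HSS[D [DO cD ->]].
  have [r r0 Hr] := compact_off_diagonal DO cD.
  pose Q : set (X -> R) := [set q | exists b x y, [/\ mi_order b = k, D (x, y) &
     q = fun f => rnorm (extension (mpartial b (val f)) x -
               extension (mpartial b (val f)) y) * (enorm (x - y) `^ alpha)^-1]].
  have HE : @Hoelder_seminorm R F d Omega E k alpha ([set b | mi_order b = k] `*` D) =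
      fun f => P f + sup_seminorm Q f.
    apply/funext => f; rewrite /Hoelder_seminorm; congr (_ + fine (esup0 _)).
    apply/seteqP; split=> t.
      by move=> [b [x [y [[/= bk Dxy] ->]]]]; eexists; [exists b, x, y; split|].
    by move=> [_ [b [x [y [bk Dxy ->]]]] <-]; exists b, x, y.
  have sQ q : Q q -> is_seminorm q.
    move=> [b [x [y [bk /DO[/= clx cly _] ->]]]].
    by apply: extension_difference_seminorm; rewrite ?bk ?invr_ge0 ?powR_ge0.
  have QP q : Q q -> forall f, q f <= 2 / r `^ alpha * P f.
    move=> [b [x [y [bk Dxy ->]]]] f; have [/= clx cly _] := DO _ Dxy.
    have bk' : (mi_order b <= k)%N by rewrite bk.
    have bnd z : closure Omega z -> rnorm (extension (mpartial b (val f)) z) <= P f.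
      by move=> clz; apply: (extension_bound (extension_val f bk') clz) => w; exact: Ck_norm_ge.
    apply: (@le_trans _ _ ((P f + P f) * (enorm (x - y) `^ alpha)^-1)).
      rewrite ler_wpM2r ?invr_ge0 ?powR_ge0 //.
      by apply: le_trans (ler_rnormB _ _) _; apply: lerD; exact: bnd.
    have h : (enorm (x - y) `^ alpha)^-1 <= (r `^ alpha)^-1.
      rewrite lef_pV2 ?posrE ?powR_gt0 //; last exact: lt_le_trans r0 (Hr _ _ Dxy).
      by apply: ge0_ler_powR; rewrite ?nnegrE ?enorm_ge0 ?(ltW r0) ?(ltW alpha_gt0) // Hr.
    have := ler_wpM2l (seminorm_ge0 f sP) h; lra.
  rewrite HE; split.
    apply: seminorm_add => //; apply: sup_seminorm_seminorm => // f.
    by exists (2 / r `^ alpha * P f) => q Qq; exact: QP.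
  exists (1 + 2 / r `^ alpha) => f; rewrite mulrDl mul1r lerD2l.
  apply: sup_seminorm_le => [|q Qq]; last exact: QP.
  by rewrite mulr_ge0 ?seminorm_ge0 // divr_ge0 ?powR_ge0.
apply: topology_ext; apply/seteqP; split; apply: seminorm_topology_sub.
- by move=> _ [S SSS <-]; case: (key S SSS).
- exact: norm_topology_seminorm.
- by move=> _ [S SSS <-]; exists P => //; case: (key S SSS).
- exact: norm_topology_seminorm.
- by move=> _ [S SSS <-]; case: (key S SSS).
- move=> _ ->; exists (@Hoelder_seminorm R F d Omega E k alpha S0); first by exists S0.
  exists 1 => f; rewrite mul1r lerDl; exact: fine_esup0_ge0.
Qed.

Lemma compact_family_topologyE :
  @family_topology R F d Omega E k alpha (compact_family Omega k) =
  @Ck_topology R F d Omega E k alpha.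
Proof.
apply: family_topologyE; last by move=> _ [D [DO cD] <-]; exists D.
by eexists; exists set0; [split; [exact: sub0set|exact: compact0]|].
Qed.

Lemma finite_family_topologyE :
  @family_topology R F d Omega E k alpha (finite_family Omega k) =
  @Ck_topology R F d Omega E k alpha.
Proof.
apply: family_topologyE.
  by eexists; exists set0; [split; [exact: sub0set|exact: finite_set0]|].
by move=> _ [D [DO fD] <-]; exists D; split=> //; exact: finite_compact.
Qed.

End FamilyTopology.

(** * Completeness of Hoelder balls for the C^k norm *)

Section Completeness.
Variables (R : realType) (F : RorC) (d : nat).
Local Notation K := (scalar_field R F).
Variables (Omega : set 'rV[R]_d) (k : nat) (alpha : R).
Hypothesis Omega_open : open Omega.

Lemma wpartial_mpartial (E : normedModType K) (f : Omega -> E) w : is_Ck k f ->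
  (size w <= k)%N -> exists2 b, (mi_order b <= k)%N & wpartial w f = mpartial b f.
Proof.
move=> Cf wk; have [b bw pw] := word_mi w.
exists b; first by rewrite bw.
by rewrite mpartial_word; exact: wpartial_perm Cf wk pw.
Qed.

Variable E : normedModType K.
Hypothesis E_complete : cauchy_complete E.
Local Notation X := (@Hoelder_space R F d Omega E k alpha).
Local Notation N := (@Hoelder_norm R F d Omega E k alpha).
Local Notation P := (@Ck_norm R F d Omega E k alpha).

Lemma wpartial_dist (f g : X) w z : (size w <= k)%N ->
  rnorm (wpartial w (val f) z - wpartial w (val g) z) <= P (f - g).
Proof.
move=> wk; have [b bw pw] := word_mi w; have bk : (mi_order b <= k)%N by rewrite bw.
rewrite (wpartial_perm Omega_open (Hoelder_is_Ck f) wk pw).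
rewrite (wpartial_perm Omega_open (Hoelder_is_Ck g) wk pw) -!mpartial_word.
by have := @Ck_norm_ge _ _ _ _ _ _ _ b (f - g) z bk; rewrite mpartial_valB.
Qed.

Lemma Hoelder_ball_complete (u : nat -> X) r : (forall n, N (u n) <= r) ->
  (forall e, 0 < e -> exists m, forall i j, (m <= i)%N -> (m <= j)%N -> P (u i - u j) < e) ->
  exists x, forall e, 0 < e -> exists m, forall i, (m <= i)%N -> P (x - u i) < e.
Proof.
move=> Nu cu.
pose tail (e : R) m := forall i j, (m <= i)%N -> (m <= j)%N -> P (u i - u j) < e.
(* The pair [e], [m] comes from the [P]-Cauchy condition and not from the point, so these pointwise
   limits are uniform. Words longer than [k] get the value 0. *)
have lim (wz : seq 'I_d * Omega) : exists v : E, (size wz.1 <= k)%N ->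
    forall e m, tail e m -> forall i, (m <= i)%N ->
      rnorm (v - wpartial wz.1 (val (u i)) wz.2) <= e.
  case: wz => w z /=; have [wk|nwk] := boolP (size w <= k)%N; last by exists 0.
  pose s n := wpartial w (val (u n)) z.
  have cs : cvg (s @ \oo).
    apply: cauchy_rnorm_cvg => // e e0; have [m Hm] := cu e e0.
    exists [set n | (m <= n)%N]; first by exists m.
    by move=> i j mi mj; apply: le_lt_trans (Hm i j mi mj); exact: wpartial_dist.
  exists (lim (s @ \oo)) => _ e m Hm i mi.
  apply/ler_addgt0Pr => c c0.
  have /cvg_rnormP/(_ c c0)[n _ Hn] := cs.
  rewrite [leRHS]addrC; apply: le_trans (ler_rnorm_distD (s (maxn m n)) _ _) _; apply: lerD.
    by apply/ltW/Hn; exact: leq_maxr.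
  by apply: le_trans (wpartial_dist _ _ _ wk) _; apply/ltW/Hm => //; exact: leq_maxl.
have /choice[g Hg] := lim.
have {}Hg w z : (size w <= k)%N -> forall e m, tail e m -> forall i, (m <= i)%N ->
    rnorm (g (w, z) - wpartial w (val (u i)) z) <= e by exact: (Hg (w, z)).
pose f : Omega -> E := fun z => g ([::], z).
have [|Cf wf] := @Ck_limit _ _ _ _ _ Omega_open k (fun w z => g (w, z)).
  move=> e e0; have [m Hm] := cu e e0.
  exists (val (u m)); first exact: Hoelder_is_Ck.
  by move=> w wk z; rewrite rnorm_distC; exact: (Hg w z wk e m Hm m (leqnn m)).
have bf b z e m i : (mi_order b <= k)%N -> tail e m -> (m <= i)%N ->
    rnorm (mpartial b f z - mpartial b (val (u i)) z) <= e.
  move=> bk Hm mi; have wk : (size (mi_word b) <= k)%N by rewrite size_mi_word.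
  by rewrite !mpartial_word (wf _ wk); exact: (Hg _ _ wk _ _ Hm _ mi).
have [m1 Hm1] := cu 1 ltr01.
have Hf : Hoelder k alpha f.
  split.
    split=> [//|b bk]; apply: (locally_cauchy_extension E_complete) => p clp e e0.
    have e3 : 0 < e / 3 by rewrite divr_gt0.
    have [m Hm] := cu _ e3.
    have [t t0 Ht] := extension_locally_cauchy (extension_val (u m) bk) clp e3.
    exists t => // x y xp yp.
    have := Ht x y xp yp; have := bf b x _ m m bk Hm (leqnn m).
    have := bf b y _ m m bk Hm (leqnn m).
    set fx := mpartial b f x; set fy := mpartial b f y.
    set ux := mpartial b _ x; set uy := mpartial b _ y.
    have := ler_rnorm_distD ux fx fy; have := ler_rnorm_distD uy ux fy.
    rewrite (rnorm_distC uy fy); lra.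
  (* [P (u m1) + 1] bounds the derivatives, within 1 of those of [u m1]; [r] bounds the quotients,
     as limits of quotients of the [u m]. *)
  apply/Hoelder_enorm_ltP; exists (Num.max (P (u m1) + 1) r); split=> [b x bk|b x y bk xy].
    rewrite le_max; apply/orP; left.
    apply: le_trans (rnorm_ge_dist _ (mpartial b (val (u m1)) x)) _.
    by rewrite addrC; apply: lerD; [exact: Ck_norm_ge|exact: (bf _ _ _ _ _ bk Hm1)].
  rewrite le_max; apply/orP; right.
  have xy0 : val x - val y != 0.
    by rewrite subr_eq0; apply/eqP => /val_inj.
  have en0 : 0 < enorm (val x - val y) `^ alpha by rewrite powR_gt0 // enorm_gt0.
  rewrite ler_pdivrMr //; apply/ler_addgt0Pr => e e0.
  have e2 : 0 < e / 2 by rewrite divr_gt0.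
  have [m Hm] := cu _ e2.
  have bk' : (mi_order b <= k)%N by rewrite bk.
  have := le_trans (Hoelder_norm_ge (u m) bk xy) (Nu m); rewrite ler_pdivrMr //.
  have := bf b x _ m m bk' Hm (leqnn m); have := bf b y _ m m bk' Hm (leqnn m).
  set fx := mpartial b f x; set fy := mpartial b f y.
  set ux := mpartial b _ x; set uy := mpartial b _ y.
  have := ler_rnorm_distD ux fx fy; have := ler_rnorm_distD uy ux fy.
  rewrite (rnorm_distC uy fy); lra.
exists (exist _ f (mem_set Hf)) => e e0.
have e2 : 0 < e / 2 by rewrite divr_gt0.
have [m Hm] := cu _ e2; exists m => i mi.
apply: (@le_lt_trans _ _ (e / 2)); last by rewrite ltr_pdivrMr // mulr_natr mulr2n ltrDl.
apply: Ck_norm_le; first exact: ltW.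
by move=> b z bk; rewrite mpartial_valB //; exact: (bf _ _ _ _ _ bk Hm mi).
Qed.

End Completeness.

(** * Lipschitz domains *)

Section DotProduct.
Variables (R : realType) (d : nat).
Implicit Types x y z e : 'rV[R]_d.

Lemma edotDl x y e : edot (x + y) e = edot x e + edot y e.
Proof. by rewrite /edot -big_split; apply: eq_bigr => j _; rewrite mxE mulrDl. Qed.

Lemma edotZl t x e : edot (t *: x) e = t * edot x e.
Proof. by rewrite /edot mulr_sumr; apply: eq_bigr => j _; rewrite mxE mulrA. Qed.

Lemma edotNl x e : edot (- x) e = - edot x e.
Proof. by rewrite -scaleN1r edotZl mulN1r. Qed.

Lemma edot_unit e : enorm e = 1 -> edot e e = 1.
Proof. by move=> e1; rewrite -(sqr_sqrtr (edot_ge0 e)) -/(enorm e) e1 expr1n. Qed.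

Lemma ler_edot x e : enorm e = 1 -> `|edot x e| <= d%:R * `|x|.
Proof.
move=> e1; have e_le1 : `|e| <= 1 by rewrite -e1 ler_norm_enorm.
apply: le_trans (ler_norm_sum _ _ _) _.
apply: (@le_trans _ _ (\sum_(j < d) `|x|)); last by rewrite sumr_const card_ord mulr_natl.
apply: ler_sum => j _; rewrite normrM -[leRHS]mulr1.
by apply: ler_pM => //; [exact: ler_coord|exact: le_trans (ler_coord e j) e_le1].
Qed.

Definition orthogonal_part e x : 'rV[R]_d := x - edot x e *: e.

Lemma orthogonal_partB e x y :
  orthogonal_part e x - orthogonal_part e y = orthogonal_part e (x - y).
Proof.
by rewrite /orthogonal_part edotDl edotNl scalerBl !opprD !opprK addrACA.
Qed.

Lemma orthogonal_partD e x t : enorm e = 1 ->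
  orthogonal_part e (x + t *: e) = orthogonal_part e x.
Proof.
move=> e1; rewrite /orthogonal_part edotDl edotZl edot_unit // mulr1 scalerDl.
by rewrite opprD addrACA subrr addr0.
Qed.

Lemma ler_orthogonal_part e x : enorm e = 1 ->
  enorm (orthogonal_part e x) <= d.+1%:R * (d.+1%:R * `|x|).
Proof.
move=> e1; apply: le_trans (ler_enorm_norm _) _; rewrite ler_wpM2l //.
apply: le_trans (ler_normB _ _) _; rewrite normrZ -natr1 mulrDl mul1r addrC.
apply: lerD => //; have e_le1 : `|e| <= 1 by rewrite -e1 ler_norm_enorm.
rewrite -[leRHS]mulr1; apply: ler_pM => //; exact: ler_edot.
Qed.

End DotProduct.

Section LipschitzDomains.
Variables (R : realType) (F : RorC) (d : nat).
Local Notation K := (scalar_field R F).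
Variables (Omega : set 'rV[R]_d) (E : normedModType K).
Hypothesis Omega_open : open Omega.

(* Near a boundary point, x and y in Omega are joined inside Omega by going up
   along e, across, and down again; the height |x - y| times a constant suffices
   because the graph below is Lipschitz. *)
Lemma lipschitz_boundary_bound (p : 'rV[R]_d) : lipschitz_boundary Omega ->
  closure Omega p -> exists2 r : R, 0 < r & exists2 C : R, 0 <= C &
    forall (g : Omega -> E) (M : R), 0 <= M -> (forall j, differentiable_along j g) ->
      (forall j z, rnorm (partial j g z) <= M) ->
      forall x y : Omega, `|val x - p| < r -> `|val y - p| < r ->
        rnorm (g x - g y) <= C * M * `|val x - val y|.
Proof.
move=> lip clp; have [Op|nOp] := pselect (Omega p).
  have [r r0 Hr] := domain_ball Omega_open Op.
  exists r => //; exists d%:R => // g M _ dg HM x y xp yp.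
  by have := cube_lipschitz Hr dg HM yp xp; rewrite !zero_extensionE mulrA.
have [|U [e [phi [L [[oU Up] e1 Lphi HU]]]]] := lip p.
  by split=> // /interior_subset.
have [s s0 Hs] := domain_ball oU Up.
pose D : R := d.+1%:R; have D0 : 0 <= D by [].
(* [c1] is a Lipschitz constant, for the maximum norm, of [phi] after the projection; [c2] adds the
   variation of the height along [e]. The radius solves [r + c2 * (r + r) = s], so points within [r]
   of [p] remain in [U] after being raised by [h]. *)
pose c1 := `|L| * (D * D); have c10 : 0 <= c1 by rewrite !mulr_ge0.
pose c2 := c1 + D; have c20 : 0 <= c2 by rewrite addr_ge0.
pose r := s / (1 + c2 *+ 2).
have q0 : 0 < 1 + c2 *+ 2 by rewrite ltr_wpDr // mulrn_wge0.
have r0 : 0 < r by rewrite divr_gt0.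
have rs : r + c2 * (r + r) = s.
  have : r * (1 + c2 *+ 2) = s by rewrite /r divfK // gt_eqF.
  by move=> <-; rewrite mulr2n; ring.
have e_le1 : `|e| <= 1 by rewrite -e1 ler_norm_enorm.
have dD : d%:R <= D by rewrite ler_nat.
exists r => //; exists (d%:R * (c2 *+ 2 + 1)).
  by rewrite mulr_ge0 // addr_ge0 // mulrn_wge0.
move=> g M M0 dg HM x y xp yp.
pose n := `|val x - val y|.
have n0 : 0 <= n by exact: normr_ge0.
have nr : n < r + r.
  by rewrite /n -(subrKA p); apply: le_lt_trans (ler_normD _ _) _; rewrite [X in _ + X]distrC ltrD.
pose h := c2 * n.
have h0 : 0 <= h by rewrite mulr_ge0.
have hs : r + h <= s by rewrite -rs lerD2l ler_wpM2l // ltW.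
have phiL u v : `|phi (orthogonal_part e u) - phi (orthogonal_part e v)| <= c1 * `|u - v|.
  apply: le_trans (Lphi _ _) _; rewrite orthogonal_partB.
  apply: (@le_trans _ _ (`|L| * enorm (orthogonal_part e (u - v)))).
    by rewrite ler_wpM2r ?enorm_ge0 // ler_norm.
  by rewrite /c1 -!mulrA ler_wpM2l // ler_orthogonal_part.
have up u t : `|u - p| < r -> Omega u -> 0 <= t <= h -> Omega (u + t *: e).
  move=> ur Ou /andP[t0 th].
  have Uu : U u by apply: Hs; apply: lt_le_trans ur _; apply: le_trans hs; rewrite lerDl.
  apply/HU.
    apply: Hs; rewrite addrAC; apply: le_lt_trans (ler_normD _ _) _.
    apply: lt_le_trans hs; apply: ltr_leD => //.
    rewrite normrZ ger0_norm //; apply: le_trans th.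
    by rewrite -[leRHS]mulr1 ler_wpM2l.
  rewrite -/(orthogonal_part e _) orthogonal_partD // edotDl edotZl edot_unit // mulr1.
  by apply: lt_le_trans ((HU _ Uu).1 Ou) _; rewrite lerDl.
(* On the way from [val x], the graph rises by at most [c1 * n] and the height drops by at most
   [D * n]; the lift [h = (c1 + D) * n] compensates both. *)
have across t : 0 <= t <= 1 ->
    Omega (val x + h *: e + t *: (val y + h *: e - (val x + h *: e))).
  move=> /andP[t0 t1].
  have -> : val x + h *: e + t *: (val y + h *: e - (val x + h *: e)) =
      (val x + t *: (val y - val x)) + h *: e.
    by rewrite opprD addrACA subrr addr0 addrAC.
  set u := val x + t *: (val y - val x).
  have ux : `|u - val x| <= n.
    rewrite /u addrC addKr normrZ ger0_norm // /n distrC.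
    by rewrite -[leRHS]mul1r ler_wpM2r.
  have up' : `|u - p| < r.
    have -> : u - p = (1 - t) *: (val x - p) + t *: (val y - p).
      rewrite scalerBl scale1r -[RHS]addrA [- _ + _]addrC -scalerBr.
      by rewrite opprB addrA subrK /u addrAC.
    apply: le_lt_trans (ler_normD _ _) _; rewrite !normrZ.
    rewrite !ger0_norm ?subr_ge0 //.
    have a0 : 0 < r - `|val x - p| by rewrite subr_gt0.
    have b0 : 0 < r - `|val y - p| by rewrite subr_gt0.
    have t01 : 0 <= t <= 1 by rewrite t0.
    have := convex_gt0 a0 b0 t01; lra.
  apply/HU.
    apply: Hs; rewrite addrAC; apply: le_lt_trans (ler_normD _ _) _.
    apply: lt_le_trans hs; apply: ltr_leD => //.
    by rewrite normrZ ger0_norm // -[leRHS]mulr1 ler_wpM2l.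
  rewrite -/(orthogonal_part e _) orthogonal_partD // edotDl edotZl edot_unit // mulr1.
  have Ux : U (val x) by apply: Hs; apply: lt_le_trans xp _; apply: le_trans hs; rewrite lerDl.
  have := (HU _ Ux).1 (domainP x); rewrite -/(orthogonal_part e _).
  have := phiL u (val x).
  have := ler_edot (u - val x) e1; rewrite edotDl edotNl.
  have h1 : c1 * `|u - val x| <= c1 * n by rewrite ler_wpM2l.
  have h2 : d%:R * `|u - val x| <= D * n by apply: ler_pM.
  rewrite !ler_norml /h /c2 mulrDl => /andP[a1 a2] /andP[b1 b2] c.
  lra.
have vertical u : `|val u - p| < r ->
    rnorm (zero_extension g (val u + h *: e) - g u) <= d%:R * (M * h).
  move=> ur; rewrite -(zero_extensionE g u).
  have hE : val u + h *: e - val u = h *: e by rewrite addrC addKr.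
  apply: le_trans (segment_lipschitz Omega_open dg HM _) _.
    move=> t /andP[t0 t1]; rewrite hE scalerA; apply: up => //; first exact: domainP.
    by rewrite mulr_ge0 //= -[leRHS]mul1r ler_wpM2r.
  rewrite ler_wpM2l // ler_wpM2l // hE normrZ ger0_norm //.
  by rewrite -[leRHS]mulr1 ler_wpM2l.
have hor := segment_lipschitz Omega_open dg HM across.
have := vertical x xp; have := vertical y yp; move: hor.
have -> : `|val y + h *: e - (val x + h *: e)| = n.
  by rewrite opprD addrACA subrr addr0 distrC.
set gx := zero_extension g (val x + _); set gy := zero_extension g (val y + _) => hor.
have := ler_rnorm_distD gx (g x) (g y); have := ler_rnorm_distD gy gx (g y).
rewrite (rnorm_distC (g x) gx) -/n.
have -> : d%:R * (c2 *+ 2 + 1) * M * n = d%:R * (M * h) + d%:R * (M * n) + d%:R * (M * h).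
  by rewrite /h mulr2n; ring.
move: hor; rewrite (rnorm_distC gx gy); lra.
Qed.

End LipschitzDomains.

(** * Equicontinuity up to the boundary *)

Section Equicontinuity.
Variables (R : realType) (F : RorC) (d : nat).
Local Notation K := (scalar_field R F).
Variables (Omega : set 'rV[R]_d) (E : normedModType K) (k : nat) (alpha : R).
Hypotheses (Omega_open : open Omega) (alpha_gt0 : 0 < alpha).
Hypothesis lip : (1 <= k)%N -> lipschitz_boundary Omega.

(** Formulated for bare functions, because it is also used for weakly Hoelder functions before their
    membership in the space is established. *)
Definition Hoelder_bounded (M : R) (f : Omega -> E) :=
  (forall b x, (mi_order b <= k)%N -> rnorm (mpartial b f x) <= M) /\
  forall b x y, mi_order b = k -> x <> y ->
    rnorm (mpartial b f x - mpartial b f y) / enorm (val x - val y) `^ alpha <= M.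

Lemma mpartial_lower (f : Omega -> E) b j : is_Ck k f -> (mi_order b < k)%N ->
  differentiable_along j (mpartial b f) /\
  exists2 b', (mi_order b' <= k)%N & partial j (mpartial b f) = mpartial b' f.
Proof.
move=> Cf bk; rewrite mpartial_word.
have wk : (size (j :: mi_word b) <= k)%N by rewrite /= size_mi_word.
split; last exact: (wpartial_mpartial Omega_open Cf wk).
have := is_Ck_wpartial (ltnW wk) Cf.
by rewrite -(subnSK wk) => /is_Ck_differentiable.
Qed.

(** Derivatives of order [k] are controlled by the Hoelder quotient. Those of lower order have
    bounded partial derivatives, so the Lipschitz bound near [p] applies; this is where the boundary
    matters when [k >= 1]. *)
Lemma equicontinuity p (e : R) : closure Omega p -> 0 < e ->
  exists2 r : R, 0 < r & forall (f : Omega -> E) M, 0 <= M -> is_Ck k f ->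
    Hoelder_bounded M f -> forall b (x y : Omega), (mi_order b <= k)%N ->
    `|val x - p| < r -> `|val y - p| < r ->
    rnorm (mpartial b f x - mpartial b f y) <= e * M.
Proof.
move=> clp e0; pose D : R := d.+1%:R; have D0 : 0 < D by [].
have [r1 r10 Hr1] : exists2 r : R, 0 < r & forall (f : Omega -> E) M, 0 <= M -> is_Ck k f ->
    Hoelder_bounded M f -> forall b (x y : Omega), (mi_order b < k)%N ->
    `|val x - p| < r -> `|val y - p| < r ->
    rnorm (mpartial b f x - mpartial b f y) <= e * M.
  have [k0|k0] := posnP k.
    by exists 1 => // f M _ _ _ b x y; rewrite k0.
  have [r r0 [C C0 HC]] := lipschitz_boundary_bound E Omega_open (lip k0) clp.
  exists (Num.min r (e / (C + 1) / 2)).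
    by rewrite lt_min r0 !divr_gt0 // ltr_wpDl.
  move=> f M M0 Cf [HM _] b x y bk; rewrite !lt_min => /andP[xr xs] /andP[yr ys].
  have := HC (mpartial b f) M M0 _ _ x y xr yr.
  move=> /(_ (fun j => (mpartial_lower j Cf bk).1)) H.
  apply: le_trans (H _) _.
    by move=> j z; have [_ [b' b'k ->]] := mpartial_lower j Cf bk; exact: HM.
  rewrite mulrAC ler_wpM2r //.
  have : `|val x - val y| < e / (C + 1).
    rewrite (splitr (e / _)) -(subrKA p); apply: le_lt_trans (ler_normD _ _) _.
    by rewrite [X in _ + X]distrC ltrD.
  rewrite ltr_pdivlMr ?ltr_wpDl // mulrC => /ltW; apply: le_trans.
  by rewrite ler_wpM2r // lerDl.
(* Points within [s] of [p] are at Euclidean distance at most [e ^ (1 / alpha)]: [D] pays for the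
   change of norm, 2 for the passage through [p]. *)
pose s := e `^ alpha^-1 / D / 2.
have ea : 0 < e `^ alpha^-1 by rewrite powR_gt0.
have s0 : 0 < s by rewrite !divr_gt0.
exists (Num.min r1 s); first by rewrite lt_min r10.
move=> f M M0 Cf Hf b x y; rewrite leq_eqVlt !lt_min => /predU1P[bk|bk] /andP[xr xs] /andP[yr ys];
  last exact: (Hr1 f M M0 Cf Hf b x y bk xr yr).
have [xy|xy] := pselect (x = y); first by rewrite xy subrr rnorm0 mulr_ge0 // ltW.
have xy0 : val x - val y != 0 by rewrite subr_eq0; apply/eqP => /val_inj.
have := Hf.2 b x y bk xy; rewrite ler_pdivrMr ?powR_gt0 ?enorm_gt0 // mulrC.
move/le_trans; apply; rewrite ler_wpM2r //.
have -> : e = (e `^ alpha^-1) `^ alpha.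
  by rewrite -powRrM mulVf ?gt_eqF // powRr1 // ltW.
apply: ge0_ler_powR; rewrite ?nnegrE ?enorm_ge0 ?(ltW ea) ?(ltW alpha_gt0) //.
apply: le_trans (ler_enorm_norm _) _.
have : `|val x - val y| < e `^ alpha^-1 / D.
  rewrite (splitr (_ / D)) -(subrKA p); apply: le_lt_trans (ler_normD _ _) _.
  by rewrite [X in _ + X]distrC ltrD.
by rewrite ltr_pdivlMr // mulrC => /ltW.
Qed.

End Equicontinuity.

Section UltraCauchy.
Variable R : realType.

(** The image has a cluster point in a compact interval, and an ultrafilter contains the preimage of
    each ball around it or the complement; the complement is incompatible with clustering. *)
Lemma ultra_cauchy_real (T : Type) (H : set_system T) (phi : T -> R) r :
  UltraFilter H -> H [set t | `|phi t| <= r] -> forall e, 0 < e ->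
  exists2 A, H A & forall s t, A s -> A t -> `|phi s - phi t| < e.
Proof.
move=> UH Hr e e0; have e2 : 0 < e / 2 by rewrite divr_gt0.
have [|l [_ lcl]] := @segment_compact R (- r) r (phi @ H) _.
  change (H (phi @^-1` `[- r, r]%classic)).
  by apply: (filterS _ Hr) => t /=; rewrite in_itv /= ler_norml.
exists [set t | `|l - phi t| < e / 2]; last first.
  move=> s t /= ls lt; rewrite -(subrKA l) [e]splitr; apply: le_lt_trans (ler_normD _ _) _.
  by rewrite distrC; exact: ltrD.
have [//|nH] := in_ultra_setVsetC [set t | `|l - phi t| < e / 2] UH.
have nl : nbhs l [set v | `|l - v| < e / 2].
  by apply/nbhs_ballP; exists (e / 2) => //= v; rewrite -ball_normE.
have pH : (phi @ H) (phi @` (~` [set t | `|l - phi t| < e / 2])).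
  change (H (phi @^-1` (phi @` (~` [set t | `|l - phi t| < e / 2])))).
  by apply: (filterS _ nH) => t nt; exists t.
by have [_ [[t nt <-] lt]] := lcl _ _ pH nl.
Qed.

Lemma ultra_cauchy_scalar (F : RorC) (T : Type) (H : set_system T)
    (phi : T -> scalar_field R F) r :
  UltraFilter H -> H [set t | rabs (phi t) <= r] -> forall e, 0 < e ->
  exists2 A, H A & forall s t, A s -> A t -> rabs (phi s - phi t) < e.
Proof.
case: F phi => phi UH Hr e e0; first exact: ultra_cauchy_real UH Hr e e0.
have e2 : 0 < e / 2 by rewrite divr_gt0.
have normC (z : R[i]) : `|complex.Re z| <= rabs (z : scalar_field R ComplexScalars) /\
    `|complex.Im z| <= rabs (z : scalar_field R ComplexScalars).
  split; first exact: (@ler_real_part R ComplexScalars z).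
  case: z => a b; rewrite /rabs /=.
  by rewrite -sqrtr_sqr ler_wsqrtr // lerDr sqr_ge0.
have [|A HA dA] := @ultra_cauchy_real T H (fun t => complex.Re (phi t)) r UH _ _ e2.
  by apply: filterS Hr => t; apply: le_trans; case: (normC (phi t)).
have [|B HB dB] := @ultra_cauchy_real T H (fun t => complex.Im (phi t)) r UH _ _ e2.
  by apply: filterS Hr => t; apply: le_trans; case: (normC (phi t)).
exists (A `&` B); first exact: filterI.
move=> s t [As Bs] [At Bt]; have := dA s t As At; have := dB s t Bs Bt.
case: (phi s) (phi t) => [a b] [a' b'] /= h1 h2.
apply: le_lt_trans (ler_rabs_complex (a - a') (b - b')) _.
by rewrite [e]splitr addrC; exact: ltrD.
Qed.

End UltraCauchy.

Section BallCompactness.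
Variables (R : realType) (F : RorC) (d : nat).
Local Notation K := (scalar_field R F).
Variables (Omega : set 'rV[R]_d) (k : nat) (alpha : R).
Hypotheses (Omega_open : open Omega) (Omega_bounded : bounded_set Omega).
Hypotheses (alpha_gt0 : 0 < alpha) (lip : (1 <= k)%N -> lipschitz_boundary Omega).
Local Notation X := (@Hoelder_space R F d Omega K^o k alpha).
Local Notation N := (@Hoelder_norm R F d Omega K^o k alpha).
Local Notation P := (@Ck_norm R F d Omega K^o k alpha).

Lemma closure_compact : compact (closure Omega).
Proof.
apply: bounded_closed_compact; last exact: closed_closure.
have [M [Mreal HM]] := Omega_bounded.
exists (M + 2); split; first exact: num_real.
move=> r Mr p /= clp; have [x xp] := closure_domain clp ltr01.
have M1 : M < M + 1 by rewrite ltrDl.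
have hx : `|val x| <= M + 1 by exact: HM _ M1 (val x) (domainP x).
have : `|p| <= `|val x| + `|val x - p|.
  by rewrite -[X in `|X| <= _](subrKC (val x)) distrC ler_normD.
lra.
Qed.

(** Arzela-Ascoli with ultrafilters: finitely many balls of equicontinuity cover the closure, each
    gets a sample point, and the ultrafilter is Cauchy at the finitely many sampled derivatives.
    Three errors of [e / 4] remain below [e]. *)
Lemma Hoelder_ball_ultra_cauchy (H : set_system X) r : UltraFilter H ->
  H [set f | N f <= r] ->
  forall e, 0 < e -> exists2 A, H A & forall f g, A f -> A g -> P (f - g) < e.
Proof.
move=> UH Hr e e0.
pose M := `|r| + 1; have M0 : 0 < M by rewrite ltr_wpDl.
have e4 : 0 < e / 4 by rewrite divr_gt0.
have /choice[rho Hrho] : forall p, exists t : R, 0 < t /\ (closure Omega p ->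
   forall (f : Omega -> K^o), is_Ck k f -> Hoelder_bounded k alpha M f ->
     forall b (x y : Omega), (mi_order b <= k)%N ->
     `|val x - p| < t -> `|val y - p| < t ->
      rnorm (mpartial b f x - mpartial b f y) <= e / 4).
  move=> p; have [clp|nclp] := pselect (closure Omega p); last by exists 1.
  have [t t0 Ht] := @equicontinuity _ F _ _ K^o _ _ Omega_open alpha_gt0 lip p _ clp
    (divr_gt0 e4 M0).
  exists t; split=> // _ f Cf Hf b x y bk xp yp.
  by have := Ht f M (ltW M0) Cf Hf b x y bk xp yp; rewrite divfK // gt_eqF.
(* Samples are taken in Omega, where the derivatives live, and are optional since the choice runs
   over all [p], including those outside the closure. *)
have /choice[c Hc] : forall p, exists x : option Omega, closure Omega p ->
    exists2 y, x = Some y & `|val y - p| < rho p.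
  move=> p; have [clp|nclp] := pselect (closure Omega p); last by exists None.
  have [x xp] := closure_domain clp (Hrho p).1.
  by exists (Some x) => _; exists x.
have := closure_compact; rewrite compact_cover => /(_ _ (closure Omega) (fun p => (ball p
  (rho p))^°)).
case=> [p _|p clp|D' D'cl cov].
- exact: open_interior.
- by exists p => //; apply: nbhsx_ballx; case: (Hrho p).
(* A finite type that covers all multi-indices of order at most [k], so that the filter can be
   intersected over it. *)
pose mi (b : {ffun 'I_d -> 'I_k.+1}) : multi_index d := [ffun j => nat_of_ord (b j)].
have miP b : (mi_order b <= k)%N -> exists b', b = mi b'.
  move=> bk; have bj j : (b j < k.+1)%N.
    by rewrite ltnS (leq_trans _ bk) // /mi_order (bigD1 j) //= leq_addr.
  by exists [ffun j => inord (b j)]; apply/ffunP => j; rewrite !ffunE inordK.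
pose G p b' : set X -> Prop := fun A => forall f g x, A f -> A g -> c p = Some x ->
   (mi_order (mi b') <= k)%N ->
   rnorm (mpartial (mi b') (val f) x - mpartial (mi b') (val g) x) < e / 4.
have /choice[S HS] : forall pb : 'rV[R]_d * {ffun 'I_d -> 'I_k.+1}, exists A, H A /\ G pb.1 pb.2 A.
  move=> [p b] /=; case cp : (c p) => [x|]; last first.
    by exists setT; split; [exact: filterT|move=> f g x; rewrite cp].
  have [bk|nbk] := boolP (mi_order (mi b) <= k)%N; last first.
    by exists setT; split; [exact: filterT|move=> f g y _ _ _ bk; rewrite bk in nbk].
  have [|A HA dA] := @ultra_cauchy_scalar R F X H (fun f => mpartial (mi b) (val f) x) r UH _ _ e4.
    apply: filterS Hr => f /=; apply: le_trans; apply: le_trans (Ck_norm_le_Hoelder f).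
    exact: (@Ck_norm_ge _ _ _ _ _ _ _ (mi b) f x bk).
  exists A; split=> // f g y Af Ag; rewrite cp => -[<-] _; exact: dA.
have HA1 : H [set f | forall p, p \in D' -> forall b, S (p, b) f].
  have h : H (\bigcap_(p in [set` D']) [set f | forall b, S (p, b) f]).
    apply: filter_bigI => p _.
    by apply: (filter_forall (f := fun b f => S (p, b) f)) => b; case: (HS (p, b)).
  by apply: filterS h => f Hf p pD; exact: Hf.
exists ([set f | N f <= r] `&` [set f | forall p, p \in D' -> forall b, S (p, b) f]).
  exact: filterI.
have bnd (f : X) : N f <= r -> Hoelder_bounded k alpha M (val f).
  move=> fr; have fM : N f <= M by apply: le_trans fr _; rewrite (le_trans (ler_norm r)) // lerDl.
  split=> [b x bk|b x y bk xy].
    by apply: le_trans (Ck_norm_ge f x bk) _; apply: le_trans (Ck_norm_le_Hoelder f) fM.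
  exact: le_trans (Hoelder_norm_ge f bk xy) fM.
move=> f g [/= fr fS] [/= gr gS].
apply: (@le_lt_trans _ _ (e / 4 + e / 4 + e / 4)); last lra.
apply: Ck_norm_le; first by rewrite !addr_ge0 // ltW.
move=> b z bk; rewrite mpartial_valB //.
have clz : closure Omega (val z) by apply: subset_closure; exact: domainP.
have [p pD /interior_subset zp] := cov (val z) clz.
have clp : closure Omega p by apply/set_mem/D'cl.
have {}zp : `|val z - p| < rho p by rewrite distrC; rewrite -ball_normE in zp.
have [x cx xp] := Hc p clp.
have [b' be] := miP b bk; rewrite be in bk *.
have h1 := (Hrho p).2 clp _ (Hoelder_is_Ck f) (bnd f fr) (mi b') z x bk zp xp.
have h2 := (Hrho p).2 clp _ (Hoelder_is_Ck g) (bnd g gr) (mi b') x z bk xp zp.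
have [_ /(_ f g x (fS p pD b') (gS p pD b') cx bk) h3] := HS (p, b').
apply: le_trans (ler_rnorm_distD (mpartial (mi b') (val f) x)
  (mpartial (mi b') (val f) z) (mpartial (mi b') (val g) z)) _.
rewrite -addrA; apply: lerD => //.
apply: le_trans (ler_rnorm_distD (mpartial (mi b') (val g) x) _ _) _.
by apply: lerD => //; exact: ltW.
Qed.

End BallCompactness.

(** * Weakly Hoelder functions *)

Section WeakHoelder.
Variables (R : realType) (F : RorC) (d : nat).
Local Notation K := (scalar_field R F).
Variables (Omega : set 'rV[R]_d) (E : normedModType K) (alpha : R).
Hypothesis E_complete : cauchy_complete E.
Hypotheses (Omega_open : open Omega) (alpha_gt0 : 0 < alpha) (alpha_le1 : alpha <= 1).
Local Notation "e ∘ f" := ((e : E -> K^o) \o f : Omega -> K^o) (at level 50).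
Implicit Types (f : Omega -> E) (g : Omega -> K^o) (e : {linear E -> K^o}).

Lemma Hoelder_comp k f e : continuous e -> Hoelder k alpha f -> Hoelder k alpha (e ∘ f).
Proof.
move=> ce [[Cf ef] /Hoelder_enorm_ltP[M [HM HM']]].
have mE b : (mi_order b <= k)%N -> mpartial b (e ∘ f) = e ∘ (mpartial b f).
  by move=> bk; rewrite !mpartial_word (wpartial_comp ce Cf) // size_mi_word.
have [C HC] := continuous_functional_bounded ce.
have HC' v : rnorm (e v : K^o) <= `|C| * rnorm v.
  rewrite -rabs_regular; apply: le_trans (HC v) _.
  by rewrite ler_wpM2r ?rnorm_ge0 // ler_norm.
split.
  split=> [|b bk]; first exact: is_Ck_comp.
  have [h /is_extensionP[eh ch]] := ef b bk; exists ((e : E -> K^o) \o h).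
  rewrite mE //; apply/is_extensionP; split=> [x|p clp c c0]; first by rewrite /= eh.
  have C0 : 0 < `|C| + 1 by rewrite ltr_wpDl.
  have [r r0 Hr] := ch p clp _ (divr_gt0 c0 C0); exists r => // q clq qp.
  rewrite (_ : _ - _ = e (h p - h q) :> K^o); last by rewrite (raddfB e).
  have := Hr q clq qp; rewrite ltr_pdivlMr // mulrC; apply: le_lt_trans.
  by apply: le_trans (HC' _) _; rewrite ler_wpM2r ?rnorm_ge0 // lerDl.
apply/Hoelder_enorm_ltP; exists (`|C| * M); split=> [b x bk|b x y bk xy].
  by rewrite mE //; apply: le_trans (HC' _) _; rewrite ler_wpM2l // HM.
rewrite mE ?bk //=.
rewrite (_ : _ - _ = e (mpartial b f x - mpartial b f y) :> K^o); last by rewrite (raddfB e).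
apply: (@le_trans _ _ (`|C| * rnorm (mpartial b f x - mpartial b f y) /
    enorm (val x - val y) `^ alpha)).
  by rewrite ler_wpM2r ?invr_ge0 ?powR_ge0.
by rewrite -mulrA ler_wpM2l // HM'.
Qed.

(** Restricting to balls inside Omega keeps the boundary out. Radii at most 1/2 keep distances at
    most 1, where t <= t^alpha turns Lipschitz bounds into Hoelder bounds. *)
Definition locally_Hoelder g := forall (x : Omega) r, r <= 2^-1 ->
  (forall y, `|y - val x| < r -> Omega y) -> exists C, forall y z : Omega,
  `|val y - val x| < r -> `|val z - val x| < r ->
  rnorm (g y - g z) <= C * `|val y - val z| `^ alpha.

(** The recursion follows [is_Ck], so that regularity in norm can be recovered one derivative at a
    time. *)
Fixpoint locally_CkHoelder k g : Prop := locally_Hoelder g /\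
  if k is k'.+1 then
    forall j, differentiable_along j g /\ locally_CkHoelder k' (partial j g)
  else True.

Lemma Hoelder_locally k g : Hoelder k alpha g -> locally_CkHoelder k g.
Proof.
move=> [[Cg _] /Hoelder_enorm_ltP[M [HM HM']]].
suff H m w : (size w + m)%N = k -> locally_CkHoelder m (wpartial w g) by exact: (H k [::]).
have LH v : (size v <= k)%N -> locally_Hoelder (wpartial v g).
  move=> vk x r r2 xr.
  have [b bv pv] := word_mi v.
  rewrite (wpartial_perm Omega_open Cg vk pv) -mpartial_word.
  have D0 : 0 < d.+1%:R :> R by [].
  move: vk; rewrite -bv leq_eqVlt => /predU1P[bk|bk].
    exists (`|M| * d.+1%:R `^ alpha) => y z _ _.
    have [yz|yz] := pselect (y = z).
      by rewrite yz !subrr rnorm0 mulr_ge0 ?powR_ge0 // mulr_ge0 ?powR_ge0.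
    have yz0 : val y - val z != 0 by rewrite subr_eq0; apply/eqP => /val_inj.
    have := HM' b y z bk yz; rewrite ler_pdivrMr ?powR_gt0 ?enorm_gt0 //.
    move/le_trans; apply; rewrite -mulrA -powRM //.
    apply: (le_trans (ler_wpM2r (powR_ge0 _ _) (ler_norm M))); rewrite ler_wpM2l //.
    by apply: ge0_ler_powR; rewrite ?nnegrE ?enorm_ge0 ?(ltW alpha_gt0) ?mulr_ge0 ?ler_enorm_norm.
  exists (d%:R * `|M|) => y z yr zr.
  have r0 : 0 < r by apply: le_lt_trans yr.
  have bM j v' : rnorm (partial j (mpartial b g) v') <= `|M|.
    have [_ [b' b'k ->]] := mpartial_lower Omega_open j Cg bk.
    by apply: le_trans (ler_norm M); exact: HM.
  have := cube_lipschitz xr (fun j => (mpartial_lower Omega_open j Cg bk).1) bM zr yr.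
  rewrite !zero_extensionE => h; apply: le_trans h _; rewrite mulrA ler_wpM2l ?mulr_ge0 //.
  have t1 : `|val y - val z| <= 1.
    rewrite -(subrKA (val x)); apply: le_trans (ler_normD _ _) _.
    by rewrite [X in _ + X]distrC; lra.
  have [->|t0] := eqVneq `|val y - val z| 0; first by rewrite powR_ge0.
  rewrite -[leLHS]powRr1 //; apply: ger_powR => //.
  by rewrite t1 andbT lt_neqAle eq_sym t0 normr_ge0.
elim: m w => [|m IH] w wm; first by split=> //; apply: LH; rewrite -wm addn0.
split; first by apply: LH; rewrite -wm leq_addr.
move=> j; split.
  have := is_Ck_wpartial (w := w) _ Cg; rewrite -wm leq_addr addKn => /(_ isT).
  exact: is_Ck_differentiable.
by apply: (IH (j :: w)); rewrite /= addSnnS.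
Qed.

(** The normalized differences over one ball form a weakly bounded set, hence a bounded one: the
    constant becomes independent of the functional. *)
Lemma weakly_Hoelder (f : Omega -> E) : (forall e, continuous e -> locally_Hoelder (e ∘ f)) ->
  forall (x : Omega) r, r <= 2^-1 -> (forall y, `|y - val x| < r -> Omega y) ->
  exists2 C, 0 <= C & forall y z : Omega, `|val y - val x| < r -> `|val z - val x| < r ->
    rnorm (f y - f z) <= C * `|val y - val z| `^ alpha.
Proof.
move=> Hf x r r2 xr.
pose A := [set v : E | exists y z : Omega, [/\ `|val y - val x| < r, `|val z - val x| < r, y <> z &
  v = real_scalar F (`|val y - val z| `^ alpha)^-1 *: (f y - f z)]].
have [e ce|M HM] := @weakly_bounded R F E A.
  have [C HC] := Hf e ce x r r2 xr; exists `|C| => _ [y [z [yr zr yz ->]]].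
  have yz0 : 0 < `|val y - val z| `^ alpha.
    by rewrite powR_gt0 // normr_gt0 subr_eq0; apply/eqP => /val_inj.
  rewrite linearZ /= rabsM rabs_real_scalar (raddfB e) rabs_regular.
  rewrite ger0_norm ?invr_ge0 ?(ltW yz0) // ler_pdivrMl // mulrC.
  by apply: le_trans (HC y z yr zr) _; rewrite ler_wpM2r ?(ltW yz0) // ler_norm.
exists `|M| => // y z yr zr.
have [yz|yz] := pselect (y = z).
  by rewrite yz !subrr rnorm0 mulr_ge0 ?powR_ge0.
have yz0 : 0 < `|val y - val z| `^ alpha.
  by rewrite powR_gt0 // normr_gt0 subr_eq0; apply/eqP => /val_inj.
have := HM _ (ex_intro _ y (ex_intro _ z (And4 yr zr yz erefl))).
rewrite rnormZr ger0_norm ?invr_ge0 ?(ltW yz0) // ler_pdivrMl // mulrC => h.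
by apply: le_trans h _; rewrite ler_wpM2r ?(ltW yz0) // ler_norm.
Qed.

Lemma small_ball (x : Omega) : exists r : R, [/\ 0 < r, r <= 2^-1 &
  forall y, `|y - val x| < r -> Omega y].
Proof.
have [r r0 Hr] := domain_ball Omega_open (domainP x).
exists (Num.min r 2^-1); split.
    by rewrite lt_min r0 /= invr_gt0 ltr0n.
  by rewrite ge_min lexx orbT.
by move=> y; rewrite lt_min => /andP[/Hr].
Qed.

Lemma powR_small (C e : R) : 0 <= C -> 0 < e ->
  exists2 s : R, 0 < s & forall t, 0 <= t < s -> C * t `^ alpha <= e.
Proof.
move=> C0 e0; have C1 : 0 < C + 1 by rewrite ltr_wpDl.
have eC : 0 < e / (C + 1) by rewrite divr_gt0.
exists ((e / (C + 1)) `^ alpha^-1); first by rewrite powR_gt0.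
move=> t /andP[t0 ts]; apply: (@le_trans _ _ ((C + 1) * (e / (C + 1)))); last first.
  by rewrite mulrC divfK // gt_eqF.
apply: ler_pM => //; rewrite ?powR_ge0 ?lerDl //.
have -> : e / (C + 1) = ((e / (C + 1)) `^ alpha^-1) `^ alpha.
  by rewrite -powRrM mulVf ?gt_eqF // powRr1 // ltW.
by apply: ge0_ler_powR; rewrite ?nnegrE ?powR_ge0 ?(ltW alpha_gt0) ?(ltW ts).
Qed.

Lemma weakly_Hoelder_continuous f : (forall e, continuous e -> locally_Hoelder (e ∘ f)) ->
  continuous f.
Proof.
move=> Hf; apply/continuous_domainP => x c c0.
have [r [r0 r2 xr]] := small_ball x.
have [C C0 HC] := weakly_Hoelder Hf r2 xr.
have [s s0 Hs] := powR_small C0 (divr_gt0 c0 (ltr0n _ 2)).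
exists (Num.min r s); first by rewrite lt_min r0.
move=> y; rewrite lt_min => /andP[yr ys].
rewrite rnorm_distC; apply: le_lt_trans (HC y x yr _) _; first by rewrite subrr normr0.
apply: (@le_lt_trans _ _ (c / 2)); first by apply: Hs; rewrite normr_ge0.
by rewrite ltr_pdivrMr // mulr_natr mulr2n ltrDl.
Qed.

(* The difference quotients form a Cauchy filter: tested with a functional e,
   they differ from a derivative of e o f by O(|h|^alpha). *)
Lemma weakly_Hoelder_differentiable j f :
  (forall e, continuous e -> differentiable_along j (e ∘ f) /\
    locally_Hoelder (partial j (e ∘ f))) -> differentiable_along j f.
Proof.
move=> Hf x; have [r [r0 r2 xr]] := small_ball x.
pose D h := diff_quotient j f x h.
(* The weight by which the difference of two quotients is divided: after a functional, each quotient
   is within a multiple of its own summand from the derivative. *)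
pose w (h h' : R) := `|h| `^ alpha + `|h'| `^ alpha.
have w0 h h' : h != 0 -> 0 < w h h'.
  by move=> h0; rewrite ltr_wpDr ?powR_ge0 // powR_gt0 // normr_gt0.
pose A := [set v : E | exists h h' : R, [/\ h != 0, h' != 0, `|h| < r, `|h'| < r &
  v = real_scalar F (w h h')^-1 *: (D h - D h')]].
have [e ce|M HM] := @weakly_bounded R F E A.
  have [de LH] := Hf e ce; have [C HC] := LH x r r2 xr.
  pose v : K^o := partial j (e ∘ f) x.
  have quot h : h != 0 -> `|h| < r -> rnorm ((e (D h) : K^o) - v) <= `|C| * `|h| `^ alpha.
    move=> h0 hr.
    have dist s : 0 <= s <= 1 -> `|val x + (s * h) *: delta_mx 0 j - val x| <= `|h|.
      move=> /andP[s0 s1]; rewrite addrC addKr normrZ rV_norm_delta mulr1 normrM.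
      by rewrite ger0_norm // ler_piMl.
    have seg s : 0 <= s <= 1 -> Omega (val x + (s * h) *: delta_mx 0 j).
      by move=> s01; apply: xr; apply: le_lt_trans (dist s s01) hr.
    have bound s : 0 <= s <= 1 -> rnorm (zero_extension (partial j (e ∘ f))
        (val x + (s * h) *: delta_mx 0 j) - v) <= `|C| * `|h| `^ alpha.
      move=> s01; have [z zE] := in_domain (seg s s01); rewrite -zE zero_extensionE.
      apply: le_trans (HC z x _ _) _.
      - by rewrite zE; apply: le_lt_trans (dist s s01) hr.
      - by rewrite subrr normr0.
      apply: (le_trans (ler_wpM2r (powR_ge0 _ _) (ler_norm C))); rewrite ler_wpM2l //.
      by apply: ge0_ler_powR; rewrite ?nnegrE ?(ltW alpha_gt0) // zE dist.
    have := partial_mean_value de seg bound.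
    rewrite zero_extensionE -diff_quotient_dist // diff_quotient_comp.
    by rewrite ler_pM2r ?normr_gt0 // rnorm_distC.
  exists `|C| => _ [h [h' [h0 h'0 hr h'r ->]]].
  rewrite linearZ /= rabsM rabs_real_scalar (raddfB e) rabs_regular.
  rewrite ger0_norm ?invr_ge0 ?(ltW (w0 h h' h0)) // ler_pdivrMl ?w0 // mulrC.
  apply: le_trans (ler_rnorm_distD v _ _) _; rewrite /w mulrDr.
  by apply: lerD; [exact: quot|rewrite rnorm_distC; exact: quot].
apply: cauchy_rnorm_cvg => // c c0.
have [s s0 Hs] := powR_small (normr_ge0 M) (divr_gt0 c0 (ltr0n _ 4)).
have m0 : 0 < Num.min r s by rewrite lt_min r0.
exists [set h | h != 0 /\ `|h| < Num.min r s].
  apply/nbhs_ballP; exists (Num.min r s) => //= h; rewrite -ball_normE /= sub0r normrN.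
  by move=> hm h0; split.
move=> h h' [h0] /=; rewrite lt_min => /andP[hr hs] [h'0]; rewrite lt_min => /andP[h'r h's].
have := HM _ (ex_intro _ h (ex_intro _ h' (And5 h0 h'0 hr h'r erefl))).
rewrite rnormZr ger0_norm ?invr_ge0 ?(ltW (w0 h h' h0)) // ler_pdivrMl ?w0 // mulrC => H.
have H1 : `|M| * `|h| `^ alpha <= c / 4 by apply: Hs; rewrite normr_ge0.
have H2 : `|M| * `|h'| `^ alpha <= c / 4 by apply: Hs; rewrite normr_ge0.
have H3 : M * w h h' <= `|M| * w h h' by rewrite ler_wpM2r ?(ltW (w0 h h' h0)) // ler_norm.
rewrite -/(D h) -/(D h'); apply: le_lt_trans H _; apply: le_lt_trans H3 _.
rewrite /w mulrDr; lra.
Qed.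

(** Once [partial j f] exists in norm it commutes with every functional, so it is again weakly
    Hoelder and the induction proceeds. *)
Lemma weakly_CkHoelder k f : (forall e, continuous e -> locally_CkHoelder k (e ∘ f)) ->
  is_Ck k f.
Proof.
elim: k f => [|k IH] f Hf.
  by split=> //; apply: weakly_Hoelder_continuous => e /Hf[].
split; first by apply: weakly_Hoelder_continuous => e /Hf[].
move=> j; have dj : differentiable_along j f.
  apply: weakly_Hoelder_differentiable => e /Hf[_ /(_ j)[de]].
  by case: k {IH Hf} => [|k] [].
split=> //; apply: IH => e ce; have [_ /(_ j)[_]] := Hf e ce.
by have [_ ->] := partial_comp ce dj.
Qed.

(** Interior regularity comes first, so that functionals commute with derivatives. Uniform
    boundedness then gives global bounds, and these give equicontinuity at the boundary, hence the
    extensions, by completeness of [E]. *)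
Lemma Hoelder_weakE k : ((1 <= k)%N -> lipschitz_boundary Omega) ->
  @Hoelder R F d Omega E k alpha = @Hoelder_weak R F d Omega E k alpha.
Proof.
move=> lip; apply/seteqP; split=> f Hf; first by move=> e ce; exact: Hoelder_comp.
have Cf : is_Ck k f by apply: weakly_CkHoelder => e ce; apply/Hoelder_locally/Hf.
have mE e b : continuous e -> (mi_order b <= k)%N -> mpartial b (e ∘ f) = e ∘ (mpartial b f).
  by move=> ce bk; rewrite !mpartial_word (wpartial_comp ce Cf) // size_mi_word.
have [e ce|M HM] := @weakly_bounded R F E [set v | exists b (x : Omega),
    (mi_order b <= k)%N /\ v = mpartial b f x].
  have [_ /Hoelder_enorm_ltP[M [HM _]]] := Hf e ce.
  by exists M => _ [b [x [bk ->]]]; have := HM b x bk; rewrite mE.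
have [e ce|M' HM'] := @weakly_bounded R F E [set v | exists b (x y : Omega),
    [/\ mi_order b = k, x <> y & v = real_scalar F (enorm (val x - val y) `^ alpha)^-1 *:
      (mpartial b f x - mpartial b f y)]].
  have [_ /Hoelder_enorm_ltP[M' [_ HM']]] := Hf e ce.
  exists M' => _ [b [x [y [bk xy ->]]]]; have := HM' b x y bk xy; rewrite mE ?bk //=.
  rewrite linearZ /= rabsM rabs_real_scalar (raddfB e) rabs_regular mulrC.
  by rewrite ger0_norm // invr_ge0 powR_ge0.
have bf : Hoelder_bounded k alpha (Num.max 0 (Num.max M M')) f.
  split=> [b x bk|b x y bk xy].
    by rewrite !le_max (HM (mpartial b f x)) ?orbT //; exists b, x.
  rewrite !le_max; apply/orP; right; apply/orP; right.
  have := HM' _ (ex_intro _ b (ex_intro _ x (ex_intro _ y (And3 bk xy erefl)))).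
  by rewrite rnormZr mulrC ger0_norm // invr_ge0 powR_ge0.
split; last by apply/Hoelder_enorm_ltP; exists (Num.max 0 (Num.max M M')).
split=> // b bk; apply: (locally_cauchy_extension E_complete) => p clp c c0.
(* Adding 1 makes the bound positive, so that [c / B] is an admissible tolerance for
   equicontinuity. *)
pose B := Num.max 0 (Num.max M M') + 1.
have B0 : 0 < B by rewrite ltr_wpDl // le_max lexx.
have [r r0 Hr] := @equicontinuity _ F _ _ E _ _ Omega_open alpha_gt0 lip p _ clp (divr_gt0 c0 B0).
exists r => // x y xp yp; rewrite -[c](divfK (lt0r_neq0 B0)).
apply: Hr => //; first exact: ltW.
have MB : Num.max 0 (Num.max M M') <= B by rewrite lerDl.
by split=> [b' z bk'|b' z z' bk' zz']; apply: le_trans MB; [exact: bf.1|exact: bf.2].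
Qed.

End WeakHoelder.

Theorem corollary4p12 (R : realType) (F : RorC) (d k : nat) (alpha : R)
    (Omega : set 'rV[R]_d) (E : completeNormedModType (scalar_field R F))
    (d_gt0 : (0 < d)%N)
    (Omega_neq0 : Omega !=set0) (Omega_open : open Omega)
    (Omega_bounded : bounded_set Omega)
    (alpha_gt0 : 0 < alpha) (alpha_le1 : alpha <= 1) :
  let normE := @Hoelder_norm R F d Omega E k alpha in
  let tauE := @Ck_topology R F d Omega E k alpha in
  let tauE_K := @family_topology R F d Omega E k alpha
                  (compact_family Omega k) in
  let norm := @Hoelder_norm R F d Omega (scalar_field R F)^o k alpha in
  let tau := @Ck_topology R F d Omega (scalar_field R F)^o k alpha in
  let tau_S := @family_topology R F d Omega (scalar_field R F)^o k alpha in
  [/\ is_Saks normE tauE,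
      C_sequential (mixed_topology normE tauE),
      forall B, norm_bounded normE B -> agree_on B tauE tauE_K &
      mixed_topology normE tauE = mixed_topology normE tauE_K] /\
  (((1 <= k)%N -> lipschitz_boundary Omega) ->
   [/\ semi_Montel (mixed_topology norm tau),
       is_submixed_topology norm (tau_S (finite_family Omega k))
         (mixed_topology norm tau) &
       is_submixed_topology norm (tau_S (compact_family Omega k))
         (mixed_topology norm tau)] /\
   @Hoelder R F d Omega E k alpha = @Hoelder_weak R F d Omega E k alpha /\
   tvs_complete (mixed_topology normE tauE)).
Proof.
move=> normE tauE tauE_K norm tau tau_S.
have E_complete := complete_cauchy_complete (E := E).
have tauK : tauE_K = tauE by exact: compact_family_topologyE.
have mixE (E' : normedModType (scalar_field R F)) :
    mixed_topology (@Hoelder_norm R F d Omega E' k alpha)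
      (@Ck_topology R F d Omega E' k alpha) =
    seminorm_topology (mixed_seminorms (@Hoelder_norm R F d Omega E' k alpha)
      (@Ck_norm R F d Omega E' k alpha)).
  apply: mixed_topologyE; [exact: Hoelder_norm_seminorm|exact: Ck_norm_seminorm|].
  exact: Ck_norm_le_Hoelder.
have lscN (E' : normedModType (scalar_field R F)) :
    lsc (@Ck_norm R F d Omega E' k alpha) (@Hoelder_norm R F d Omega E' k alpha).
  have [G SG] := @Hoelder_saks_system R F d Omega E' k alpha.
  by apply: saks_lsc SG; exact: Ck_norm_seminorm.
split.
  split.
  - exact: Hoelder_is_Saks.
  - rewrite mixE; apply: mixed_topology_C_sequential.
    + exact: Hoelder_norm_seminorm.
    + exact: Ck_norm_seminorm.
    + exact: Ck_norm_le_Hoelder.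
  - by move=> B _; rewrite tauK.
  - by rewrite tauK.
move=> lip.
(* Both families induce exactly [tau], so one argument with a variable topology serves for finite
   and compact sets. *)
have submixed (T : topology (@Hoelder_space R F d Omega (scalar_field R F)^o k alpha)) :
    T = tau -> is_submixed_topology norm T (mixed_topology norm tau).
  move=> ->; split; first exact: Hoelder_is_Saks.
  move=> G SG; rewrite mixE; apply: mixed_submixed SG.
  - exact: Hoelder_norm_seminorm.
  - exact: Ck_norm_seminorm.
  - exact: Ck_norm_le_Hoelder.
  - exact: lscN.
  - by apply: Hoelder_ball_complete => //; exact: scalar_cauchy_complete.
  - exact: Hoelder_ball_ultra_cauchy.
split; last split.
- split.
  + rewrite mixE; apply: mixed_semi_Montel.
    * exact: Hoelder_norm_seminorm.
    * exact: Ck_norm_seminorm.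
    * exact: Ck_norm_le_Hoelder.
    * exact: Ck_norm_eq0.
    * exact: lscN.
    * by apply: Hoelder_ball_complete => //; exact: scalar_cauchy_complete.
    * exact: Hoelder_ball_ultra_cauchy.
    * exact: Hoelder_saks_system.
  + by apply: submixed; exact: finite_family_topologyE.
  + by apply: submixed; exact: compact_family_topologyE.
- exact: Hoelder_weakE.
- rewrite mixE; apply: mixed_complete.
  + exact: Hoelder_norm_seminorm.
  + exact: Ck_norm_seminorm.
  + exact: Ck_norm_le_Hoelder.
  + exact: lscN.
  + exact: Hoelder_ball_complete.
Qed.
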